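(* Let $u\colon\mathbb N\to\mathbb C$ be bounded by $1$ and assume that all rotations on the circle satisfy the strong $u$-MOMO property. Then $u$ satisfies the Veech condition for ${\rm DISP}$: $\pi_0$ is orthogonal in $L^2(X_u,\kappa)$ to $L^2$ of the Kronecker factor of $(X_u,\kappa,S)$, for each $\kappa\in V_S(u)$. In particular, for such $u$ the Sarnak condition $u\perp\mathscr C_{\rm DISP}$ and the Veech condition for ${\rm DISP}$ are equivalent. Moreover, for every increasing sequence $(N_\ell)$ along which $u$ is generic, $u$ satisfies the averaged 2-Chowla property $$\lim_{H\to\infty}\frac1H\sum_{h\le H}\lim_{\ell\to\infty}\frac1{N_\ell}\left|\sum_{n\le N_\ell}u(n)\overline{u(n+h)}\right|=0$$ and, for all sequences $v_1,\ldots,v_k\colon\mathbb N\to\mathbb C$ (bounded by $1$), we have $$\lim_{H\to\infty}\frac1{H^k}\sum_{h_1,\ldots,h_k\le H}\lim_{\ell\to\infty}\frac1{N_\ell}\left|\sum_{n\le N_\ell}u(n)\prod_{i=1}^kv_i(n+h_i)\right|=0 .$$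
   Context: A topological dynamical system $(X,T)$ is a homeomorphism $T$ of a compact metric space $X$. $(X,T)$ satisfies the strong $u$-MOMO property if $\lim_{K\to\infty}\frac1{b_K}\sum_{k<K}\big\|\sum_{b_k\le n<b_{k+1}}u(n)f\circ T^n\big\|_{C(X)}=0$ for each $f\in C(X)$ and each increasing sequence $(b_k)\subset\mathbb N$ with $b_{k+1}-b_k\to\infty$. A $T$-invariant Borel probability measure $\nu$ on $X$ is visible if there are $x\in X$ and an increasing $(N_\ell)$ with $\frac1{N_\ell}\sum_{n\le N_\ell}\delta_{T^nx}\to\nu$ weak-$*$. ${\rm DISP}$ is the class of measure-preserving systems with discrete spectrum (not necessarily ergodic); $\mathscr C_{\rm DISP}$ is the class of topological systems $(X,T)$ such that $(X,\mathcal B(X),\nu,T)\in{\rm DISP}$ for each visible $\nu$. $u\perp\mathscr C_{\rm DISP}$ means $\lim_{N\to\infty}\frac1N\sum_{n\le N}f(T^nx)u(n)=0$ for all $(X,T)\in\mathscr C_{\rm DISP}$, $f\in C(X)$, $x\in X$. The Kronecker factor of a measure-preserving system is its largest factor with discrete spectrum. Extend $u$ to $\mathbb Z$ by $u(-n)=u(n)$ for $n\in\mathbb N$ and any $u(0)$ with $|u(0)|\le1$. Let $S$ be the left shift on $\{z\in\mathbb C:|z|\le1\}^{\mathbb Z}$ and $X_u:=\overline{\{S^ku:k\in\mathbb Z\}}$. $u$ is generic along an increasing sequence $(N_\ell)$ if $\frac1{N_\ell}\sum_{n\le N_\ell}\delta_{S^nu}$ converges weak-$*$; $V_S(u)$ is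 the set of all such limits $\kappa$. $\pi_0\colon X_u\to\mathbb C$ is $\pi_0(z)=z_0$.
   Formalization: In the last display the inner limits over ℓ need not exist for arbitrary v_i; the formula is proved whenever they exist for all h_1,…,h_k, and, for all bounded v_i, with the limsup over ℓ taken outside the average over h_1,…,h_k. *)

(* Defs.v *)
From HB Require Import structures.
From mathcomp Require Import all_boot all_order all_algebra complex.
From mathcomp Require Import all_classical all_reals all_analysis.

Set Implicit Arguments.
Unset Strict Implicit.
Unset Printing Implicit Defensive.

Import Order.TTheory GRing.Theory Num.Theory.
Import numFieldNormedType.Exports.

Local Open Scope classical_set_scope.
Local Open Scope ring_scope.

HB.instance Definition _ (R : rcfType) := NormedModule.copy R[i] R[i]^o.

(* Measurable types of the library are pointed, hence the base point on
   compact metric spaces; no definition below depends on it. *)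
#[short(type="pmetricType")]
HB.structure Definition PointedMetric (K : numDomainType) :=
  { M of Metric K M & Pointed M }.

Definition borel (X : ptopologicalType) := g_sigma_algebraType (@open X).

Notation cabs := ComplexField.Normc.normc (only parsing).

Definition increasing (N : nat -> nat) : Prop :=
  forall m n, (m < n)%N -> (N m < N n)%N.

Section measure_preserving_systems.
Context {R : realType} {d : measure_display} {Y : measurableType d}.
Variables (mu : probability Y R) (T : Y -> Y).

Definition cintegral (f : Y -> R[i]) : R[i] :=
  Complex (\int[mu]_y complex.Re (f y)) (\int[mu]_y complex.Im (f y)).

Definition L2norm2 (f : Y -> R[i]) : \bar R :=
  (\int[mu]_y ((cabs (f y)) ^+ 2)%:E)%E.

(* [A] is a sub-sigma-algebra of [Y]; [L2 A] is the space L^2(Y, A, mu) of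
   complex functions. *)
Definition L2 (A : set (set Y)) (f : Y -> R[i]) : Prop :=
  (forall U : set R[i], open U -> A (f @^-1` U)) /\ (L2norm2 f < +oo)%E.

Definition eigenfunction (A : set (set Y)) (lam : R[i]) (g : Y -> R[i]) :
    Prop :=
  L2 A g /\ {ae mu, forall y, g (T y) = lam * g y}.

Definition discrete_spectrum (A : set (set Y)) : Prop :=
  forall f, L2 A f -> forall e : R, 0 < e ->
  exists (n : nat) (c lam : 'I_n -> R[i]) (g : 'I_n -> Y -> R[i]),
    (forall i, eigenfunction A (lam i) (g i)) /\
    (L2norm2 (fun y => f y - \sum_(i < n) c i * g i y)%R < e%:E)%E.

Definition measure_preserving : Prop :=
  measurable_fun setT T /\
  forall B : set Y, measurable B -> mu (T @^-1` B) = mu B.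

Definition DISP : Prop := measure_preserving /\ discrete_spectrum measurable.

(* The factors of an invertible system are its invariant sub-sigma-algebras. *)
Definition is_factor (A : set (set Y)) : Prop :=
  [/\ sigma_algebra setT A, A `<=` measurable & [set T @^-1` B | B in A] = A].

Definition ae_subset (A K : set (set Y)) : Prop :=
  forall B, A B -> exists2 B', K B' & mu ((B `\` B') `|` (B' `\` B)) = 0%E.

Definition is_kronecker_factor (K : set (set Y)) : Prop :=
  [/\ is_factor K, discrete_spectrum K &
      forall A, is_factor A -> discrete_spectrum A -> ae_subset A K].

End measure_preserving_systems.

Section topological_systems.
Context {R : realType}.

Definition strong_MOMO (u : nat -> R[i]) (X : topologicalType) (T : X -> X) :
    Prop :=
  forall f : X -> R[i], continuous f ->
  forall b : nat -> nat, (0 < b 0)%N -> increasing b ->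
    (fun k => (b k.+1 - b k)%N) @ \oo --> \oo ->
    (fun K => (b K)%:R^-1 * \sum_(0 <= k < K)
       sup (range (fun x =>
         cabs (\sum_(b k <= n < b k.+1) u n * f (iter n T x))))) @ \oo
      --> (0 : R).

Definition is_homeomorphism (X : topologicalType) (T : X -> X) : Prop :=
  continuous T /\
  exists T' : X -> X, [/\ continuous T', cancel T T' & cancel T' T].

Definition is_tds (X : pmetricType R) (T : X -> X) : Prop :=
  compact [set: X] /\ is_homeomorphism T.

(* The empirical measures of [x] along [N] tend weak-* to [nu]. *)
Definition quasi_generic (X : ptopologicalType) (T : X -> X) (x : X)
    (N : nat -> nat) (nu : probability (borel X) R) : Prop :=
  forall f : X -> R[i], continuous f ->
    (fun l => (N l)%:R^-1 * \sum_(1 <= n < (N l).+1) f (iter n T x)) @ \oo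
      --> cintegral nu f.

Definition visible (X : ptopologicalType) (T : X -> X)
    (nu : probability (borel X) R) : Prop :=
  measure_preserving nu T /\
  exists (x : X) (N : nat -> nat), increasing N /\ quasi_generic T x N nu.

Definition in_C_DISP (X : pmetricType R) (T : X -> X) : Prop :=
  is_tds T /\
  forall nu : probability (borel X) R, visible T nu -> DISP nu T.

Definition orthogonal_C_DISP (u : nat -> R[i]) : Prop :=
  forall (X : pmetricType R) (T : X -> X), in_C_DISP T ->
  forall f : X -> R[i], continuous f -> forall x : X,
    (fun N => N%:R^-1 * \sum_(1 <= n < N.+1) f (iter n T x) * u n) @ \oo
      --> (0 : R[i]).

Definition abs_mean (w : nat -> R[i]) (N : nat) : R :=
  N%:R^-1 * cabs (\sum_(1 <= n < N.+1) w n).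

End topological_systems.

Section circle.
Variable R : realType.

Definition circle := set_type [set z : R[i] | `|z| = 1].

HB.instance Definition _ := Topological.on circle.

Variable a : circle.

Fact rotation_subproof (x : circle) :
  \val a * \val x \in [set z : R[i] | `|z| = 1].
Proof.
apply/mem_set => /=; rewrite normrM.
by have /= -> := set_mem (valP a); have /= -> := set_mem (valP x); rewrite mulr1.
Qed.

Definition rotation (x : circle) : circle := SigSub (rotation_subproof x).

End circle.

Section subshift.
Variable R : realType.

Fact reindex_continuous (V : topologicalType) (k : int) :
  continuous (fun z : {ptws int -> V} => (fun j => z (j + k)) : {ptws int -> V}).
Proof.
move=> z.
have FF : Filter ((fun z : {ptws int -> V} =>
    (fun j => z (j + k)) : {ptws int -> V}) @ z).
  by apply: fmap_filter; exact: nbhs_filter.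
apply/cvg_sup => j U [_ [[W oW <-] Wz WU]]; apply: (filterS WU).
apply: (@proj_continuous int (fun=> V) (j + k) z W).
exact: open_nbhs_nbhs.
Qed.

Definition biseq := {ptws int -> R[i]}.

HB.instance Definition _ := Topological.on biseq.

Definition shift_by (k : int) (z : biseq) : biseq := fun j => z (j + k).

Variables (u : nat -> R[i]) (u0 : R[i]).

Definition extend : biseq := fun j => if j == 0 then u0 else u `|j|%N.

(* When [u] and [u0] are bounded by 1, the orbit lies in the closed set of
   sequences with values in the closed unit disc, so that the closure can be
   taken among all complex sequences. *)
Definition orbit_closure : set biseq :=
  closure [set z | exists k : int, z = shift_by k extend].

Definition Xu := set_type orbit_closure.

HB.instance Definition _ := Topological.on Xu.

Fact shift_by_continuous k : continuous (shift_by k).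
Proof. exact: reindex_continuous. Qed.

Fact shift_subproof (z : Xu) : shift_by 1 (\val z) \in orbit_closure.
Proof.
apply/mem_set => B nB.
have [y [[k ->] By]] := set_mem (valP z) _ (shift_by_continuous nB).
exists (shift_by 1 (shift_by k extend)); split => //.
exists (1 + k); apply/funext => j; by rewrite /shift_by addrA.
Qed.

Definition shift (z : Xu) : Xu := SigSub (shift_subproof z).

Fact point_subproof : extend \in orbit_closure.
Proof.
apply/mem_set/subset_closure; exists 0.
by apply/funext => j; rewrite /shift_by addr0.
Qed.

Definition uXu : Xu := SigSub point_subproof.

HB.instance Definition _ := isPointed.Build Xu uXu.

Definition pi0 (z : Xu) : R[i] := (\val z) 0.

Definition generic_along (N : nat -> nat) (kappa : probability (borel Xu) R) :
    Prop :=
  quasi_generic shift uXu N kappa.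

(* [kappa] belongs to V_S(u). *)
Definition in_VS (kappa : probability (borel Xu) R) : Prop :=
  exists N, increasing N /\ generic_along N kappa.

Definition Veech_DISP : Prop :=
  forall kappa : probability (borel Xu) R, in_VS kappa ->
  exists K : set (set (borel Xu)), is_kronecker_factor kappa shift K /\
    forall g : Xu -> R[i], L2 kappa K g ->
      cintegral kappa (fun z => pi0 z * conjc (g z)) = 0.

End subshift.

(* Main.v *)
Require Import Defs.
From HB Require Import structures.
From mathcomp Require Import all_boot all_order all_algebra complex.
From mathcomp Require Import all_classical all_reals all_analysis.
From mathcomp Require Import measurable_realfun.
From mathcomp Require Import ring lra zify.

Set Implicit Arguments.
Unset Strict Implicit.
Unset Printing Implicit Defensive.

Import Order.TTheory GRing.Theory Num.Theory.
Import numFieldNormedType.Exports.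

Local Open Scope classical_set_scope.
Local Open Scope ring_scope.
Local Open Scope complex_scope.

(** Testing the strong MOMO property of the rotation by $a$ on the identity
    function of the circle, with blocks chosen as badly as possible, shows that
    $\sum_{n\le N}|\sum_{h<H}a^hu(n+h)|\le eHN$ once $H$ is large and then $N$
    is large ([momo_small_exponential_sums]). The whole theorem follows from
    this estimate for all $a$ on the circle.

    Veech condition. If $\kappa$ is a limit of empirical measures of [u], the
    estimate says that $\frac1H\sum_{h<H}a^h\pi_0\circ S^h$ is small in
    $L^2(\kappa)$. For an eigenfunction $g$ with eigenvalue $\lambda$, the scalar
    product of $\pi_0$ with $g$ does not change when $\pi_0$ is replaced by this
    average at $a=\bar\lambda$, so it vanishes ([orthogonal_eigen]). The
    Kronecker factor is made of the sets whose indicators are limits of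
    combinations of bounded eigenfunctions ([kronecker_factor_exists]), and
    $\pi_0$ is orthogonal to all functions that are measurable with respect to
    it ([orthogonal_discrete]).

    Sarnak condition. It holds as well, hence the equivalence. If the means of
    $f(T^nx)u(n)$ did not tend to 0, some subsequence of times would stay away
    from 0 and generate a measure $\nu$ ([quasi_generic_exists]). This measure is
    invariant, hence visible, hence has discrete spectrum, so $f$ is close in
    $L^2(\nu)$ to a combination of eigenfunctions, each of which is close to a
    continuous $\phi$ with $\phi(T^{n+h}x)\approx\lambda^h\phi(T^nx)$ for most
    $n$. Averaging over $h<H$ brings back the short exponential sums
    ([asymptotically_orthogonal_eigen]).

    Correlations. The limits $C_{h,k}$ of the means of
    $u(n+h)\overline{u(n+k)}$ form a positive definite Toeplitz matrix, and the
    estimate says that $\sum_{h,k<H}a^{h-k}C_{h,k}\le eH^2$. Along powers of two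
    the normalised left-hand side decreases, so the bound is uniform in $a$, and
    Plancherel on a finite cyclic group yields
    $\sum_{j<H}|C_{0,j}|^2\le eH$ ([mean_square_correlation]). This is the
    averaged 2-Chowla property. For several sequences, the box of shifts is
    averaged along its diagonal, which leaves for each point of the box the
    correlations of [u] with translates of one bounded sequence; these are
    controlled by the $C_{h,k}$, uniformly in that sequence
    ([uniform_decorrelation], [box_decorrelation]). *)

(** * Continuity and the modulus of complex numbers *)

Lemma cvg_sumr (K : numFieldType) (V : normedModType K) (T I : Type)
    (F : set_system T) {FF : Filter F} (r : seq I) (P : pred I)
    (f : I -> T -> V) (l : I -> V) :
  (forall i, P i -> f i @ F --> l i) ->
  (fun t => \sum_(i <- r | P i) f i t) @ F --> \sum_(i <- r | P i) l i.
Proof. by move=> fl; apply: (cvg_big (@add_continuous V)). Qed.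

Section continuous_functions.
Variables (K : numFieldType) (T : topologicalType).
Implicit Types f g : T -> K.

Lemma continuous_mulr f g :
  continuous f -> continuous g -> continuous (fun x => f x * g x).
Proof.
by move=> cf cg x; exact: (@cvgM K T (nbhs x) _ f g (f x) (g x) (cf x) (cg x)).
Qed.

Lemma continuous_addr f g :
  continuous f -> continuous g -> continuous (fun x => f x + g x).
Proof.
by move=> cf cg x; exact: (@cvgD K K T (nbhs x) _ f g (f x) (g x) (cf x) (cg x)).
Qed.

Lemma continuous_oppr f : continuous f -> continuous (fun x => - f x).
Proof.
by move=> cf x; exact: (@cvgN K K T (nbhs x) _ f (f x) (cf x)).
Qed.

Lemma continuous_sumr (I : Type) (r : seq I) (P : pred I) (f : I -> T -> K) :
  (forall i, P i -> continuous (f i)) ->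
  continuous (fun x => \sum_(i <- r | P i) f i x).
Proof.
move=> cf x.
exact: (@cvg_sumr K K T I (nbhs x) _ r P f (fun i => f i x) (fun i Pi => cf i Pi x)).
Qed.

Lemma continuous_expr f n : continuous f -> continuous (fun x => f x ^+ n).
Proof.
move=> cf; elim: n => [|n IH]; first exact: cst_continuous.
rewrite (_ : (fun x => _) = (fun x => f x * f x ^+ n)); last first.
  by apply/funext => x; rewrite exprS.
exact: continuous_mulr.
Qed.

End continuous_functions.

Section complex_modulus.
Variable R : realType.
Implicit Types (z w : R[i]) (e : R).

Lemma cabs_ge0 z : 0 <= cabs z.
Proof. by case: z => a b /=; exact: sqrtr_ge0. Qed.

Lemma normr_cabs z : `|z| = (cabs z)%:C.
Proof. by case: z. Qed.

Lemma cabsE z : cabs z ^+ 2 = complex.Re z ^+ 2 + complex.Im z ^+ 2.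
Proof. by case: z => a b /=; rewrite sqr_sqrtr // addr_ge0 // sqr_ge0. Qed.

Lemma cabs2 z : z * conjc z = (cabs z ^+ 2)%:C.
Proof.
case: z => a b; rewrite cabsE /=; apply/eqP; rewrite eq_complex /=.
by apply/andP; split; apply/eqP; ring.
Qed.

Lemma cabsM z w : cabs (z * w) = cabs z * cabs w.
Proof. exact: ComplexField.Normc.normcM. Qed.

Lemma cabsD z w : cabs (z + w) <= cabs z + cabs w.
Proof. exact: le_normcD. Qed.

Lemma cabsN z : cabs (- z) = cabs z.
Proof. exact: normcN. Qed.

Lemma cabsB z w : cabs (z - w) = cabs (w - z).
Proof. by rewrite -cabsN opprB. Qed.

Lemma cabs0 : cabs (0 : R[i]) = 0. Proof. exact: ComplexField.Normc.normc0. Qed.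

Lemma cabs1 : cabs (1 : R[i]) = 1. Proof. exact: ComplexField.Normc.normc1. Qed.

Lemma cabs_real (x : R) : cabs x%:C = `|x|.
Proof. by rewrite /= expr0n /= addr0 sqrtr_sqr. Qed.

Lemma cabs_conj z : cabs (conjc z) = cabs z.
Proof. by case: z => a b /=; rewrite sqrrN. Qed.

Lemma cabsX z n : cabs (z ^+ n) = cabs z ^+ n.
Proof. by elim: n => [|n IH]; rewrite ?expr0 ?cabs1 // !exprS cabsM IH. Qed.

Lemma cabsV z : cabs z^-1 = (cabs z)^-1.
Proof. exact: ComplexField.Normc.normcV. Qed.

Lemma cabs_nat n : cabs (n%:R : R[i]) = n%:R.
Proof. by rewrite -(rmorph_nat (real_complex R)) cabs_real ger0_norm. Qed.

Lemma cabs_sum (I : Type) (r : seq I) (P : pred I) (F : I -> R[i]) :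
  cabs (\sum_(i <- r | P i) F i) <= \sum_(i <- r | P i) cabs (F i).
Proof.
elim/big_rec2: _ => [|i y z _ h]; first by rewrite cabs0.
by rewrite (le_trans (cabsD _ _)) // lerD2l.
Qed.

Lemma cabs_prod (I : Type) (r : seq I) (P : pred I) (F : I -> R[i]) :
  cabs (\prod_(i <- r | P i) F i) = \prod_(i <- r | P i) cabs (F i).
Proof. by apply: (big_morph _ cabsM cabs1). Qed.

Lemma ler_cabsB z w : cabs z - cabs w <= cabs (z - w).
Proof. by rewrite lerBlDr (le_trans _ (cabsD _ _)) // subrK. Qed.

Lemma dist_cabs z w : `|cabs z - cabs w| <= cabs (z - w).
Proof. by rewrite ler_norml ler_cabsB andbT lerNl opprB cabsB ler_cabsB. Qed.

Lemma Re_cabs z : `|complex.Re z| <= cabs z.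
Proof.
rewrite -ler_sqr ?nnegrE ?normr_ge0 ?cabs_ge0 // cabsE real_normK ?num_real //.
by rewrite lerDl sqr_ge0.
Qed.

Lemma Im_cabs z : `|complex.Im z| <= cabs z.
Proof.
rewrite -ler_sqr ?nnegrE ?normr_ge0 ?cabs_ge0 // cabsE real_normK ?num_real //.
by rewrite lerDr sqr_ge0.
Qed.

Lemma cabs_eq0 z : cabs z = 0 -> z = 0.
Proof. exact: ComplexField.Normc.eq0_normc. Qed.

Lemma cabs_le_ReIm z : cabs z <= `|complex.Re z| + `|complex.Im z|.
Proof.
rewrite -ler_sqr ?nnegrE ?cabs_ge0 ?addr_ge0 // cabsE sqrrD.
by rewrite !real_normK ?num_real // lerD2r lerDl mulrn_wge0 // mulr_ge0.
Qed.

(** All estimates in the square norm use this form of the triangle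
    inequality, as it needs no square roots. *)
Lemma cabsD_sqr z w : cabs (z + w) ^+ 2 <= 2 * cabs z ^+ 2 + 2 * cabs w ^+ 2.
Proof.
have /(lerXn2r 2) := cabsD z w; rewrite !nnegrE ?addr_ge0 ?cabs_ge0 //.
move=> /(_ isT isT) /le_trans; apply.
rewrite -subr_ge0 (_ : _ - _ = (cabs z - cabs w) ^+ 2) ?sqr_ge0 //; ring.
Qed.

Lemma ball_cabs z e w : ball z e%:C w <-> cabs (z - w) < e.
Proof. by rewrite -ball_normE /= normr_cabs ltcR. Qed.

Lemma nbhs_cabs z (A : set R[i]) :
  nbhs z A <-> exists2 e, 0 < e & forall w, cabs (z - w) < e -> A w.
Proof.
split=> [/nbhs_ballP [e /= e0 eA]|[e e0 eA]].
  have ee : e = (complex.Re e)%:C by rewrite RRe_real // gtr0_real.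
  rewrite ee in e0 eA; exists (complex.Re e); first by rewrite -ltcR.
  by move=> w /ball_cabs; exact: eA.
apply/nbhs_ballP; exists e%:C => /=; first by rewrite ltcR.
by move=> w /ball_cabs; exact: eA.
Qed.

Lemma cvg_cabsP (T : Type) (F : set_system T) (FF : Filter F) (f : T -> R[i]) z :
  f @ F --> z <-> forall e, 0 < e -> \forall x \near F, cabs (f x - z) < e.
Proof.
split=> [fz e e0|fz A /nbhs_cabs [e e0 eA]].
  apply: (fz [set w | cabs (w - z) < e]); apply/nbhs_cabs.
  by exists e => // w; rewrite /= cabsB.
rewrite /= /nbhs /=; near=> x; apply: eA; rewrite cabsB; near: x; exact: fz.
Unshelve. all: by end_near. Qed.

Lemma continuous_cabsP (T : topologicalType) (f : T -> R[i]) :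
  continuous f <->
  forall x e, 0 < e -> \forall y \near x, cabs (f y - f x) < e.
Proof. by split=> cf x; have /cvg_cabsP := cf x. Qed.

Lemma cabs_continuous : continuous (fun z => cabs z : R).
Proof.
move=> z; apply/(@cvgrPdist_lt _ R^o _ _ (nbhs_filter z)) => e e0.
apply/nbhs_cabs; exists e => // w zw; rewrite (le_lt_trans _ zw) //.
exact: dist_cabs.
Qed.

Lemma Re_continuous : continuous (fun z => complex.Re z : R).
Proof.
move=> z; apply/(@cvgrPdist_lt _ R^o _ _ (nbhs_filter z)) => e e0.
apply/nbhs_cabs; exists e => // w zw; rewrite (le_lt_trans _ zw) //.
by rewrite (le_trans _ (Re_cabs _)) // raddfB.
Qed.

Lemma Im_continuous : continuous (fun z => complex.Im z : R).
Proof.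
move=> z; apply/(@cvgrPdist_lt _ R^o _ _ (nbhs_filter z)) => e e0.
apply/nbhs_cabs; exists e => // w zw; rewrite (le_lt_trans _ zw) //.
by rewrite (le_trans _ (Im_cabs _)) // raddfB.
Qed.

Lemma conjc_continuous : continuous (@conjc R).
Proof.
apply/continuous_cabsP => z e e0; apply/nbhs_cabs; exists e => // w zw.
by rewrite -rmorphB cabs_conj cabsB.
Qed.

Lemma continuous_conjc (T : topologicalType) (f : T -> R[i]) :
  continuous f -> continuous (fun x => conjc (f x)).
Proof.
move=> cf x; apply: (@continuous_comp _ _ _ f (@conjc R)); first exact: cf.
exact: conjc_continuous.
Qed.

Lemma real_complex_continuous : continuous (fun x : R => x%:C : R[i]).
Proof.
apply/continuous_cabsP => x e e0.
apply/nbhs_ballP; exists e => // y; rewrite -ball_normE => xy.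
by rewrite /mkset -(rmorphB (real_complex R)) cabs_real distrC.
Qed.

End complex_modulus.

(** * Short exponential sums *)

Section blocks_to_windows.
Variables (R : realType) (G : nat -> nat -> R).
Hypothesis G0 : forall m n, 0 <= G m n.

Hypothesis small_blocks : forall b : nat -> nat, (0 < b 0)%N -> increasing b ->
  (fun k => (b k.+1 - b k)%N) @ \oo --> \oo ->
  (fun K => (b K)%:R^-1 * \sum_(0 <= k < K) G (b k) (b k.+1)) @ \oo
    --> (0 : R).

(** By pigeonhole one residue class modulo $H$ carries its share of the sum;
    along a residue class the windows of length $H$ are consecutive disjoint
    blocks. *)
Lemma heavy_residue (e : R) (H N : nat) : (0 < H)%N ->
  e * H%:R * N%:R < \sum_(1 <= n < N.+1) G n (n + H) ->
  exists2 r, (r < H)%N &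
    e * N%:R < \sum_(1 <= n < N.+1 | (n %% H == r)%N) G n (n + H).
Proof.
move=> H0 big; apply: contrapT => /forall2NP small.
suff : \sum_(1 <= n < N.+1) G n (n + H) <= e * H%:R * N%:R by rewrite leNgt big.
have -> : \sum_(1 <= n < N.+1) G n (n + H)%N =
    \sum_(r < H) \sum_(1 <= n < N.+1 | (n %% H == r)%N) G n (n + H)%N.
  under [RHS]eq_bigr do rewrite big_mkcond.
  rewrite exchange_big /=; apply: eq_bigr => n _.
  rewrite -big_mkcond; apply/esym/(big_pred1 (Ordinal (ltn_pmod n H0))) => r.
  by rewrite /= -val_eqE /= eq_sym.
apply: (@le_trans _ _ (\sum_(r < H) e * N%:R)).
  by apply: ler_sum => r _; have [/(_ (ltn_ord r))//|/negP] := small r; rewrite -leNgt.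
by rewrite sumr_const card_ord mulrAC [X in _ <= X]mulr_natr lexx.
Qed.

Variable e : R.
Hypothesis e0 : 0 < e.
Hypothesis bad : forall H0, exists2 H, (H0 <= H)%N &
  forall N0, exists2 N, (N0 <= N)%N &
    e * H%:R * N%:R < \sum_(1 <= n < N.+1) G n (n + H).

(** A stage that starts at $M$ consists of a window length $H$, a residue $r$
    and a horizon $N$ so distant that the windows starting in $(M+H,N]$ at
    points of the class of $r$ modulo $H$ carry more than $eN/2$. The index
    $i$ forces the window lengths and the horizons to infinity. *)
Definition stage_spec (i M : nat) (s : nat * nat * nat) :=
  let: (H, r, N) := s in
  [/\ (i < H)%N, (r < H)%N, (M <= N)%N, (H <= N)%N & (i <= N)%N /\
    e / 2 * N%:R < \sum_((M + H).+1 <= n < N.+1 | (n %% H == r)%N) G n (n + H)].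

(** The sum over the windows that start up to $M+H$ is fixed while $N$ is
    arbitrarily large, so dropping it costs at most half of $eN$. *)
Lemma stage_exists (i M : nat) : exists s, stage_spec i M s.
Proof.
have [H iH /= badH] := bad i.+1; have H0 : (0 < H)%N := leq_trans (ltn0Sn _) iH.
pose C := \sum_(1 <= n < (M + H).+1) G n (n + H).
have C0 : 0 <= C by apply: sumr_ge0.
pose N0 := (Num.truncn (2 / e * C)).+1.
have [N] := badH (maxn (maxn (M + H) i) N0).
rewrite !geq_max => /andP[/andP[MN iN] NN] /(heavy_residue H0) [r rH big].
have CN : C <= e / 2 * N%:R.
  rewrite -ler_pdivrMl ?divr_gt0 // invf_div.
  apply: (@le_trans _ _ N0%:R); last by rewrite ler_nat.
  by apply: ltW; rewrite truncnS_gt.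
exists (H, r, N); split=> //; [lia|lia|split=> //].
rewrite (big_cat_nat (n := (M + H).+1)) //= in big.
have : \sum_(1 <= n < (M + H).+1 | (n %% H == r)%N) G n (n + H) <= C.
  by rewrite /C big_mkcond /=; apply: ler_sum => n _; case: ifP.
lra.
Qed.

Definition stage i M := sval (cid (stage_exists i M)).
Definition stage_length i M := (stage i M).1.1.
Definition stage_residue i M := (stage i M).1.2.
Definition stage_horizon i M := (stage i M).2.

Lemma stageP i M : [/\ (i < stage_length i M)%N, (stage_residue i M < stage_length i M)%N,
  (M <= stage_horizon i M)%N, (stage_length i M <= stage_horizon i M)%N & (i <= stage_horizon i M)%N /\
    e / 2 * (stage_horizon i M)%:R <
    \sum_((M + stage_length i M).+1 <= n < (stage_horizon i M).+1 | (n %% stage_length i M == stage_residue i M)%N)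
       G n (n + stage_length i M)].
Proof.
by rewrite /stage_length /stage_residue /stage_horizon /stage; case: cid => -[[H r] N].
Qed.

(** A stage ends one window after its horizon, which leaves room for a
    breakpoint past the horizon. *)
Fixpoint start i :=
  if i is j.+1 then (stage_horizon j (start j) + stage_length j (start j))%N else 0%N.

Local Notation H_ i := (stage_length i (start i)).
Local Notation r_ i := (stage_residue i (start i)).
Local Notation N_ i := (stage_horizon i (start i)).

Definition in_stage i m :=
  [&& (start i + H_ i < m)%N, (m <= start i.+1)%N & (m %% H_ i == r_ i)%N].

Definition breakpoint m := `[< exists i, in_stage i m >].

Lemma start_mono i j : (i <= j)%N -> (start i <= start j)%N.
Proof.
move/subnK <-; elim: (j - i)%N => // k IH; rewrite addSn (leq_trans IH) //=.
by have [_ _ h _ _] := stageP (k + i) (start (k + i)); rewrite (leq_trans h) ?leq_addr.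
Qed.

Lemma stage_order i j m m' :
  in_stage i m -> in_stage j m' -> (m < m')%N -> (i <= j)%N.
Proof.
move=> /and3P[im _ _] /and3P[_ jm' _] mm'; rewrite leqNgt; apply/negP => ji.
have := start_mono ji; move: im jm' mm'; lia.
Qed.

(** Breakpoints of the same stage are congruent modulo its window length; a
    breakpoint of a later stage is separated from the start of its stage by a
    window of that stage. *)
Lemma breakpoint_gap i m m' :
  in_stage i m -> breakpoint m' -> (m < m')%N -> (m + H_ i <= m')%N \/
    (exists2 j, (i < j)%N & (start i.+1 + H_ j < m')%N).
Proof.
move=> im /asboolP [j jm'] mm'.
have := stage_order im jm' mm'; rewrite leq_eqVlt => /orP [/eqP ij|ij].
  left; rewrite -ij in jm'; case/and3P: im => _ _ /eqP mr.
  case/and3P: jm' => _ _ /eqP m'r.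
  have Hd : (H_ i %| m' - m)%N by rewrite -eqn_mod_dvd ?(ltnW mm') // mr m'r.
  have := dvdn_leq _ Hd; rewrite subn_gt0 mm' => /(_ isT); lia.
right; exists j => //; case/and3P: jm' => jm' _ _.
by rewrite (leq_ltn_trans _ jm') // leq_add2r start_mono.
Qed.

Lemma residue_in_window H r m : (r < H)%N ->
  exists m', [/\ (m < m')%N, (m' <= m + H)%N & (m' %% H == r)%N].
Proof.
move=> rH; have H0 : (0 < H)%N by lia.
have mE := divn_eq m H; have mH := ltn_pmod m H0.
case: (ltnP (m %% H)%N r) => rm.
  exists (m %/ H * H + r)%N; split; [lia|lia|by rewrite modnMDl modn_small].
exists (m %/ H * H + H + r)%N; split; [lia|lia|].
by rewrite -addnA modnMDl modnDl modn_small.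
Qed.

Lemma stage_break i : exists m, [/\ in_stage i m, (N_ i < m)%N & (m <= N_ i + H_ i)%N].
Proof.
have [iH rH MN HN [iN big]] := stageP i (start i).
have NH : (start i + H_ i <= N_ i)%N.
  rewrite leqNgt; apply/negP => NH; move: big; rewrite big_geq ?ltnS ?(ltnW NH) //.
  by rewrite ltNge mulr_ge0 // ltW // divr_gt0.
have [m [Nm mN mr]] := residue_in_window (N_ i) rH.
by exists m; split=> //; apply/and3P; split=> //; rewrite (leq_ltn_trans NH).
Qed.

Lemma breakpoint_inf m : exists m', (m < m')%N && breakpoint m'.
Proof.
have [m' [im' Nm' _]] := stage_break m; exists m'; apply/andP; split; last first.
  by apply/asboolP; exists m.
by have [_ _ _ _ [mN _]] := stageP m (start m); exact: leq_ltn_trans Nm'.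
Qed.

Definition next m := ex_minn (breakpoint_inf m).

Lemma next_gt m : (m < next m)%N.
Proof. by rewrite /next; case: ex_minnP => ? /andP[]. Qed.

Lemma next_break m : breakpoint (next m).
Proof. by rewrite /next; case: ex_minnP => ? /andP[]. Qed.

Lemma next_min m m' : (m < m')%N -> breakpoint m' -> (next m <= m')%N.
Proof.
by move=> mm' bm'; rewrite /next; case: ex_minnP => ? _; apply; rewrite mm'.
Qed.

Definition breaks k := iter k.+1 next 0%N.

Lemma breaksS k : breaks k.+1 = next (breaks k). Proof. by []. Qed.

Lemma breaks_inc : increasing breaks.
Proof.
move=> m n /subnK <-; elim: (n - m.+1)%N => [|k IH]; first exact: next_gt.
by rewrite addSn (ltn_trans IH) // next_gt.
Qed.

Lemma breaks_ge k : (k < breaks k)%N.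
Proof. elim: k => [|k IH]; [exact: next_gt|exact: leq_ltn_trans IH (next_gt _)]. Qed.

Lemma next_gap i m : in_stage i m -> (m + i < next m)%N.
Proof.
move=> im; case: (breakpoint_gap im (next_break m) (next_gt m)) => [|[j ij]].
  have [iH _ _ _ _] := stageP i (start i); lia.
have [jH _ _ _ _] := stageP j (start j).
case/and3P: im => _ im _; lia.
Qed.

Lemma next_stage i m : in_stage i m -> (m <= N_ i)%N -> next m = (m + H_ i)%N.
Proof.
move=> im mN; have [iH rH MN HN [iN big]] := stageP i (start i).
apply/eqP; rewrite eqn_leq; apply/andP; split.
  apply: next_min; first by lia.
  apply/asboolP; exists i; case/and3P: im => a b c; apply/and3P; split.
  - by lia.
  - by rewrite /= leq_add2r.
  - by rewrite modnDr.
case: (breakpoint_gap im (next_break m) (next_gt m)) => [//|[j ij]].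
by apply: leq_trans; rewrite /= (leq_trans _ (leqnSn _)) //; lia.
Qed.

Lemma breaks_gap : (fun k => (breaks k.+1 - breaks k)%N) @ \oo --> \oo.
Proof.
move=> A [n _ nA]; exists (start n) => // k /= nk; apply: nA => /=.
have /asboolP [i ik] : breakpoint (breaks k) by exact: next_break.
have : (n <= i)%N.
  rewrite leqNgt; apply/negP => /start_mono; case/and3P: ik => _ ik _.
  have := breaks_ge k; lia.
have := next_gap ik; rewrite -breaksS; lia.
Qed.

Lemma sum_breaks (F : nat -> R) K :
  \sum_(0 <= k < K) F (breaks k) = \sum_(1 <= m < breaks K | breakpoint m) F m.
Proof.
have skip m n : (n <= next m)%N ->
    \sum_(m.+1 <= j < n | breakpoint j) F j = 0.
  move=> nm; rewrite big_nat_cond big1 // => j /andP[/andP[mj jn] bj].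
  by have := next_min mj bj; rewrite leqNgt (leq_trans jn).
elim: K => [|K IH]; first by rewrite big_geq // skip.
rewrite big_nat_recr //= IH (big_cat_nat (n := breaks K) (p := breaks K.+1)) /=; last 2 first.
- by have := breaks_ge K; lia.
- exact/ltnW/next_gt.
congr (_ + _); rewrite big_ltn_cond ?next_gt // ifT; last exact: next_break.
by rewrite skip ?addr0.
Qed.

(** Let $K$ be the index of the first breakpoint past the horizon $N$ of a
    stage. All windows counted in the stage are blocks of index less than
    $K$, and this breakpoint is at most $2N$, so that the normalisation loses
    a factor 2. *)
Lemma bad_breaks i : exists2 K, (N_ i < breaks K)%N &
  e / 4 <= (breaks K)%:R^-1 * \sum_(0 <= k < K) G (breaks k) (breaks k.+1).
Proof.
have [iH rH MN HN [iN big]] := stageP i (start i).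
have ex : exists K, (N_ i < breaks K)%N by exists (N_ i); exact: breaks_ge.
case: (ex_minnP ex) => K NK Kmin; exists K => //.
have KN : (breaks K <= N_ i + H_ i)%N.
  have [m [im Nm mN]] := stage_break i; rewrite (leq_trans _ mN) //.
  have bm : breakpoint m by apply/asboolP; exists i.
  case: K NK Kmin => [|K] NK Kmin; first by apply: next_min => //; lia.
  rewrite breaksS; apply: next_min => //; rewrite (leq_ltn_trans _ Nm) //.
  by rewrite leqNgt; apply/negP => /Kmin; rewrite ltnn.
have N0 : (0 < N_ i)%N by lia.
rewrite ler_pdivlMl ?ltr0n; last by lia.
rewrite (sum_breaks (fun m => G m (next m))).
apply: (@le_trans _ _ (e / 2 * (N_ i)%:R)).
  have : 0 <= (N_ i)%:R + (N_ i)%:R - (breaks K)%:R :> R.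
    by rewrite subr_ge0 -natrD ler_nat (leq_trans KN) // leq_add2l.
  move/(mulr_ge0 (ltW e0)); lra.
apply: (le_trans (ltW big)).
have incl m : [&& ((start i + H_ i).+1 <= m)%N, (m < (N_ i).+1)%N & (m %% H_ i == r_ i)%N] -> in_stage i m.
  case/and3P => a b c; apply/and3P; split=> //; rewrite /=; lia.
rewrite big_nat_cond.
rewrite (eq_bigr (fun m => G m (next m))); last first.
  move=> m /andP[/andP[a b] c]; rewrite (next_stage (i := i)) ?incl ?a ?b ?c //.
rewrite -big_nat_cond [X in _ <= X](big_cat_nat (n := (start i + H_ i).+1)) /=; last 2 first.
- by [].
- case: (leqP (start i + H_ i) (N_ i)) => h; first by lia.
  move: big; rewrite big_geq //; last by lia.
  by rewrite ltNge mulr_ge0 // ltW // divr_gt0.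
have NH : (start i + H_ i <= N_ i)%N.
  rewrite leqNgt; apply/negP => h; move: big; rewrite big_geq; last by lia.
  by rewrite ltNge mulr_ge0 // ltW // divr_gt0.
rewrite [X in _ + X](big_cat_nat (n := (N_ i).+1)) ?ltnS //=.
rewrite addrCA -[X in X <= _]addr0 lerD ?addr_ge0 ?sumr_ge0 //.
rewrite big_nat_cond [X in _ <= X]big_nat_cond big_mkcond [X in _ <= X]big_mkcond /=.
apply: ler_sum => m _; case: ifPn => [/andP[/andP[a b] c]|_]; last by case: ifP.
rewrite a b /= ifT //; apply/asboolP; exists i; apply: incl; exact/and3P.
Qed.

Lemma bad_contradiction : False.
Proof.
have /(@cvgrPdist_lt _ R^o) small : _ :=
  small_blocks (b := breaks) (next_gt 0%N) breaks_inc breaks_gap.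
have [K0 _ K0P] := small (e / 4) (divr_gt0 e0 (ltr0n _ 4)).
have [K NK] := bad_breaks (breaks K0).
have [_ _ _ _ [iN _]] := stageP (breaks K0) (start (breaks K0)).
have K0K : (K0 <= K)%N.
  rewrite leqNgt; apply/negP => /breaks_inc; lia.
have := K0P _ K0K; rewrite sub0r normrN => /ltr_normlW; lra.
Qed.

End blocks_to_windows.

(** If the conclusion fails for arbitrarily long windows, the hypothesis
    fails for one sequence of breakpoints: on successive, very long stages
    the breakpoints run through the residue class modulo the current window
    length that carries most of the mass. *)
Lemma small_windows (R : realType) (G : nat -> nat -> R) :
  (forall m n, 0 <= G m n) ->
  (forall b : nat -> nat, (0 < b 0)%N -> increasing b ->
    (fun k => (b k.+1 - b k)%N) @ \oo --> \oo ->
    (fun K => (b K)%:R^-1 * \sum_(0 <= k < K) G (b k) (b k.+1)) @ \oo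
      --> (0 : R)) ->
  forall e, 0 < e -> exists H0, forall H, (H0 <= H)%N ->
  exists N0, forall N, (N0 <= N)%N ->
    \sum_(1 <= n < N.+1) G n (n + H) <= e * H%:R * N%:R.
Proof.
move=> G0 small e e0; apply: contrapT => /forallNP bad.
apply: (bad_contradiction G0 small e0) => H0.
have /existsNP [H /not_implyP [H0H /forallNP badH]] := bad H0.
exists H => // N0; have /existsNP [N /not_implyP [N0N /negP]] := badH N0.
by rewrite -ltNge; exists N.
Qed.

Section circle_rotations.
Variables (R : realType) (u : nat -> R[i]).

Lemma cabs_circle (a : circle R) : cabs (\val a) = 1.
Proof.
have /= := set_mem (valP a); rewrite normr_cabs => /eqP.
by rewrite eq_complex /= eqxx andbT => /eqP.
Qed.

Lemma iter_rotation (a x : circle R) n :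
  \val (iter n (rotation a) x) = \val a ^+ n * \val x.
Proof. by elim: n => [|n IH]; rewrite ?mul1r //= IH exprS mulrA. Qed.

Lemma circle_point (a : R[i]) : cabs a = 1 -> exists b : circle R, \val b = a.
Proof.
move=> a1; have aP : a \in [set z : R[i] | `|z| = 1].
  by apply/mem_set; rewrite /= normr_cabs a1.
by exists (SigSub aP).
Qed.

Definition small_exponential_sums : Prop :=
  forall a : R[i], cabs a = 1 ->
  forall e : R, 0 < e -> exists H0, forall H, (H0 <= H)%N ->
  exists N0, forall N, (N0 <= N)%N ->
    \sum_(1 <= n < N.+1) cabs (\sum_(h < H) a ^+ h * u (n + h)%N)
      <= e * H%:R * N%:R.

(** For the identity function of the circle the supremum over the starting
    point is a constant: the starting point contributes a factor of modulus
    1, and the block sums are those of $u(n)a^n$. Blocks are then traded for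
    windows by [small_windows]. *)
Lemma momo_small_exponential_sums :
  (forall b : circle R, strong_MOMO u (rotation b)) -> small_exponential_sums.
Proof.
move=> momo a a1 e e0; have [b ba] := circle_point a1.
pose G m n := cabs (\sum_(m <= j < n) u j * a ^+ j) : R.
have valc : continuous (fun x : circle R => \val x : R[i]).
  exact: initial_continuous.
have G0 m n : 0 <= G m n by exact: cabs_ge0.
have small q : (0 < q 0)%N -> increasing q ->
    (fun k => (q k.+1 - q k)%N) @ \oo --> \oo ->
    (fun K => (q K)%:R^-1 * \sum_(0 <= k < K) G (q k) (q k.+1)) @ \oo
      --> (0 : R).
  move=> q0 qinc qgap; have := momo b _ valc q q0 qinc qgap.
  apply: cvg_trans; apply: near_eq_cvg; near=> K.
  congr (_ * _); apply: eq_bigr => k _.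
  have same x : cabs (\sum_(q k <= n < q k.+1) u n * \val (iter n (rotation b) x))
      = G (q k) (q k.+1).
    under eq_bigr do rewrite iter_rotation ba mulrA.
    by rewrite -mulr_suml cabsM cabs_circle mulr1.
  rewrite -[RHS]sup1; congr sup.
  apply/seteqP; split=> [_ [x _ <-]|_ ->] /=; first by rewrite same.
  by exists b; rewrite ?same.
have [H0 H0P] := small_windows G0 small e0.
exists H0 => H /H0P [N0 N0P]; exists N0 => N /N0P; apply: le_trans.
apply: ler_sum => n _; rewrite /G -{2}[n]add0n big_addn addKn big_mkord.
under [X in cabs X <= _]eq_bigr do rewrite mulrC addnC.
under [X in _ <= cabs X]eq_bigr do rewrite exprD mulrA.
by rewrite -mulr_suml cabsM cabsX a1 expr1n mulr1.
Unshelve. all: by end_near. Qed.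

End circle_rotations.

(** * Positive definite Toeplitz matrices *)

Lemma circle_compact (R : realType) : compact [set a : R[i] | cabs a = 1].
Proof.
pose f (p : R * R) : R[i] := p.1%:C + 'i * p.2%:C.
have cf : continuous f.
  apply: continuous_addr; last apply: continuous_mulr.
  - move=> p; apply: (@continuous_comp _ _ _ fst (fun x : R => x%:C : R[i])).
      exact: cvg_fst.
    exact: real_complex_continuous.
  - exact: cst_continuous.
  - move=> p; apply: (@continuous_comp _ _ _ snd (fun x : R => x%:C : R[i])).
      exact: cvg_snd.
    exact: real_complex_continuous.
have cK := compact_setX (@segment_compact R (-1) 1) (@segment_compact R (-1) 1).
have cfK : compact (f @` (`[-1, 1] `*` `[-1, 1])).
  by apply: continuous_compact cK; exact: continuous_subspaceT.
apply: (subclosed_compact _ cfK) => [|a /= a1].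
  apply: (@closed_comp _ _ (fun a : R[i] => cabs a : R) [set 1]).
    by move=> a _; exact: cabs_continuous.
  exact: closed_eq.
exists (complex.Re a, complex.Im a); last by rewrite /f /= [RHS]complexE.
by split; rewrite /= in_itv /= -ler_norml -a1 ?Re_cabs ?Im_cabs.
Qed.

Section toeplitz.
Variables (R : realType) (C : nat -> nat -> R[i]).
Hypothesis toeplitz : forall h k, C h.+1 k.+1 = C h k.
Hypothesis hermitian : forall h k, C k h = conjc (C h k).
Hypothesis psd : forall n (c : nat -> R[i]),
  0 <= \sum_(h < n) \sum_(k < n) c h * conjc (c k) * C h k.

Lemma toeplitzD h k n : C (h + n)%N (k + n)%N = C h k.
Proof. by elim: n => [|n IH]; rewrite ?addn0 // !addnS toeplitz. Qed.

Lemma toeplitz_eq p q h k : (p + h = q + k)%N -> C q p = C h k.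
Proof.
move=> e; rewrite -(toeplitzD q p k) -(toeplitzD h k p) -e.
by rewrite [(h + p)%N]addnC [(k + p)%N]addnC.
Qed.

Definition toeplitz_form H (a : R[i]) : R[i] :=
  \sum_(h < H) \sum_(k < H) a ^+ h * conjc (a ^+ k) * C h k.

Lemma toeplitz_form_ge0 H a : 0 <= toeplitz_form H a. Proof. exact: psd. Qed.

Definition toeplitz_form_re H a : R := complex.Re (toeplitz_form H a).

Lemma toeplitz_formE H a : toeplitz_form H a = (toeplitz_form_re H a)%:C.
Proof. by rewrite RRe_real // ger0_real // toeplitz_form_ge0. Qed.

Lemma cabs1_conj (a : R[i]) : cabs a = 1 -> a * conjc a = 1.
Proof. by move=> a1; rewrite cabs2 a1 expr1n. Qed.

(** Positivity of the form with the sign of the second half changed is the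
    inequality $\|x+y\|^2\le 2\|x\|^2+2\|y\|^2$ for the two halves $x$ and
    $y$; the two diagonal blocks agree because the matrix is Toeplitz and
    $|a|=1$. *)
Lemma toeplitz_form_double H a : cabs a = 1 -> toeplitz_form (H + H) a <= 4 * toeplitz_form H a.
Proof.
move=> a1.
pose F h k := a ^+ h * conjc (a ^+ k) * C h k.
have split4 (s t : nat -> R[i]) :
    \sum_(h < H + H) \sum_(k < H + H) s h * t k * F h k =
    \sum_(h < H) \sum_(k < H) s h * t k * F h k
    + \sum_(h < H) \sum_(k < H) s h * t (H + k)%N * F h (H + k)%N
    + (\sum_(h < H) \sum_(k < H) s (H + h)%N * t k * F (H + h)%N k
    + \sum_(h < H) \sum_(k < H) s (H + h)%N * t (H + k)%N * F (H + h)%N (H + k)%N).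
  by rewrite big_split_ord /=; congr (_ + _); rewrite -big_split /=;
     apply: eq_bigr => h _; rewrite big_split_ord.
have shift h k : F (H + h)%N (H + k)%N = F h k.
  rewrite /F ![(H + _)%N]addnC toeplitzD !exprD rmorphM /= mulrACA.
  by rewrite cabs1_conj ?mulr1 // cabsX a1 expr1n.
pose sg h : R[i] := if (h < H)%N then 1 else -1.
have sgl (h : 'I_H) : sg h = 1 by rewrite /sg ltn_ord.
have sgr (h : 'I_H) : sg (H + h)%N = -1 by rewrite /sg ltnNge leq_addr.
have := psd (H + H) (fun h => sg h * a ^+ h).
have -> : \sum_(h < H + H) \sum_(k < H + H)
    sg h * a ^+ h * conjc (sg k * a ^+ k) * C h k
    = \sum_(h < H + H) \sum_(k < H + H) sg h * sg k * F h k.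
  apply: eq_bigr => h _; apply: eq_bigr => k _; rewrite rmorphM /=.
  have -> : conjc (sg k) = sg k by rewrite /sg; case: ifP; rewrite ?rmorphN rmorph1.
  by rewrite /F; ring.
rewrite split4.
have -> : toeplitz_form (H + H) a = \sum_(h < H + H) \sum_(k < H + H) 1 * 1 * F h k.
  by apply: eq_bigr => h _; apply: eq_bigr => k _; rewrite !mul1r.
rewrite (split4 (fun=> 1) (fun=> 1)) /=.
set A1 := \sum_(h < H) _; set A2 := \sum_(h < H) _.
set A3 := \sum_(h < H) _; set A4 := \sum_(h < H) _.
set B1 := \sum_(h < H) _; set B2 := \sum_(h < H) _.
set B3 := \sum_(h < H) _; set B4 := \sum_(h < H) _.
have -> : A1 = toeplitz_form H a.
  by apply: eq_bigr => h _; apply: eq_bigr => k _; rewrite !sgl !mul1r.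
have -> : B1 = toeplitz_form H a.
  by apply: eq_bigr => h _; apply: eq_bigr => k _; rewrite !mul1r.
have -> : A4 = toeplitz_form H a.
  by apply: eq_bigr => h _; apply: eq_bigr => k _; rewrite !sgr mulrNN !mul1r shift.
have -> : B4 = toeplitz_form H a.
  by apply: eq_bigr => h _; apply: eq_bigr => k _; rewrite !mul1r shift.
have -> : A2 = - B2.
  rewrite -sumrN; apply: eq_bigr => h _; rewrite -sumrN; apply: eq_bigr => k _.
  by rewrite sgl sgr mulrN mulNr !mul1r.
have -> : A3 = - B3.
  rewrite -sumrN; apply: eq_bigr => h _; rewrite -sumrN; apply: eq_bigr => k _.
  by rewrite sgl sgr mulNr mulNr !mul1r.
move=> ge0; rewrite -subr_ge0; apply: etrans ge0; congr (0 <= _); ring.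
Qed.

Lemma toeplitz_form_continuous H : continuous (toeplitz_form H).
Proof.
apply: continuous_sumr => h _; apply: continuous_sumr => k _.
apply: continuous_mulr; last exact: cst_continuous.
apply: continuous_mulr; last apply: continuous_conjc.
- by apply: continuous_expr => a; exact: cvg_id.
- by apply: continuous_expr => a; exact: cvg_id.
Qed.

Hypothesis small : forall a, cabs a = 1 -> forall e : R, 0 < e ->
  exists2 m, (0 < m)%N & toeplitz_form_re (2 ^ m) a <= e * (2 ^ m)%:R ^+ 2.

(** The normalisation turns [toeplitz_form_double] into monotonicity in $m$. *)
Definition dyadic_form m a : R := toeplitz_form_re (2 ^ m) a / (2 ^ m)%:R ^+ 2.

Lemma dyadic_form_noninc m n a : cabs a = 1 -> (m <= n)%N -> dyadic_form n a <= dyadic_form m a.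
Proof.
move=> a1 /subnK <-; elim: (n - m)%N => // k IH; rewrite addSn (le_trans _ IH) //.
have := toeplitz_form_double (2 ^ (k + m)) a1; rewrite !toeplitz_formE.
rewrite -(rmorph_nat (real_complex R)) -rmorphM lecR => h.
rewrite /dyadic_form expnS mul2n -addnn ler_pdivrMr ?exprn_gt0 ?ltr0n ?addn_gt0 ?expn_gt0 //.
rewrite (le_trans h) // natrD.
have x0 : (2 ^ (k + m))%:R != 0 :> R by rewrite pnatr_eq0 expn_eq0.
by rewrite le_eqVlt; apply/orP; left; apply/eqP; field.
Qed.

(** Dini: the normalised forms decrease along powers of two, so the pointwise
    hypothesis becomes uniform on the compact circle. *)
Lemma dyadic_form_uniform (e : R) : 0 < e ->
  exists m, forall n a, (m <= n)%N -> cabs a = 1 -> dyadic_form n a <= e.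
Proof.
move=> e0; apply: contrapT => /forallNP bad.
have {}bad m : exists a, cabs a = 1 /\ e < dyadic_form m a.
  have /existsNP[n /existsNP[a /not_implyP[mn /not_implyP[a1 /negP]]]] := bad m.
  rewrite -ltNge => ea; exists a; split=> //.
  exact: lt_le_trans ea (dyadic_form_noninc a1 mn).
have [a aP] := choice bad.
have aF : (a @ \oo) [set a : R[i] | cabs a = 1].
  by exists 0%N => // n _; have [] := aP n.
have [b [b1 bcl]] := @circle_compact R (a @ \oo) _ aF.
have [m m0 bm] := small b1 (divr_gt0 e0 (ltr0n _ 2)).
have bm' : dyadic_form m b < e.
  have x0 : 0 < (2 ^ m)%:R ^+ 2 :> R by rewrite exprn_gt0 // ltr0n expn_gt0.
  rewrite /dyadic_form ltr_pdivrMr // (le_lt_trans bm) // ltr_pM2r //; lra.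
have nb : nbhs b [set z | dyadic_form m z < e].
  have cm : continuous (dyadic_form m).
    apply: continuous_mulr; last exact: cst_continuous.
    move=> z; apply: (@continuous_comp _ _ _ (toeplitz_form (2 ^ m)) (fun z => complex.Re z : R)).
      exact: toeplitz_form_continuous.
    exact: Re_continuous.
  exact: (cvgr_lt _ (cm b)).
have aT : (a @ \oo) [set z | exists2 n, (m <= n)%N & z = a n].
  by exists m => // n mn; exists n.
have [z [[n mn ->]]] := bcl _ _ aT nb.
have [an1 ean] := aP n.
by rewrite /= ltNge (ltW (lt_le_trans ean (dyadic_form_noninc an1 mn))).
Qed.

Lemma sum_roots_of_unity (L : nat) (w : R[i]) (j : nat) :
  L.-primitive_root w -> (\sum_(i < L) w ^+ (i * j) = if (L %| j)%N then L%:R else 0).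
Proof.
move=> wp; have L0 := prim_order_gt0 wp; case: ifPn => Lj.
  rewrite (eq_bigr (fun=> 1)) ?sumr_const ?card_ord // => i _.
  by rewrite mulnC exprM -(prim_expr_mod wp) (eqP Lj) expr0 expr1n.
have w1 : w ^+ j != 1 by rewrite -(prim_order_dvd wp).
have := subrX1 (w ^+ j) L; rewrite -exprM mulnC exprM (prim_expr_order wp) expr1n subrr.
move/esym/eqP; rewrite mulf_eq0 subr_eq0 (negPf w1) /= => /eqP sum0.
by rewrite -[RHS]sum0; apply: eq_bigr => i _; rewrite mulnC exprM.
Qed.

(** Iterated square roots of $-1$; such a number has a power of 2 as its
    order, which does not divide $2^n$. *)
Lemma dyadic_root (n : nat) :
  exists2 w : R[i], (2 ^ n.+1).-primitive_root w & cabs w = 1.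
Proof.
have [w wn] : exists w : R[i], w ^+ (2 ^ n) = -1.
  elim: n => [|n [w wn]]; first by exists (-1); rewrite expn0 expr1.
  by exists (sqrtc w); rewrite expnS exprM sqr_sqrtc.
have w1 : w ^+ (2 ^ n.+1) = 1 by rewrite expnSr exprM wn sqrrN expr1n.
have [d dw] := prim_order_exists (expn_gt0 2 n.+1) w1.
move/(dvdn_pfactor _ _ (isT : prime 2)) => [k kn dk].
have kE : k = n.+1.
  apply/eqP; move: kn; rewrite leq_eqVlt => /orP[//|kn].
  have /dvdnP[c cE] : (d %| 2 ^ n)%N by rewrite dk dvdn_exp2l.
  move: wn; rewrite cE mulnC exprM (prim_expr_order dw) expr1n => /eqP.
  by rewrite -subr_eq0 opprK (_ : 1 + 1 = 2%:R) // pnatr_eq0.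
exists w; first by rewrite -kE -dk.
have /eqP := congr1 (fun z => cabs z : R) w1; rewrite cabsX cabs1.
by rewrite pexprn_eq1 ?cabs_ge0 // expn_eq0 /= => /eqP.
Qed.

Definition energy H : R := \sum_(h < H) \sum_(k < H) cabs (C h k) ^+ 2.

(** Plancherel on the group of $4H$-th roots of unity: pairing the form of
    length $3H$ with the one of length $H$ recovers each square $|C_{h,k}|^2$
    at least $H$ times, and no frequencies wrap around. *)
Lemma energy_le (m : nat) (X : R) :
  (forall a, cabs a = 1 -> toeplitz_form_re (2 ^ m) a <= X) ->
  energy (2 ^ m) <= 3 * X * complex.Re (C 0 0).
Proof.
set H := (2 ^ m)%N => supX; have H0 : (0 < H)%N by rewrite expn_gt0.
set L := (4 * H)%N; set M := (3 * H)%N.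
have [w wp w1] : exists2 w : R[i], L.-primitive_root w & cabs w = 1.
  by have [w wp w1] := dyadic_root m.+1; exists w; rewrite // (_ : L = 2 ^ m.+2)%N // /L /H !expnS mulnA.
have L0 : (0 < L)%N := prim_order_gt0 wp.
have LC0 : 0 < L%:R :> R[i] by rewrite ltr0n.
have wc : conjc w = w ^+ L.-1.
  rewrite -[LHS]mul1r -(prim_expr_order wp) -{1}(prednK L0) exprS.
  by rewrite mulrAC cabs1_conj // mul1r.
have wsum x y : (x < L)%N -> (y < L)%N ->
    \sum_(j < L) (w ^+ j) ^+ x * conjc ((w ^+ j) ^+ y) =
    if (x == y)%N then L%:R else 0.
  move=> xL yL; rewrite (_ : (x == y)%N = (L %| x + L.-1 * y)%N); last first.
    rewrite /dvdn -(mod0n L) -(eqn_modDr y) add0n.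
    rewrite (_ : x + L.-1 * y + y = y * L + x)%N; last first.
      by rewrite -[in RHS](prednK L0) mulnS; lia.
    by rewrite modnMDl !modn_small.
  rewrite -(sum_roots_of_unity _ wp); apply: eq_bigr => j _.
  rewrite !rmorphXn /= wc -!exprM -exprD; congr (_ ^+ _); lia.
have sumM : \sum_(j < L) toeplitz_form M (w ^+ j) = L%:R * M%:R * C 0 0.
  rewrite /toeplitz_form exchange_big /=.
  transitivity (\sum_(p < M) L%:R * C 0 0); last first.
    by rewrite sumr_const card_ord -mulr_natl; ring.
  apply: eq_bigr => p _; rewrite exchange_big /=.
  have pL (q : 'I_M) : (q < L)%N by have := ltn_ord q; rewrite /L /M; lia.
  under eq_bigr do rewrite -mulr_suml wsum //.
  rewrite (bigD1 p) //= eqxx big1 ?addr0; last first.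
    by move=> q /negPf qp; rewrite eq_sym val_eqE qp mul0r.
  by rewrite -(toeplitzD 0 0 p).
have sumMH : \sum_(j < L) toeplitz_form M (w ^+ j) * toeplitz_form H (w ^+ j) =
    (L%:R * \sum_(p < M) \sum_(q < M) \sum_(h < H) \sum_(k < H)
      if (p + h == q + k)%N then cabs (C h k) ^+ 2 else 0)%:C.
  rewrite rmorphM /= rmorph_nat rmorph_sum mulr_sumr.
  have expand j : toeplitz_form M (w ^+ j) * toeplitz_form H (w ^+ j) =
      \sum_(p < M) \sum_(q < M) \sum_(h < H) \sum_(k < H)
        ((w ^+ j) ^+ (p + h) * conjc ((w ^+ j) ^+ (q + k))) * (C p q * C h k).
    rewrite {1}/toeplitz_form mulr_suml; apply: eq_bigr => p _.
    rewrite mulr_suml; apply: eq_bigr => q _.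
    rewrite mulr_sumr; apply: eq_bigr => h _.
    rewrite mulr_sumr; apply: eq_bigr => k _.
    by rewrite !exprD rmorphM /=; ring.
  under eq_bigr do rewrite expand.
  rewrite exchange_big; apply: eq_bigr => p _.
  rewrite exchange_big rmorph_sum mulr_sumr; apply: eq_bigr => q _.
  rewrite exchange_big rmorph_sum mulr_sumr; apply: eq_bigr => h _.
  rewrite exchange_big rmorph_sum mulr_sumr; apply: eq_bigr => k _.
  have inL (i : 'I_M) (j : 'I_H) : (i + j < L)%N.
    by rewrite /L mulSn addnC -addSn leq_add // ltnW.
  rewrite -mulr_suml wsum ?inL //.
  case: eqP => [e|_]; last by rewrite mul0r mulr0.
  transitivity (L%:R * (C h k * conjc (C h k))); last by rewrite cabs2.
  by rewrite [C p q]hermitian (toeplitz_eq e) [X in _ * X]mulrC.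
(* The double sum counts the solutions of p + h = q + k. *)
have low : (L%:R * (H%:R * energy H))%:C <=
    \sum_(j < L) toeplitz_form M (w ^+ j) * toeplitz_form H (w ^+ j).
  rewrite sumMH lecR ler_wpM2l //.
  under eq_bigr do rewrite exchange_big.
  rewrite exchange_big /energy mulr_sumr; apply: ler_sum => h _ /=.
  under [X in _ <= X]eq_bigr do rewrite exchange_big.
  rewrite [X in _ <= X]exchange_big mulr_sumr; apply: ler_sum => k _ /=.
  set s := cabs (C h k) ^+ 2; have s0 : 0 <= s by rewrite exprn_ge0 ?cabs_ge0.
  (* Each p in [H, 2H) has the partner q = p + h - k in [0, 3H). *)
  rewrite /M (_ : 3 * H = H + (H + H))%N; last by lia.
  rewrite big_split_ord big_split_ord /= addrCA.
  rewrite -[X in X <= _]addr0 lerD ?addr_ge0 //; last 2 first.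
  - by apply: sumr_ge0 => p _; apply: sumr_ge0 => q _; case: ifP.
  - by apply: sumr_ge0 => p _; apply: sumr_ge0 => q _; case: ifP.
  rewrite mulr_natl -[X in _ *+ X]card_ord -sumr_const; apply: ler_sum => p _.
  have [hH kH pH] := And3 (ltn_ord h) (ltn_ord k) (ltn_ord p).
  have qM : (H + p + h - k < H + (H + H))%N by lia.
  rewrite (bigD1 (Ordinal qM)) //= ifT; last by apply/eqP; lia.
  by rewrite lerDl sumr_ge0 // => q _; case: ifP.
have up : \sum_(j < L) toeplitz_form M (w ^+ j) * toeplitz_form H (w ^+ j) <= X%:C * (L%:R * M%:R * C 0 0).
  rewrite -sumM mulr_sumr; apply: ler_sum => j _; rewrite mulrC.
  apply: ler_wpM2r; first exact: toeplitz_form_ge0.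
  by rewrite toeplitz_formE lecR; apply: supX; rewrite cabsX w1 expr1n.
have C00 : C 0 0 = (complex.Re (C 0 0))%:C.
  rewrite RRe_real // ger0_real //.
  by have := psd 1 (fun=> 1); rewrite !big_ord1 rmorph1 !mul1r.
have LR : 0 < L%:R :> R by rewrite ltr0n.
have HR : 0 < H%:R :> R by rewrite ltr0n.
have upE : X%:C * (L%:R * M%:R * C 0 0) =
    (L%:R * (H%:R * (3 * X * complex.Re (C 0 0))))%:C.
  rewrite [in LHS]C00 !rmorphM /= !rmorph_nat /M natrM; ring.
have := le_trans low up; rewrite upE lecR.
by rewrite !ler_pM2l.
Qed.

(** For $h<H$, row $h$ of the square matrix of size $2H$ contains the entries
    $C_{h,h+j}=C_{0,j}$ for all $j<H$. *)
Lemma energy_double H : H%:R * \sum_(j < H) cabs (C 0 j) ^+ 2 <= energy (H + H).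
Proof.
have sq0 h k : 0 <= cabs (C h k) ^+ 2 by rewrite exprn_ge0 ?cabs_ge0.
rewrite /energy big_split_ord /= -[X in X <= _]addr0 lerD //; last first.
  by apply: sumr_ge0 => h _; apply: sumr_ge0.
rewrite mulr_natl -[X in _ *+ X]card_ord -sumr_const; apply: ler_sum => h _.
rewrite -[X in _ <= X](big_mkord predT (fun k => cabs (C h k) ^+ 2)).
have hH := ltn_ord h.
rewrite (big_cat_nat (n := h)) //=; last by lia.
rewrite [X in _ + X](big_cat_nat (n := (h + H)%N)) //=; [|lia|lia].
rewrite addrCA -[X in X <= _]addr0 lerD ?addr_ge0 ?sumr_ge0 //.
rewrite -{1}[val h]add0n big_addn addKn big_mkord.
by apply: ler_sum => j _; rewrite -(toeplitzD 0 j h) add0n.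
Qed.

(** This is the lemma of Wiener for a spectral measure without atoms, carried
    out on finite groups: uniformly small forms give small energy along
    powers of two, and other lengths are compared with the next power of two. *)
Lemma mean_square_correlation (e : R) : 0 < e ->
  exists H0, forall H, (H0 <= H)%N ->
  \sum_(j < H) cabs (C 0 j) ^+ 2 <= e * H%:R.
Proof.
move=> e0; pose c := 1 + `|complex.Re (C 0 0)|.
have c0 : 0 < c by rewrite ltr_pwDl.
have [d d0 dE] : exists2 d, 0 < d & d = e / (24 * c).
  by exists (e / (24 * c)); rewrite // divr_gt0 // mulr_gt0 // ltr0n.
have [m mP] := dyadic_form_uniform d0.
exists (2 ^ m)%N => H mH.
have H0 : (0 < H)%N by rewrite (leq_trans _ mH) // expn_gt0.
(* The least power of 2 above H is at most 2H. *)
pose n := (trunc_log 2 H).+1.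
have nH : (H < 2 ^ n)%N by exact: trunc_log_ltn.
have Hn : (2 ^ n <= H + H)%N.
  by rewrite /n expnS mul2n -addnn leq_add // trunc_logP.
have mn : (m <= n)%N.
  by rewrite -(leq_exp2l _ _ (isT : 1 < 2)%N) (leq_trans mH) // ltnW.
set K := (2 ^ n)%N in nH Hn.
have KR : 0 < K%:R :> R by rewrite ltr0n expn_gt0.
have KH : K%:R <= 2 * H%:R :> R by rewrite -natrM ler_nat mul2n -addnn.
have en : energy (K + K) <= 3 * (d * (2 ^ n.+1)%:R ^+ 2) * complex.Re (C 0 0).
  rewrite addnn -mul2n -expnS; apply: energy_le => a a1.
  have := mP n.+1 a (leqW mn) a1.
  by rewrite /dyadic_form ler_pdivrMr // exprn_gt0 // ltr0n expn_gt0.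
have := le_trans (energy_double K) en.
have -> : (2 ^ n.+1)%:R = 2 * K%:R :> R by rewrite expnS natrM.
set S := \sum_(j < K) _.
have -> : 3 * (d * (2 * K%:R) ^+ 2) * complex.Re (C 0 0) =
  K%:R * (12 * d * K%:R * complex.Re (C 0 0)) by ring.
rewrite ler_pM2l // => SK.
have HS : \sum_(j < H) cabs (C 0 j) ^+ 2 <= S.
  rewrite /S -!(big_mkord predT (fun k => cabs (C 0 k) ^+ 2)).
  rewrite [X in _ <= X](big_cat_nat (n := H)) //=; last exact: ltnW.
  by rewrite lerDl sumr_ge0 // => i _; rewrite exprn_ge0 ?cabs_ge0.
apply: (le_trans HS); apply: (le_trans SK).
apply: (@le_trans _ _ (12 * d * K%:R * c)).
  apply: ler_wpM2l; first by rewrite ltW // (mulr_gt0 (mulr_gt0 _ d0) KR) // ltr0n.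
  by apply: (le_trans (ler_norm _)); rewrite lerDr.
apply: (@le_trans _ _ (12 * d * (2 * H%:R) * c)).
  by apply: ler_wpM2r (ltW c0) _ _ _; apply: ler_wpM2l KH; rewrite ltW // mulr_gt0 ?ltr0n.
rewrite le_eqVlt; apply/orP; left; apply/eqP; rewrite dE; field; exact: lt0r_neq0.
Qed.

End toeplitz.

(** * Means over initial segments *)

Section means.
Variable R : realType.

Definition mean (N : nat) (w : nat -> R) : R :=
  N%:R^-1 * \sum_(1 <= n < N.+1) w n.

Definition cmean (N : nat) (w : nat -> R[i]) : R[i] :=
  N%:R^-1 * \sum_(1 <= n < N.+1) w n.

Lemma ler_mean N w w' : (forall n, (0 < n)%N -> w n <= w' n) ->
  mean N w <= mean N w'.
Proof.
move=> ww'; rewrite ler_wpM2l ?invr_ge0 // big_nat [X in _ <= X]big_nat.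
by apply: ler_sum => n /andP[n0 _]; exact: ww'.
Qed.

Lemma mean_ge0 N w : (forall n, (0 < n)%N -> 0 <= w n) -> 0 <= mean N w.
Proof.
move=> w0; rewrite mulr_ge0 ?invr_ge0 // big_nat.
by apply: sumr_ge0 => n /andP[n0 _]; exact: w0.
Qed.

Lemma meanD N w w' : mean N (fun n => w n + w' n) = mean N w + mean N w'.
Proof. by rewrite /mean big_split mulrDr. Qed.

Lemma meanZ N c w : mean N (fun n => c * w n) = c * mean N w.
Proof. by rewrite /mean -mulr_sumr mulrCA. Qed.

Lemma mean_cst_le N c : 0 <= c -> mean N (fun=> c) <= c.
Proof.
move=> c0; rewrite /mean sumr_const_nat subSS subn0 -[c *+ N]mulr_natl mulrA.
case: N => [|N]; first by rewrite mulr0 mul0r.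
by rewrite mulVf ?mul1r // pnatr_eq0.
Qed.

Lemma cmean_sum N (I : Type) (r : seq I) (P : pred I) (w : I -> nat -> R[i]) :
  cmean N (fun n => \sum_(i <- r | P i) w i n) = \sum_(i <- r | P i) cmean N (w i).
Proof. by rewrite /cmean exchange_big mulr_sumr. Qed.

Lemma cmeanZ N c w : cmean N (fun n => c * w n) = c * cmean N w.
Proof. by rewrite /cmean -mulr_sumr mulrCA. Qed.

Lemma cmeanD N w w' : cmean N (fun n => w n + w' n) = cmean N w + cmean N w'.
Proof. by rewrite /cmean big_split mulrDr. Qed.

Lemma cmeanB N w w' : cmean N (fun n => w n - w' n) = cmean N w - cmean N w'.
Proof. by rewrite /cmean sumrB mulrBr. Qed.

Lemma cmean_real N w : cmean N (fun n => (w n)%:C) = (mean N w)%:C.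
Proof.
by rewrite /cmean /mean rmorphM /= fmorphV rmorph_nat rmorph_sum.
Qed.

Lemma cabs_cmean N w : cabs (cmean N w) <= mean N (fun n => cabs (w n)).
Proof.
rewrite /cmean cabsM cabsV cabs_nat ler_wpM2l ?invr_ge0 //; exact: cabs_sum.
Qed.

Lemma abs_meanE N w : abs_mean w N = cabs (cmean N w).
Proof. by rewrite /abs_mean /cmean cabsM cabsV cabs_nat. Qed.

Lemma cmean_conj N w : cmean N (fun n => conjc (w n)) = conjc (cmean N w).
Proof. by rewrite /cmean rmorphM /= fmorphV rmorph_nat rmorph_sum. Qed.

Lemma eq_cmean N w w' : (forall n, (0 < n)%N -> w n = w' n) ->
  cmean N w = cmean N w'.
Proof. by move=> e; congr (_ * _); apply: eq_big_nat => n /andP[? _]; exact: e. Qed.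

Lemma eq_mean N w w' : (forall n, (0 < n)%N -> w n = w' n) ->
  mean N w = mean N w'.
Proof. by move=> e; congr (_ * _); apply: eq_big_nat => n /andP[? _]; exact: e. Qed.

(** Shifting a bounded sequence changes its means by boundary terms only. *)
Lemma cmean_shift N w t B : (forall n, (0 < n)%N -> cabs (w n) <= B) ->
  cabs (cmean N (fun n => w (n + t)%N) - cmean N w) <= 2 * t%:R * B / N%:R.
Proof.
move=> wB.
have B0 : 0 <= B by apply: le_trans (wB 1%N isT); exact: cabs_ge0.
have blk m : (0 < m)%N -> cabs (\sum_(m <= n < m + t) w n) <= t%:R * B.
  move=> m0; apply: (le_trans (cabs_sum _ _ _)).
  apply: (@le_trans _ _ (\sum_(m <= n < m + t) B)).
    rewrite big_nat [X in _ <= X]big_nat; apply: ler_sum => n /andP[mn _].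
    by apply: wB; exact: leq_trans mn.
  by rewrite sumr_const_nat addKn mulr_natl.
rewrite -[cmean N w]/(_ * _) -mulrBr cabsM cabsV cabs_nat mulrC.
rewrite ler_wpM2r ?invr_ge0 //.
have -> : \sum_(1 <= n < N.+1) w (n + t)%N = \sum_(1 + t <= n < N.+1 + t) w n.
  by rewrite big_addn addnK.
have -> : \sum_(1 + t <= n < N.+1 + t) w n - \sum_(1 <= n < N.+1) w n
    = \sum_(N.+1 <= n < N.+1 + t) w n - \sum_(1 <= n < 1 + t) w n.
  have e1 := big_cat_nat (n := (1 + t)%N) (m := 1%N) (p := (N.+1 + t)%N)
    (idx := 0 : R[i]) (op := +%R) (P := predT) (F := w) (leq_addr _ _).
  have e2 := big_cat_nat (n := N.+1) (m := 1%N) (p := (N.+1 + t)%N)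
    (idx := 0 : R[i]) (op := +%R) (P := predT) (F := w) (ltn0Sn _) (leq_addr _ _).
  have {}e1 := e1 (leq_add (ltn0Sn N) (leqnn t)).
  by apply/eqP; rewrite subr_eq addrAC eq_sym subr_eq addrC -e2 e1 addrC.
rewrite (le_trans (cabsD _ _)) // cabsN -mulrA mulr_natl mulr2n lerD //; exact: blk.
Qed.

Lemma increasing_leq (N : nat -> nat) : increasing N -> forall l, (l <= N l)%N.
Proof. by move=> incN; elim=> // l IH; exact: leq_ltn_trans (incN _ _ (ltnSn l)). Qed.

Lemma near_div_increasing (N : nat -> nat) (c e : R) : increasing N -> 0 < e ->
  \forall l \near \oo, c / (N l)%:R < e.
Proof.
move=> incN e0; exists (Num.truncn (`|c| / e)).+1 => // l /= cl.
have Nl := leq_trans cl (increasing_leq incN l).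
have N0 : 0 < (N l)%:R :> R by rewrite ltr0n; lia.
rewrite ltr_pdivrMr // (le_lt_trans (ler_norm c)) // mulrC -ltr_pdivrMr //.
by apply: lt_le_trans (truncnS_gt _) _; rewrite ler_nat.
Qed.

Lemma limn_sup_between (A : nat -> R) (e : R) l0 :
  (forall l, 0 <= A l <= 1) -> (forall l, (l0 <= l)%N -> A l <= e) ->
  0 <= limn_sup A <= e.
Proof.
move=> A01 Ae.
have bA : bounded_fun A.
  exists 1; split=> // x x1 l _; have /andP[A0 A1] := A01 l.
  by rewrite /= ger0_norm // (le_trans A1 (ltW x1)).
have ubA n : has_sup (sdrop A n).
  split; first by exists (A n); exists n => //=.
  by exists 1 => _ [l _ <-]; have /andP[] := A01 l.
have sups0 n : 0 <= sups A n.
  have [/andP[A0 _] _] := (A01 n, tt); apply: (le_trans A0).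
  by apply: ub_le_sup; [case: (ubA n)|exists n => //=].
rewrite limn_supE //; apply/andP; split.
  apply: lb_le_inf; first by exists (sups A 0%N); exists 0%N.
  by move=> _ [n _ <-].
apply: (@le_trans _ _ (sups A l0)).
  apply: ge_inf; last by exists l0.
  by exists 0 => _ [n _ <-].
by apply: ge_sup => [|_ [l /= l0l <-]]; [case: (ubA l0)|exact: Ae].
Qed.

End means.

(** * Correlations of a sequence with small exponential sums *)

Section limits_of_complex_sequences.
Variables (R : realType).
Implicit Types (f : nat -> R[i]) (z : R[i]).

Lemma cvgn_cabs f z : f @ \oo --> z -> (fun n => cabs (f n)) @ \oo --> cabs z.
Proof. by move=> fz; apply: (cvg_comp _ _ fz); exact: cabs_continuous. Qed.

Lemma cvgn_Re f z :
  f @ \oo --> z -> (fun n => complex.Re (f n)) @ \oo --> complex.Re z.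
Proof. by move=> fz; apply: (cvg_comp _ _ fz); exact: Re_continuous. Qed.

Lemma cvgn_Im f z :
  f @ \oo --> z -> (fun n => complex.Im (f n)) @ \oo --> complex.Im z.
Proof. by move=> fz; apply: (cvg_comp _ _ fz); exact: Im_continuous. Qed.

Lemma cvgn_unique f z w : f @ \oo --> z -> f @ \oo --> w -> z = w.
Proof. by move=> fz fw; exact: (cvg_unique (@norm_hausdorff _ _) fz fw). Qed.

Lemma cvgn_ge0 f z : (forall n, 0 <= f n) -> f @ \oo --> z -> 0 <= z.
Proof.
move=> f0 fz; rewrite lecE /=; apply/andP; split.
  apply/eqP; apply: (@cvg_unique _ (@Rhausdorff R) _ _ _ _ (cvgn_Im fz)).
  rewrite (_ : (fun n => _) = fun=> 0) /=; last first.
    by apply/funext => n; exact: ger0_Im.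
  exact: cvg_cst.
have fz' := cvgn_Re fz.
rewrite -(cvg_lim (@Rhausdorff R) fz'); apply: limr_ge.
  by apply/cvg_ex; eexists; exact: fz'.
by apply: nearW => n; have := f0 n; rewrite lecE => /andP[].
Qed.

Lemma cvgn_close f g z : f @ \oo --> z ->
  (forall e : R, 0 < e -> \forall n \near \oo, cabs (f n - g n) < e) ->
  g @ \oo --> z.
Proof.
move=> /cvg_cabsP fz fg; apply/cvg_cabsP => e e0; near=> n.
rewrite -[g n](subrK (f n)) -addrA (le_lt_trans (cabsD _ _)) // cabsB.
rewrite [e]splitr ltrD //; near: n; [apply: fg|apply: fz]; exact: divr_gt0.
Unshelve. all: by end_near. Qed.

End limits_of_complex_sequences.

Section correlations.
Variables (R : realType) (u : nat -> R[i]) (N : nat -> nat) (C : nat -> nat -> R[i]).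
Hypothesis u1 : forall n, (0 < n)%N -> cabs (u n) <= 1.
Hypothesis incN : increasing N.

Definition cov h k M := cmean M (fun n => u (n + h)%N * conjc (u (n + k)%N)).

Hypothesis covC : forall h k, (fun l => cov h k (N l)) @ \oo --> C h k.
Hypothesis short : small_exponential_sums u.

Lemma u_shift1 n h : (0 < n)%N -> cabs (u (n + h)%N) <= 1.
Proof. by move=> n0; apply: u1; rewrite addn_gt0 n0. Qed.

Lemma cov_toeplitz h k : C h.+1 k.+1 = C h k.
Proof.
symmetry; apply: (cvgn_unique (@covC h k)); apply: (cvgn_close (@covC _ _)) => e e0.
have := near_div_increasing 2 incN e0.
apply: filterS => l; apply: le_lt_trans.
rewrite (_ : cov h.+1 k.+1 (N l) =
    cmean (N l) (fun n => (fun m => u (m + h)%N * conjc (u (m + k)%N)) (n + 1)%N)).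
  rewrite -[X in _ <= X / _]mulr1 -[X in _ <= X * _ / _]mulr1.
  apply: cmean_shift => n n0.
  by rewrite cabsM cabs_conj mulr_ile1 ?cabs_ge0 ?u_shift1.
by apply: eq_cmean => n _; rewrite !addnS !addn0 !addSn.
Qed.

Lemma cov_hermitian h k : C k h = conjc (C h k).
Proof.
apply: (cvgn_unique (@covC k h)).
rewrite (_ : (fun l => _) = (fun l => conjc (cov h k (N l)))).
  by apply: (cvg_comp _ _ (@covC h k)); exact: conjc_continuous.
apply/funext => l; rewrite /cov -cmean_conj; apply: eq_cmean => n _.
by rewrite rmorphM /= conjcK mulrC.
Qed.

(** The form of the correlations is a mean of squares, whence its positivity. *)
Lemma cov_form n (c : nat -> R[i]) M :
  \sum_(h < n) \sum_(k < n) c h * conjc (c k) * cov h k M =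
  (mean M (fun j => cabs (\sum_(h < n) c h * u (j + h)%N) ^+ 2))%:C.
Proof.
rewrite -cmean_real.
under [RHS]eq_cmean => j _ do rewrite -cabs2 rmorph_sum /= mulr_suml.
rewrite cmean_sum; apply: eq_bigr => h _.
under [RHS]eq_cmean => j _ do rewrite mulr_sumr.
rewrite cmean_sum; apply: eq_bigr => k _; rewrite -cmeanZ.
by apply: eq_cmean => j _; rewrite rmorphM /=; ring.
Qed.

Lemma cov_form_cvg n (c : nat -> R[i]) :
  (fun l => (mean (N l) (fun j => cabs (\sum_(h < n) c h * u (j + h)%N) ^+ 2))%:C)
    @ \oo --> \sum_(h < n) \sum_(k < n) c h * conjc (c k) * C h k.
Proof.
under eq_fun do rewrite -cov_form.
apply: cvg_sumr => h _; apply: cvg_sumr => k _.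
exact: (cvgM (cvg_cst (c h * conjc (c k))) (@covC h k)).
Qed.

Lemma cov_psd n (c : nat -> R[i]) :
  0 <= \sum_(h < n) \sum_(k < n) c h * conjc (c k) * C h k.
Proof.
apply: cvgn_ge0 (@cov_form_cvg n c) => l.
by rewrite lecR; apply: mean_ge0 => j _; rewrite exprn_ge0 ?cabs_ge0.
Qed.

(** A sum $S$ of $H$ terms of modulus at most 1 satisfies $|S|^2\le H|S|$. *)
Lemma cov_small (a : R[i]) : cabs a = 1 -> forall e : R, 0 < e ->
  exists2 m, (0 < m)%N & toeplitz_form_re C (2 ^ m) a <= e * (2 ^ m)%:R ^+ 2.
Proof.
move=> a1 e e0; have [H0 H0P] := short a1 e0; exists H0.+1 => //.
set H := (2 ^ H0.+1)%N; have H0H : (H0 <= H)%N.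
  by rewrite (leq_trans (leqnSn _)) // ltnW // ltn_expl.
have [N0 N0P] := H0P H H0H.
rewrite /toeplitz_form_re /toeplitz_form -(cvg_lim (@Rhausdorff R) (cvgn_Re (@cov_form_cvg H (fun h => a ^+ h)))).
apply: limr_le; first by apply/cvg_ex; eexists; exact: cvgn_Re (@cov_form_cvg _ _).
exists (maxn N0 1) => // l /=; rewrite geq_max => /andP[l0 l1].
have Nl := leq_trans l0 (increasing_leq incN l).
have Np : 0 < (N l)%:R :> R by rewrite ltr0n (leq_trans l1) // increasing_leq.
apply: (@le_trans _ _ (H%:R * mean (N l) (fun n => cabs (\sum_(h < H) a ^+ h * u (n + h)%N)))).
  rewrite -meanZ; apply: ler_mean => n n0.
  rewrite expr2 ler_wpM2r ?cabs_ge0 // (le_trans (cabs_sum _ _ _)) //.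
  rewrite -[X in _ <= X%:R]card_ord -sumr_const; apply: ler_sum => h _.
  by rewrite cabsM cabsX a1 expr1n mul1r u_shift1.
rewrite /mean (_ : e * H%:R ^+ 2 = H%:R * (e * H%:R)); last by ring.
by rewrite ler_wpM2l // ler_pdivrMl // mulrC N0P.
Qed.

(** A mean of squares controls the mean, by $|z|\le e/2+|z|^2/(2e)$. *)
Lemma mean_abs_correlation (e : R) : 0 < e ->
  exists H0, forall H, (H0 <= H)%N -> \sum_(j < H) cabs (C 0 j) <= e * H%:R.
Proof.
move=> e0; have [H0 H0P] :=
  mean_square_correlation cov_toeplitz cov_hermitian cov_psd cov_small (exprn_gt0 2 e0).
exists H0 => H /H0P sq.
have -> : \sum_(j < H) cabs (C 0 j) = e^-1 * \sum_(j < H) e * cabs (C 0 j).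
  by rewrite -mulr_sumr mulKf // lt0r_neq0.
rewrite ler_pdivrMl //.
apply: (@le_trans _ _ (\sum_(j < H) (e ^+ 2 / 2 + cabs (C 0 j) ^+ 2 / 2))).
  apply: ler_sum => j _; have := sqr_ge0 (e - cabs (C 0 j)); nra.
rewrite big_split /= sumr_const card_ord -mulr_suml -mulr_natr; move: sq; nra.
Qed.

(** By symmetry, row $s$ contains each $|C_{0,j}|$ at most twice. *)
Lemma row_sum_le L s : (s < L)%N ->
  \sum_(k < L) cabs (C s k) <= 2 * \sum_(j < L) cabs (C 0 j).
Proof.
move=> sL; pose r j := cabs (C 0 j) : R.
have r0 j : 0 <= r j by exact: cabs_ge0.
rewrite -!(big_mkord predT (fun k => cabs (C _ k))) (big_cat_nat (n := s)) //=; last exact: ltnW.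
rewrite mulrC mulr_natr mulr2n; apply: lerD.
  rewrite big_nat_rev /= add0n.
  apply: (@le_trans _ _ (\sum_(0 <= i < s) r i.+1)).
    rewrite big_nat [X in _ <= X]big_nat; apply: ler_sum => i /andP[_ il].
    have -> : C s (s - i.+1)%N = conjc (C 0 i.+1).
      rewrite -cov_hermitian -[RHS](toeplitzD cov_toeplitz _ _ (s - i.+1)) add0n.
      by rewrite subnKC.
    by rewrite cabs_conj.
  rewrite -(big_add1 _ _ 0 s.+1 predT r) (big_cat_nat (n := s.+1) (p := L) (m := 0%N)) //=.
  rewrite [in X in _ <= X](big_ltn (ltn0Sn s)) -addrA addrCA lerDl.
  by apply: addr_ge0; [exact: r0|apply: sumr_ge0 => i _; exact: r0].
rewrite -{1}[s]add0n big_addn [X in _ <= X](big_cat_nat (n := (L - s)%N)) //=; last exact: leq_subr.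
apply: ler_wpDr; first by apply: sumr_ge0 => i _; exact: r0.
apply: ler_sum => i _; by rewrite -{1}[s]add0n (toeplitzD cov_toeplitz).
Qed.

Lemma unimodular_conj (z : R[i]) : exists2 c, cabs c <= 1 & c * z = (cabs z)%:C.
Proof.
have [->|z0] := eqVneq z 0; first by exists 0; rewrite ?cabs0 // mulr0.
have c0 : cabs z != 0 by apply: contra z0 => /eqP/cabs_eq0 ->.
exists (conjc z / (cabs z)%:C).
  by rewrite cabsM cabsV cabs_conj cabs_real ger0_norm ?cabs_ge0 // mulfV.
rewrite mulrAC [conjc z * z]mulrC cabs2 -fmorphV -rmorphM /= expr2 mulfK //.
Qed.

(** A translation of time by $s$ gives all terms the common factor $w(n+L)$,
    of modulus at most 1. Once the moduli are removed with constants $c_s$,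
    what remains is the mean of $|\sum_s c_su(n+s)|$, whose square expands
    into correlations of [u] alone. *)
Lemma correlation_sum_le L M (d : R) (w : nat -> R[i]) : 0 < d ->
  (forall n, (0 < n)%N -> cabs (w n) <= 1) ->
  \sum_(s < L) abs_mean (fun n => u n * w (n + (L - s))%N) M <=
  2 * L%:R ^+ 2 / M%:R + d / 2 + (2 * d)^-1 * \sum_(h < L) \sum_(k < L) cabs (cov h k M).
Proof.
move=> d0 w1.
pose z (s : nat) := cmean M (fun n => u n * w (n + (L - s))%N).
have /choice [c cP] : forall s, exists c, cabs c <= 1 /\ c * z s = (cabs (z s))%:C.
  by move=> s; have [c c1 cz] := unimodular_conj (z s); exists c.
have c1 s : cabs (c s) <= 1 by have [] := cP s.
have cz s : c s * z s = (cabs (z s))%:C by have [] := cP s.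
pose z' (s : nat) := cmean M (fun n => u (n + s)%N * w (n + L)%N).
have zz' (s : 'I_L) : cabs (z s - z' s) <= 2 * L%:R / M%:R.
  rewrite cabsB.
  have -> : z' s = cmean M (fun n => (fun m => u m * w (m + (L - s))%N) (n + s)%N).
    by apply: eq_cmean => n _; rewrite -addnA subnKC // ltnW.
  apply: (@le_trans _ _ (2 * s%:R * 1 / M%:R)).
    apply: cmean_shift => n n0.
    by rewrite cabsM mulr_ile1 ?cabs_ge0 ?u1 ?w1 // addn_gt0 n0.
  by rewrite mulr1 ler_wpM2r ?invr_ge0 // ler_wpM2l // ler_nat ltnW.
pose S n := cabs (\sum_(s < L) c s * u (n + s)%N).
have step1 : \sum_(s < L) abs_mean (fun n => u n * w (n + (L - s))%N) M <=
    2 * L%:R ^+ 2 / M%:R + mean M S.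
  have -> : \sum_(s < L) abs_mean (fun n => u n * w (n + (L - s))%N) M =
      cabs (\sum_(s < L) c s * z s).
    under [in RHS]eq_bigr do rewrite cz.
    rewrite -rmorph_sum cabs_real ger0_norm; last by apply: sumr_ge0 => s _; exact: cabs_ge0.
    by apply: eq_bigr => s _; rewrite abs_meanE.
  have -> : \sum_(s < L) c s * z s =
      \sum_(s < L) c s * (z s - z' s) + cmean M (fun n => \sum_(s < L) c s * (u (n + s)%N * w (n + L)%N)).
    rewrite cmean_sum -big_split /=; apply: eq_bigr => s _.
    by rewrite cmeanZ -mulrDr subrK.
  rewrite (le_trans (cabsD _ _)) // lerD //.
    rewrite (le_trans (cabs_sum _ _ _)) //.
    apply: (@le_trans _ _ (\sum_(s < L) (2 * L%:R / M%:R))).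
      apply: ler_sum => s _; rewrite cabsM -[X in _ <= X]mul1r.
      by rewrite ler_pM ?cabs_ge0.
    by rewrite sumr_const card_ord -mulr_natl le_eqVlt; apply/orP; left; apply/eqP; ring.
  apply: (le_trans (cabs_cmean _ _)); apply: ler_mean => n n0.
  under eq_bigr do rewrite mulrA; rewrite -mulr_suml cabsM /S.
  by rewrite -[X in _ <= X]mulr1 ler_wpM2l ?cabs_ge0 // w1 // addn_gt0 n0.
apply: (le_trans step1); rewrite -addrA lerD2l.
apply: (@le_trans _ _ (mean M (fun n => d / 2 + (2 * d)^-1 * S n ^+ 2))).
  apply: ler_mean => n _.
  have -> : d / 2 + (2 * d)^-1 * S n ^+ 2 = (2 * d)^-1 * (d ^+ 2 + S n ^+ 2).
    by field; exact: lt0r_neq0.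
  rewrite ler_pdivlMl ?mulr_gt0 // -subr_ge0.
  rewrite (_ : _ - _ = (d - S n) ^+ 2) ?sqr_ge0 //; ring.
rewrite meanD (meanZ M (2 * d)^-1); apply: lerD.
  by apply: mean_cst_le; rewrite divr_ge0 ?ltW.
apply: ler_wpM2l; first by rewrite invr_ge0 mulr_ge0 // ltW.
have e := cov_form L c M.
have -> : mean M (fun n => S n ^+ 2) =
    cabs (\sum_(h < L) \sum_(k < L) c h * conjc (c k) * cov h k M).
  rewrite e cabs_real ger0_norm //; apply: mean_ge0 => n _.
  by rewrite exprn_ge0 ?cabs_ge0.
rewrite (le_trans (cabs_sum _ _ _)) //; apply: ler_sum => h _.
rewrite (le_trans (cabs_sum _ _ _)) //; apply: ler_sum => k _.
rewrite cabsM -[X in _ <= X]mul1r; apply: ler_wpM2r; first exact: cabs_ge0.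
by rewrite cabsM cabs_conj mulr_ile1 ?cabs_ge0.
Qed.

(** The threshold in $l$ is uniform over the second sequence, which allows
    infinitely many sequences $w$ to be treated at once. *)
Lemma uniform_decorrelation (e : R) : 0 < e ->
  exists2 L, (0 < L)%N & exists l0, forall l, (l0 <= l)%N ->
  forall w : nat -> R[i], (forall n, (0 < n)%N -> cabs (w n) <= 1) ->
  \sum_(s < L) abs_mean (fun n => u n * w (n + (L - s))%N) (N l) <= e * L%:R.
Proof.
move=> e0; have [H0 H0P] := mean_abs_correlation (divr_gt0 (exprn_gt0 2 e0) (ltr0n _ 16)).
pose L := H0.+1; exists L => //.
have LR : 0 < L%:R :> R by rewrite ltr0n.
have covL : (fun l => \sum_(h < L) \sum_(k < L) cabs (cov h k (N l))) @ \oo -->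
    \sum_(h < L) \sum_(k < L) cabs (C h k).
  apply: (@cvg_sumr R R^o) => h _; apply: (@cvg_sumr R R^o) => k _.
  exact: cvgn_cabs (@covC h k).
have limL : \sum_(h < L) \sum_(k < L) cabs (C h k) <= e ^+ 2 / 8 * L%:R ^+ 2.
  apply: (@le_trans _ _ (\sum_(h < L) 2 * (e ^+ 2 / 16 * L%:R))).
    apply: ler_sum => h _; apply: (le_trans (row_sum_le (ltn_ord h))).
    by rewrite ler_wpM2l // H0P.
  by rewrite sumr_const card_ord -mulr_natr le_eqVlt; apply/orP; left; apply/eqP; field.
have e4 : e ^+ 2 / 8 * L%:R ^+ 2 < e ^+ 2 / 4 * L%:R ^+ 2.
  by rewrite ltr_pM2r ?exprn_gt0 //; have := exprn_gt0 2 e0; lra.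
have [l1 _ l1P] := cvgr_lt _ covL _ (le_lt_trans limL e4).
have eL4 : 0 < e / 4 * L%:R by rewrite mulr_gt0 // divr_gt0.
have [l2 _ l2P] := near_div_increasing (2 * L%:R ^+ 2) incN eL4.
exists (maxn l1 l2) => l; rewrite geq_max => /andP[/l1P /= ll1 /l2P /= ll2] w w1.
have eL : 0 < e * L%:R by rewrite mulr_gt0.
apply: (le_trans (correlation_sum_le _ _ eL w1)).
have : (2 * (e * L%:R))^-1 * \sum_(h < L) \sum_(k < L) cabs (cov h k (N l)) <= e / 8 * L%:R.
  rewrite ler_pdivrMl ?mulr_gt0 // (le_trans (ltW ll1)) //.
  by rewrite le_eqVlt; apply/orP; left; apply/eqP; field.
move: ll2; set A := 2 * _ / _; set B := _^-1 * _; lra.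
Qed.

End correlations.

(** * Averages over boxes of shifts *)

Section boxes.
Variable R : realType.

Lemma count_boundary (H t : nat) : (\sum_(x < H) (H <= x + t) <= t)%N.
Proof.
have le1 m : (\sum_(m <= x < H) (H <= x + t) <= H - m)%N.
  rewrite -[X in (_ <= X)%N]muln1 -sum_nat_const_nat; apply: leq_sum => x _.
  exact: leq_b1.
rewrite -(big_mkord predT (fun x => nat_of_bool (H <= x + t)%N)).
case: (leqP H t) => Ht; first by apply: leq_trans (le1 0%N) _; rewrite subn0.
rewrite (big_cat_nat (n := (H - t)%N)) ?leq_subr //= big_nat big1 ?add0n; last first.
  by move=> x /andP[_ xH]; apply/eqP; rewrite eqb0 -ltnNge -ltn_subRL; lia.
by apply: leq_trans (le1 _) _; rewrite subKn // ltnW.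
Qed.

Lemma sum_coordinate (k H : nat) (i : 'I_k) (g : 'I_H -> R) :
  \sum_(h : {ffun 'I_k -> 'I_H}) g (h i) = (\sum_(x < H) g x) * H%:R ^+ k.-1.
Proof.
pose F (j : 'I_k) (x : 'I_H) := if j == i then g x else 1.
transitivity (\sum_(h : {ffun 'I_k -> 'I_H}) \prod_(j < k) F j (h j)).
  apply: eq_bigr => h _; rewrite (bigD1 i) //= /F eqxx big1 ?mulr1 //.
  by move=> j /negPf ->.
rewrite -bigA_distr_bigA (bigD1 i) //= /F eqxx; congr (_ * _).
rewrite (eq_bigr (fun=> H%:R)); last first.
  by move=> j /negPf ->; rewrite sumr_const card_ord.
by rewrite prodr_const cardC1 card_ord.
Qed.

(** Translating a box along the diagonal changes a sum of terms in $[0,1]$ by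
    the boundary layer at most; the translation is done modulo $H$ so that it
    permutes the box. *)
Lemma sum_box_shift (k H t : nat) (X : ('I_k -> nat) -> R) :
  (0 < H)%N -> (forall h, 0 <= X h <= 1) ->
  \sum_(h : {ffun 'I_k -> 'I_H}) X (fun i => h i) <=
  \sum_(h : {ffun 'I_k -> 'I_H}) X (fun i => (h i + t)%N)
  + (k * t)%:R * H%:R ^+ k.-1.
Proof.
move=> H0 X01.
pose sg (x : 'I_H) := Ordinal (ltn_pmod (x + t) H0).
have sg_inj : injective sg.
  move=> x y /(congr1 val) /= /eqP; rewrite eqn_modDr !modn_small // => /eqP.
  exact: val_inj.
pose ph (h : {ffun 'I_k -> 'I_H}) := [ffun i => sg (h i)].
have ph_inj : injective ph.
  by move=> h h' /ffunP e; apply/ffunP => i; apply: sg_inj; have := e i; rewrite !ffunE.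
rewrite (reindex_inj ph_inj) /=.
pose b (h : {ffun 'I_k -> 'I_H}) : R := \sum_(i < k) (H <= h i + t)%N%:R.
have Xb h : X (fun i => ph h i) <= X (fun i => (h i + t)%N) + b h.
  have b0 i : 0 <= (H <= h i + t)%N%:R :> R by rewrite ler0n.
  have [/existsP[i hi]|/existsPn hn] := boolP [exists i, H <= h i + t]%N.
    have /andP[_ X1] := X01 (fun i => ph h i); have /andP[X0 _] := X01 (fun i => (h i + t)%N).
    rewrite (le_trans X1) // -[X in X <= _]add0r lerD // /b (bigD1 i) //= hi.
    by rewrite lerDl sumr_ge0.
  rewrite (_ : (fun i => _) = (fun i => (h i + t)%N)).
    by rewrite lerDl sumr_ge0.
  by apply/funext => i; rewrite ffunE /= modn_small // ltnNge.
apply: (le_trans (ler_sum _ (fun h _ => Xb h))); rewrite big_split /= lerD2l.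
rewrite /b exchange_big /= natrM -mulrA mulr_natl.
rewrite -[X in _ *+ X]card_ord -sumr_const; apply: ler_sum => i _.
rewrite (sum_coordinate i (fun x => (H <= x + t)%N%:R)).
by rewrite ler_wpM2r ?exprn_ge0 // -natr_sum ler_nat count_boundary.
Qed.

End boxes.

Section averaged_chowla.
Variables (R : realType) (u : nat -> R[i]) (N : nat -> nat) (C : nat -> nat -> R[i]).
Hypothesis u1 : forall n, (0 < n)%N -> cabs (u n) <= 1.
Hypothesis incN : increasing N.
Hypothesis covC : forall h k, (fun l => cov u h k (N l)) @ \oo --> C h k.
Hypothesis short : small_exponential_sums u.

Let corr h l := abs_mean (fun n => u n * conjc (u (n + h)%N)) (N l).

Lemma corr_cvg h : corr h @ \oo --> (cabs (C 0 h) : R).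
Proof.
rewrite (_ : corr h = fun l => cabs (cov u 0 h (N l))).
  exact: cvgn_cabs (@covC 0%N h).
apply/funext => l; rewrite /corr abs_meanE; congr cabs.
by apply: eq_cmean => n _; rewrite addn0.
Qed.

Lemma averaged_2chowla :
  (fun H => H%:R^-1 * \sum_(1 <= h < H.+1) limn (corr h)) @ \oo --> (0 : R).
Proof.
apply/(@cvgrPdist_le _ R^o) => e e0.
have [H0 H0P] := mean_abs_correlation u1 incN covC short (divr_gt0 e0 (ltr0n _ 2)).
exists (maxn H0 1) => // H /=; rewrite geq_max => /andP[H0H Hp].
have HR : 0 < H%:R :> R by rewrite ltr0n.
have -> : \sum_(1 <= h < H.+1) limn (corr h) = \sum_(1 <= h < H.+1) cabs (C 0 h).
  by apply: eq_bigr => h _; exact: (cvg_lim (@Rhausdorff R) (@corr_cvg h)).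
rewrite sub0r normrN ger0_norm; last first.
  by rewrite mulr_ge0 ?invr_ge0 // sumr_ge0 // => h _; rewrite cabs_ge0.
rewrite ler_pdivrMl //.
apply: (@le_trans _ _ (\sum_(j < H.+1) cabs (C 0 j))).
  rewrite -(big_mkord predT (fun j => cabs (C 0 j))) [X in _ <= X]big_ltn //.
  by rewrite lerDr cabs_ge0.
apply: (le_trans (H0P _ (leqW H0H))).
have H1 : 0 <= H%:R - 1 :> R by rewrite subr_ge0 ler1n.
by rewrite -(natr1 H); have := mulr_ge0 (ltW e0) H1; lra.
Qed.

Section several_sequences.
Variables (k : nat) (k0 : (0 < k)%N).

Let mcorr (v : 'I_k -> nat -> R[i]) (h : 'I_k -> nat) l :=
  abs_mean (fun n => u n * \prod_(i < k) v i (n + h i)%N) (N l).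

Lemma mcorr01 v h l : (forall i n, (0 < n)%N -> cabs (v i n) <= 1) ->
  0 <= mcorr v h l <= 1.
Proof.
move=> v1; rewrite /mcorr abs_meanE cabs_ge0 /= (le_trans (cabs_cmean _ _)) //.
apply: le_trans (mean_cst_le (N l) ler01); apply: ler_mean => n n0.
rewrite cabsM cabs_prod mulr_ile1 ?cabs_ge0 ?u1 ?prodr_ge0 //.
- by move=> i _; exact: cabs_ge0.
- by apply: prodr_ile1 => i _; rewrite cabs_ge0 v1 // addn_gt0 n0.
Qed.

(** The box is averaged over its translates by $L-s$ along the diagonal. For
    each point $h$ of the box the product of the [v i] is then a single
    sequence $w$ read at time $n+L-s$, to which [uniform_decorrelation]
    applies. *)
Lemma box_decorrelation (e : R) : 0 < e ->
  exists H0, forall H, (H0 <= H)%N -> exists l0, forall l, (l0 <= l)%N ->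
  forall v : 'I_k -> nat -> R[i], (forall i n, (0 < n)%N -> cabs (v i n) <= 1) ->
  (H%:R ^+ k)^-1 * \sum_(h : {ffun 'I_k -> 'I_H}) mcorr v (fun i => (h i).+1) l <= e.
Proof.
move=> e0; have e2 : 0 < e / 2 by rewrite divr_gt0.
have [L L0 [l0 l0P]] := uniform_decorrelation u1 incN covC short e2.
pose H0 := (Num.truncn ((k * L)%:R / (e / 2))).+1.
exists H0 => H HH0; exists l0 => l ll0 v v1.
have H1 : (0 < H)%N by rewrite (leq_trans _ HH0).
have HR : 0 < H%:R :> R by rewrite ltr0n.
have LR : 0 < L%:R :> R by rewrite ltr0n.
have kL : (k * L)%:R <= e / 2 * H%:R.
  rewrite -ler_pdivrMl // mulrC (le_trans (ltW (truncnS_gt _))) //.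
  by rewrite -/H0 ler_nat.
rewrite ler_pdivrMl ?exprn_gt0 //.
pose X (h : 'I_k -> nat) := mcorr v (fun i => (h i).+1) l.
have X01 h : 0 <= X h <= 1 by exact: mcorr01.
pose S := \sum_(h : {ffun 'I_k -> 'I_H}) X (fun i => h i).
rewrite -/S.
have shiftS (s : 'I_L) : S <= \sum_(h : {ffun 'I_k -> 'I_H}) X (fun i => (h i + (L - s))%N)
    + (k * L)%:R * H%:R ^+ k.-1.
  apply: (le_trans (sum_box_shift (L - s) H1 X01)); rewrite lerD2l.
  by rewrite ler_wpM2r ?exprn_ge0 // ler_nat leq_mul2l leq_subr orbT.
have : L%:R * S <= L%:R * (e / 2 * H%:R ^+ k + (k * L)%:R * H%:R ^+ k.-1).
  rewrite mulr_natl -[X in _ *+ X]card_ord -sumr_const.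
  apply: (le_trans (ler_sum _ (fun s _ => shiftS s))).
  rewrite big_split /= mulrDr; apply: lerD; last by rewrite sumr_const card_ord [X in _ <= X]mulr_natl lexx.
  rewrite exchange_big /=.
  apply: (@le_trans _ _ (\sum_(h : {ffun 'I_k -> 'I_H}) e / 2 * L%:R)).
    apply: ler_sum => h _.
    pose w m := \prod_(i < k) v i (m + (h i).+1)%N.
    have w1 m : (0 < m)%N -> cabs (w m) <= 1.
      move=> m0; rewrite cabs_prod; apply: prodr_ile1 => i _.
      by rewrite cabs_ge0 v1 // addn_gt0 m0.
    apply: le_trans (l0P l ll0 w w1); apply: ler_sum => s _.
    rewrite /X /mcorr !abs_meanE le_eqVlt; apply/orP; left; apply/eqP; congr cabs.
    apply: eq_cmean => n _; congr (_ * _); apply: eq_bigr => i _; congr (v i _); lia.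
  rewrite sumr_const card_ffun !card_ord -[X in X <= _]mulr_natl natrX.
  by rewrite le_eqVlt; apply/orP; left; apply/eqP; ring.
rewrite ler_pM2l // => /le_trans; apply.
apply: (@le_trans _ _ (e / 2 * H%:R ^+ k + e / 2 * H%:R * H%:R ^+ k.-1)).
  by rewrite lerD2l ler_wpM2r // exprn_ge0.
have -> : e / 2 * H%:R * H%:R ^+ k.-1 = e / 2 * H%:R ^+ k.
  by rewrite -[in RHS](prednK k0) exprS mulrA.
by rewrite le_eqVlt; apply/orP; left; apply/eqP; field.
Qed.

Variable v : 'I_k -> nat -> R[i].
Hypothesis v1 : forall i n, (0 < n)%N -> cabs (v i n) <= 1.

Let box H l := (H%:R ^+ k)^-1 *
  \sum_(h : {ffun 'I_k -> 'I_H}) mcorr v (fun i => (h i).+1) l.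

Lemma box01 H l : 0 <= box H l <= 1.
Proof.
have hb h := mcorr01 h l v1.
apply/andP; split.
  rewrite mulr_ge0 ?invr_ge0 ?exprn_ge0 // sumr_ge0 // => h _.
  by have /andP[] := hb (fun i => (h i).+1).
apply: (@le_trans _ _ ((H%:R ^+ k)^-1 * \sum_(h : {ffun 'I_k -> 'I_H}) 1)).
  rewrite ler_wpM2l ?invr_ge0 ?exprn_ge0 //; apply: ler_sum => h _.
  by have /andP[] := hb (fun i => (h i).+1).
rewrite sumr_const card_ffun !card_ord natrX.
by have [->|Hk] := eqVneq (H%:R ^+ k : R) 0; rewrite ?mulr0 // mulVf.
Qed.

Lemma limsup_box_cvg : (fun H => limn_sup (box H)) @ \oo --> (0 : R).
Proof.
apply/(@cvgrPdist_le _ R^o) => e e0.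
have [H0 H0P] := box_decorrelation e0.
exists H0 => // H /= /H0P [l0 l0P]; rewrite sub0r normrN.
have /andP[s0 se] : 0 <= limn_sup (box H) <= e.
  apply: (limn_sup_between (l0 := l0)); first exact: box01.
  by move=> l /l0P; apply.
by rewrite ger0_norm.
Qed.

(** When the inner limits exist, the upper limit of the box averages is the
    average of the limits. *)
Lemma limit_box_cvg :
  (forall h : 'I_k -> nat, (forall i, (0 < h i)%N) -> cvgn (mcorr v h)) ->
  (fun H => (H%:R ^+ k)^-1 * \sum_(h : {ffun 'I_k -> 'I_H})
     limn (mcorr v (fun i => (h i).+1))) @ \oo --> (0 : R).
Proof.
move=> cv; apply: cvg_trans limsup_box_cvg; apply: near_eq_cvg; near=> H.
have bl : box H @ \oo --> ((H%:R ^+ k)^-1 * \sum_(h : {ffun 'I_k -> 'I_H})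
     limn (mcorr v (fun i => (h i).+1)) : R).
  apply: (@cvgM R _ _ _ (fun=> (H%:R ^+ k)^-1)); first exact: cvg_cst.
  by apply: (@cvg_sumr R R^o) => h _; apply: cv.
by rewrite (cvg_limn_supE _) ?(cvg_lim (@Rhausdorff R) bl) //; apply/cvg_ex; eexists; exact: bl.
Unshelve. all: by end_near. Qed.

End several_sequences.

End averaged_chowla.

(** * Measurability of complex functions *)

Section complex_measurability.
Variables (R : realType) (d : measure_display) (Y : measurableType d).
Implicit Types f g : Y -> R[i].

Definition cmeas f : Prop :=
  measurable_fun setT (fun y => complex.Re (f y)) /\
  measurable_fun setT (fun y => complex.Im (f y)).

Lemma rational_rectangle (U : set R[i]) z : open U -> U z ->
  exists p q r s : rat,
  [/\ ratr p < complex.Re z < ratr q, ratr r < complex.Im z < ratr s &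
    forall w, ratr p < complex.Re w < ratr q -> ratr r < complex.Im w < ratr s ->
    U w].
Proof.
move=> oU Uz; have /nbhs_cabs [e e0 eU] : nbhs z U by exact: open_nbhs_nbhs.
have e2 : 0 < e / 2 by rewrite divr_gt0.
have approx (x : R) : exists p q : rat, ratr p < x < ratr q /\
    forall y, ratr p < y < ratr q -> `|x - y| < e / 2.
  have xl : x - e / 2 < x by rewrite ltrBlDr ltrDl.
  have xr : x < x + e / 2 by rewrite ltrDl.
  have [p] := rat_in_itvoo xl; rewrite in_itv /= => /andP[p1 p2].
  have [q] := rat_in_itvoo xr; rewrite in_itv /= => /andP[q1 q2].
  exists p, q; split; first by rewrite p2 q1.
  by move=> y /andP[y1 y2]; rewrite ltr_norml; apply/andP; split; lra.
have [p [q [pq hpq]]] := approx (complex.Re z).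
have [r [s [rs hrs]]] := approx (complex.Im z).
exists p, q, r, s; split=> // w wpq wrs; apply: eU.
rewrite (le_lt_trans (cabs_le_ReIm _)) // [e]splitr !raddfB.
by apply: ltrD; [exact: hpq|exact: hrs].
Qed.

Lemma cmeasP f : cmeas f <-> forall U, open U -> measurable (f @^-1` U).
Proof.
split=> [[mr mi] U oU|mf]; last first.
  split; move=> _; apply: (measurability _ (RGenOInfty.measurableE R)) => //;
  move=> /= _ [_ [a ->] <-]; rewrite setTI.
    apply: (mf ((fun z => complex.Re z) @^-1` `]a, +oo[)).
    apply: open_comp => [z _|]; [exact: Re_continuous|exact: interval_open].
  apply: (mf ((fun z => complex.Im z) @^-1` `]a, +oo[)).
  apply: open_comp => [z _|]; [exact: Im_continuous|exact: interval_open].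
pose rect (p q r s : rat) := [set y |
  [/\ ratr p < complex.Re (f y) < ratr q, ratr r < complex.Im (f y) < ratr s &
    forall w : R[i], ratr p < complex.Re w < ratr q ->
      ratr r < complex.Im w < ratr s -> U w]].
rewrite (_ : f @^-1` U = \bigcup_p \bigcup_q \bigcup_r \bigcup_s rect p q r s).
  apply: bigcupT_measurable_rat => p; apply: bigcupT_measurable_rat => q.
  apply: bigcupT_measurable_rat => r; apply: bigcupT_measurable_rat => s.
  have [H|H] := pselect (forall w : R[i], ratr p < complex.Re w < ratr q ->
      ratr r < complex.Im w < ratr s -> U w); last first.
    by rewrite (_ : rect _ _ _ _ = set0) //; apply/seteqP; split=> // y [].
  rewrite (_ : rect _ _ _ _ = (setT `&` (fun y => complex.Re (f y)) @^-1` `]ratr p, ratr q[) `&`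
      (setT `&` (fun y => complex.Im (f y)) @^-1` `]ratr r, ratr s[)).
    by apply: measurableI; [apply: mr|apply: mi] => //; exact: measurable_itv.
  apply/seteqP; split=> y /=; rewrite !in_itv /=; first by case=> a b _; split.
  by move=> [[_ a] [_ b]]; split.
apply/seteqP; split=> [y Uy|y [p _] [q _] [r _] [s _] []] /=.
  have [p [q [r [s [pq rs H]]]]] := rational_rectangle oU Uy.
  by exists p => //; exists q => //; exists r => //; exists s.
by move=> a b; apply.
Qed.

Lemma cmeas_cst c : cmeas (cst c).
Proof. by split; exact: measurable_cst. Qed.

Lemma cmeasD f g : cmeas f -> cmeas g -> cmeas (fun y => f y + g y).
Proof.
move=> [fr fi] [gr gi]; split.
  by under eq_fun do rewrite raddfD; exact: measurable_funD.
by under eq_fun do rewrite raddfD; exact: measurable_funD.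
Qed.

Lemma Re_mulc (z w : R[i]) : complex.Re (z * w) =
  complex.Re z * complex.Re w - complex.Im z * complex.Im w.
Proof. by case: z => ? ?; case: w. Qed.

Lemma Im_mulc (z w : R[i]) : complex.Im (z * w) =
  complex.Re z * complex.Im w + complex.Im z * complex.Re w.
Proof. by case: z => ? ?; case: w => ? ? /=; rewrite [X in _ + X]mulrC. Qed.

Lemma cmeasM f g : cmeas f -> cmeas g -> cmeas (fun y => f y * g y).
Proof.
move=> [fr fi] [gr gi]; split.
  under eq_fun do rewrite Re_mulc.
  by apply: measurable_funB; exact: measurable_funM.
under eq_fun do rewrite Im_mulc.
by apply: measurable_funD; exact: measurable_funM.
Qed.

Lemma cmeasZ c f : cmeas f -> cmeas (fun y => c * f y).
Proof. by move=> mf; apply: cmeasM => //; exact: cmeas_cst. Qed.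

Lemma cmeasN f : cmeas f -> cmeas (fun y => - f y).
Proof.
by move=> /(cmeasZ (-1)); under eq_fun do rewrite mulN1r.
Qed.

Lemma cmeasB f g : cmeas f -> cmeas g -> cmeas (fun y => f y - g y).
Proof. by move=> mf mg; apply: cmeasD => //; exact: cmeasN. Qed.

Lemma cmeas_conj f : cmeas f -> cmeas (fun y => conjc (f y)).
Proof.
move=> [fr fi]; split.
  by rewrite (_ : (fun y => _) = (fun y => complex.Re (f y))) //; apply/funext => y; case: (f y).
rewrite (_ : (fun y => _) = (fun y => - complex.Im (f y))).
  exact: measurable_funN.
by apply/funext => y; case: (f y).
Qed.

Lemma cmeas_sum (I : Type) (r : seq I) (P : pred I) (f : I -> Y -> R[i]) :
  (forall i, P i -> cmeas (f i)) -> cmeas (fun y => \sum_(i <- r | P i) f i y).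
Proof.
move=> mf; elim: r => [|i r IH].
  by under eq_fun do rewrite big_nil; exact: cmeas_cst.
case Pi: (P i); under eq_fun do rewrite big_cons Pi; last exact: IH.
by apply: cmeasD IH; exact: mf.
Qed.

Lemma cmeas_real (h : Y -> R) : measurable_fun setT h <-> cmeas (fun y => (h y)%:C).
Proof. by split=> [mh|[]//]; split=> //=; exact: measurable_cst. Qed.

Lemma cmeas_sqr f : cmeas f -> measurable_fun setT (fun y => cabs (f y) ^+ 2).
Proof.
move=> [fr fi]; under eq_fun do rewrite cabsE.
by apply: measurable_funD; exact: measurable_funX.
Qed.

Lemma cmeas_sqrE f : cmeas f -> measurable_fun setT (fun y => (cabs (f y) ^+ 2)%:E).
Proof. by move=> mf; apply/measurable_EFinP; exact: cmeas_sqr. Qed.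

Lemma cmeas_indic (B : set Y) : measurable B -> cmeas (fun y => (\1_B y : R)%:C).
Proof. by move=> mB; apply/cmeas_real; exact: measurable_indic. Qed.

End complex_measurability.

(** A sub-sigma-algebra is the measurable structure of another type with the
    same carrier, to which [cmeasP] applies. *)
Lemma sub_sigma_algebraP (R : realType) (d : measure_display)
    (Y : measurableType d) (A : set (set Y)) (f : Y -> R[i]) :
  sigma_algebra setT A ->
  (forall a, A [set y | a < complex.Re (f y)]) ->
  (forall a, A [set y | a < complex.Im (f y)]) ->
  forall U, open U -> A (f @^-1` U).
Proof.
move=> sA Are Aim U oU.
pose YA := g_sigma_algebraType A.
have AE : @measurable _ YA = A by rewrite -[RHS](sigma_algebra_id sA).
have : @cmeas R _ YA f.
  split; move=> _; apply: (measurability _ (RGenOInfty.measurableE R)) => //;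
    move=> /= _ [_ [a ->] <-]; rewrite setTI preimage_itvoy AE; by [apply: Are|apply: Aim].
by move=> /cmeasP /(_ U oU); rewrite AE.
Qed.

(** * The square norm *)

Section square_norm.
Context {R : realType} {d : measure_display} {Y : measurableType d}.
Variable mu : probability Y R.
Implicit Types f g : Y -> R[i].

Local Notation N2 := (L2norm2 mu).

Lemma sqrE_ge0 f y : (0 <= (cabs (f y) ^+ 2)%:E)%E.
Proof. by rewrite lee_fin exprn_ge0 ?cabs_ge0. Qed.

Lemma N2_ge0 f : (0 <= N2 f)%E.
Proof. by apply: integral_ge0 => y _; exact: sqrE_ge0. Qed.

Lemma N2_le f g : cmeas f -> cmeas g -> (forall y, cabs (f y) <= cabs (g y)) ->
  (N2 f <= N2 g)%E.
Proof.
move=> mf mg fg; apply: ge0_le_integral => //.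
- by move=> y _; exact: sqrE_ge0.
- exact: cmeas_sqrE.
- exact: cmeas_sqrE.
- by move=> y _; rewrite lee_fin lerXn2r ?nnegrE ?cabs_ge0.
Qed.

Lemma N2Z c f : cmeas f -> N2 (fun y => c * f y) = ((cabs c ^+ 2)%:E * N2 f)%E.
Proof.
move=> mf; rewrite /L2norm2 -ge0_integralZl_EFin //.
- by apply: eq_integral => y _; rewrite cabsM exprMn EFinM.
- by move=> y _; exact: sqrE_ge0.
- exact: cmeas_sqrE.
- by rewrite exprn_ge0 ?cabs_ge0.
Qed.

Lemma N2D f g : cmeas f -> cmeas g ->
  (N2 (fun y => f y + g y)%R <= 2%:E * N2 f + 2%:E * N2 g)%E.
Proof.
move=> mf mg; rewrite /L2norm2 -!ge0_integralZl_EFin //; last 4 first.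
- by move=> y _; exact: sqrE_ge0.
- exact: cmeas_sqrE.
- by move=> y _; exact: sqrE_ge0.
- exact: cmeas_sqrE.
have m2 (h : Y -> R[i]) : cmeas h -> measurable_fun setT (fun y => (2%:E * (cabs (h y) ^+ 2)%:E)%E).
  move=> mh; rewrite (_ : (fun y => _) = (fun y => (2 * cabs (h y) ^+ 2)%:E)) //.
  by apply/measurable_EFinP; apply: measurable_funM => //; exact: cmeas_sqr.
have p2 (h : Y -> R[i]) : (forall y : Y, setT y -> (0 <= 2%:E * (cabs (h y) ^+ 2)%:E)%E).
  by move=> y _; apply: mule_ge0; [rewrite lee_fin|exact: (sqrE_ge0 h y)].
rewrite -ge0_integralD //; [|exact: p2|exact: m2|exact: p2|exact: m2].
apply: ge0_le_integral => //.
- by move=> y _; exact: (sqrE_ge0 (fun y => f y + g y)).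
- by apply: cmeas_sqrE; exact: cmeasD.
- by apply: emeasurable_funD; exact: m2.
- by move=> y _; rewrite -!EFinM -EFinD lee_fin cabsD_sqr.
Qed.

Lemma N2D_lt f g (a b : R) : cmeas f -> cmeas g ->
  (N2 f < a%:E)%E -> (N2 g < b%:E)%E ->
  (N2 (fun y => f y + g y)%R < (2 * (a + b))%:E)%E.
Proof.
move=> mf mg fa gb; apply: (le_lt_trans (N2D mf mg)).
by rewrite mulrDr (EFinD (2 * a)) lteD // EFinM lte_pmul2l // lte_fin ltr0n.
Qed.

Lemma N2B_lt f g (a b : R) : cmeas f -> cmeas g ->
  (N2 f < a%:E)%E -> (N2 g < b%:E)%E ->
  (N2 (fun y => f y - g y)%R < (2 * (a + b))%:E)%E.
Proof.
move=> mf mg fa gb; apply: N2D_lt => //; first exact: cmeasN.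
apply: le_lt_trans gb; rewrite N2_le //; first exact: cmeasN.
by move=> y; rewrite cabsN.
Qed.

Lemma N2M_le f g (M : R) : cmeas f -> cmeas g -> (forall y, cabs (g y) <= M) ->
  (N2 (fun y => f y * g y)%R <= (M ^+ 2)%:E * N2 f)%E.
Proof.
move=> mf mg gM.
have M0 : 0 <= M by apply: le_trans (gM point); exact: cabs_ge0.
have -> : (M ^+ 2)%:E = (cabs (M%:C : R[i]) ^+ 2)%:E by rewrite cabs_real ger0_norm.
rewrite -N2Z //; apply: N2_le; first exact: cmeasM.
  exact: cmeasZ.
by move=> y; rewrite !cabsM mulrC cabs_real ger0_norm // ler_wpM2r ?cabs_ge0.
Qed.

Lemma N2_cst c : N2 (cst c) = (cabs c ^+ 2)%:E.
Proof.
rewrite /L2norm2 (eq_integral (cst (cabs c ^+ 2)%:E)) // integral_cst //.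
by rewrite -[RHS]mule1; congr (_ * _)%E; exact: probability_setT.
Qed.

Lemma N2_bounded f (M : R) : cmeas f -> (forall y, cabs (f y) <= M) ->
  (N2 f <= (M ^+ 2)%:E)%E.
Proof.
move=> mf fM.
have M0 : 0 <= M by apply: le_trans (fM point); exact: cabs_ge0.
have -> : (M ^+ 2)%:E = N2 (cst M%:C) by rewrite N2_cst cabs_real ger0_norm.
apply: N2_le => // y.
by rewrite cabs_real ger0_norm.
Qed.

Lemma N2_lt f (e : R) : 0 < e -> (N2 f <= 0)%E -> (N2 f < e%:E)%E.
Proof. by move=> e0 f0; apply: le_lt_trans f0 _; rewrite lte_fin. Qed.

(** Dominated convergence for the squares. *)
Lemma N2_dominated (f_ : nat -> Y -> R[i]) f F :
  (forall n, cmeas (f_ n)) -> cmeas f -> cmeas F -> (N2 F < +oo)%E ->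
  (forall n y, cabs (f_ n y - f y) <= cabs (F y)) ->
  (forall y, (fun n => f_ n y) @ \oo --> f y) ->
  forall e : R, 0 < e ->
  \forall n \near \oo, (N2 (fun y => f_ n y - f y)%R < e%:E)%E.
Proof.
move=> mf_ mf mF F2 dom cv e e0.
have mB n : cmeas (fun y => f_ n y - f y) by exact: cmeasB.
have sq0 y : (fun n => (cabs (f_ n y - f y) ^+ 2)%:E) @ \oo --> 0%:E.
  apply: cvg_EFin; first by apply: nearW.
  apply/(@cvgrPdist_lt _ R^o) => a a0.
  have b0 : 0 < Num.min 1 a by rewrite lt_min ltr01.
  have /cvg_cabsP /(_ _ b0) := cv y; apply: filterS => n.
  rewrite lt_min => /andP[c1 ca]; rewrite sub0r normrN ger0_norm ?exprn_ge0 ?cabs_ge0 //=.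
  by rewrite (le_lt_trans _ ca) // expr2 ler_piMl ?cabs_ge0 ?ltW.
have intF : mu.-integrable setT (fun y => (cabs (F y) ^+ 2)%:E).
  apply/integrableP; split; first exact: cmeas_sqrE.
  rewrite (eq_integral (fun y => (cabs (F y) ^+ 2)%:E)) // => y _.
  by rewrite gee0_abs // sqrE_ge0.
have domE : {ae mu, forall y (n : nat), setT y ->
    (`|(cabs (f_ n y - f y) ^+ 2)%:E| <= (cabs (F y) ^+ 2)%:E)%E}.
  apply: aeW => y n _; rewrite gee0_abs ?lee_fin ?exprn_ge0 ?cabs_ge0 //.
  by rewrite lerXn2r ?nnegrE ?cabs_ge0.
have [_ _] := @dominated_convergence _ _ _ mu setT measurableT
  (fun n y => (cabs (f_ n y - f y) ^+ 2)%:E) (cst 0%E)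
  (fun y => (cabs (F y) ^+ 2)%:E) (fun n => cmeas_sqrE (mB n))
  (measurable_cst _ ) (aeW mu (fun y _ => sq0 y)) intF domE.
rewrite integral_cst // mul0e => cvg0.
apply: (cvg0 [set x | (x < e%:E)%E]); apply: open_nbhs_nbhs; split.
  exact: open_ereal_lt_ereal.
by rewrite /= lte_fin.
Qed.

End square_norm.

(** * Closures of function algebras in the square norm *)

Section real_sequences.
Variable R : realType.

Lemma cvg_expr0 (x : R) : 0 <= x < 1 -> (fun n => x ^+ n) @ \oo --> (0 : R).
Proof. by move=> /andP[x0 x1]; apply: cvg_expr; rewrite ger0_norm. Qed.

Lemma bernoulli (x : R) n : -1 <= x -> 1 + n%:R * x <= (1 + x) ^+ n.
Proof.
move=> x1; elim: n => [|n IH]; first by rewrite mul0r addr0 expr0.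
rewrite exprS; apply: (@le_trans _ _ ((1 + x) * (1 + n%:R * x))); last first.
  by rewrite ler_wpM2l //; lra.
rewrite -(natr1 n); have := mulr_ge0 (ler0n R n) (sqr_ge0 x); lra.
Qed.

(** The polynomials $(1-y^n)^{2^n}$ converge on $[0,1]$ to the indicator of
    $y<1/2$ away from $1/2$, by the inequality of Bernoulli. *)
Lemma threshold_lt (y : R) : 0 <= y < 2^-1 ->
  (fun n => (1 - y ^+ n) ^+ (2 ^ n)) @ \oo --> (1 : R).
Proof.
move=> /andP[y0 y2].
have c1 : (fun n => 1 - (2 * y) ^+ n) @ \oo --> (1 : R).
  rewrite -[X in _ --> X]subr0.
  apply: (@cvgB _ R^o); first exact: cvg_cst.
  by apply: cvg_expr0; apply/andP; split; lra.
apply: (@squeeze_cvgr _ _ _ R (fun n => 1 - (2 * y) ^+ n) (cst 1) _ _ _ c1);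
  [apply: nearW => n|exact: cvg_cst].
have yn0 : 0 <= y ^+ n by rewrite exprn_ge0.
have yn1 : y ^+ n <= 1 by rewrite exprn_ile1 //; lra.
apply/andP; split; last by rewrite exprn_ile1 // ; lra.
have := @bernoulli (- y ^+ n) (2 ^ n) _; rewrite natrX exprMn mulrN; apply; lra.
Qed.

Lemma threshold_gt (y : R) : 2^-1 < y <= 1 ->
  (fun n => (1 - y ^+ n) ^+ (2 ^ n)) @ \oo --> (0 : R).
Proof.
move=> /andP[y2 y1].
have y0 : 0 < y by lra.
have c0 : (fun n => ((2 * y)^-1) ^+ n) @ \oo --> (0 : R).
  apply: cvg_expr0; rewrite invr_ge0; apply/andP; split; first by lra.
  by rewrite invf_lt1; lra.
apply: (@squeeze_cvgr _ _ _ R (cst 0) (fun n => ((2 * y)^-1) ^+ n) _ _ _ _ c0);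
  [apply: nearW => n|exact: cvg_cst].
have yn0 : 0 < y ^+ n by rewrite exprn_gt0.
have yn1 : y ^+ n <= 1 by rewrite exprn_ile1 // ltW.
apply/andP; split; first by rewrite exprn_ge0 // ; lra.
rewrite [leRHS]exprVn -[X in _ <= X]div1r ler_pdivlMr; last by rewrite exprn_gt0; lra.
rewrite exprMn -natrX.
apply: (@le_trans _ _ ((1 - y ^+ n) ^+ (2 ^ n) * (1 + y ^+ n) ^+ (2 ^ n))).
  rewrite ler_wpM2l ?exprn_ge0 //; first by lra.
  apply: le_trans (@bernoulli (y ^+ n) (2 ^ n) _); last by lra.
  by rewrite lerDr.
rewrite -exprMn exprn_ile1 //; have := sqr_ge0 (y ^+ n); nra.
Qed.

End real_sequences.

Section closure_of_algebra.
Context {R : realType} {d : measure_display} {Y : measurableType d}.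
Variable mu : probability Y R.
Implicit Types f g : Y -> R[i].

Local Notation N2 := (L2norm2 mu).

Record function_algebra (W : set (Y -> R[i])) : Prop := FunctionAlgebra {
  algebra1 : W (cst 1);
  algebraD : forall f g, W f -> W g -> W (fun y => f y + g y);
  algebraM : forall f g, W f -> W g -> W (fun y => f y * g y);
  algebraZ : forall c f, W f -> W (fun y => c * f y);
  algebraC : forall f, W f -> W (fun y => conjc (f y));
  algebra_meas : forall f, W f -> cmeas f;
  algebra_bounded : forall f, W f -> exists M, forall y, cabs (f y) <= M }.

Definition L2_closure (W : set (Y -> R[i])) f : Prop :=
  cmeas f /\ forall e : R, 0 < e ->
    exists2 w, W w & (N2 (fun y => f y - w y)%R < e%:E)%E.

Variable W : set (Y -> R[i]).
Hypothesis WA : function_algebra W.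

Local Notation cl := (L2_closure W).

Definition bounded_closure f := cl f /\ exists M, forall y, cabs (f y) <= M.
Local Notation V := bounded_closure.

Lemma L2_closure_sub w : W w -> cl w.
Proof.
move=> Ww; split; first exact: algebra_meas Ww.
move=> e e0; exists w => //.
rewrite (_ : (fun y => _) = cst 0); last by apply/funext => y; rewrite subrr.
by rewrite N2_cst cabs0 expr0n lte_fin.
Qed.

Lemma bounded_closure_sub w : W w -> V w.
Proof. by move=> Ww; split; [exact: L2_closure_sub|exact: algebra_bounded Ww]. Qed.

Lemma L2_closure_limit f : cmeas f ->
  (forall e : R, 0 < e -> exists2 g, cl g & (N2 (fun y => f y - g y)%R < e%:E)%E) ->
  cl f.
Proof.
move=> mf fl; split=> // e e0.
have e4 : 0 < e / 4 by rewrite divr_gt0.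
have [g [mg gl] fg] := fl _ e4; have [w Ww gw] := gl _ e4.
exists w => //.
have := N2D_lt (cmeasB mf mg) (cmeasB mg (algebra_meas WA Ww)) fg gw.
have -> : 2 * (e / 4 + e / 4) = e by field.
by congr (N2 _ < _)%E; apply/funext => y; rewrite addrA subrK.
Qed.

Lemma L2_closureD f g : cl f -> cl g -> cl (fun y => f y + g y).
Proof.
move=> [mf fl] [mg gl]; split; first exact: cmeasD.
move=> e e0; have e4 : 0 < e / 4 by rewrite divr_gt0.
have [v Wv fv] := fl _ e4; have [w Ww gw] := gl _ e4.
exists (fun y => v y + w y); first exact: algebraD.
have := N2D_lt (cmeasB mf (algebra_meas WA Wv)) (cmeasB mg (algebra_meas WA Ww)) fv gw.
have -> : 2 * (e / 4 + e / 4) = e by field.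
by congr (N2 _ < _)%E; apply/funext => y; rewrite opprD addrACA.
Qed.

Lemma N2M_lt f g (M e : R) : cmeas f -> cmeas g -> (forall y, cabs (g y) <= M) ->
  (N2 f < (e / (M ^+ 2 + 1))%:E)%E -> (N2 (fun y => f y * g y)%R < e%:E)%E.
Proof.
move=> mf mg gM fe; have M1 : 0 < M ^+ 2 + 1 by rewrite ltr_pwDr ?sqr_ge0.
apply: (le_lt_trans (N2M_le mu mf mg gM)).
apply: (@le_lt_trans _ _ ((M ^+ 2 + 1)%:E * N2 f)%E).
  by rewrite lee_wpmul2r ?N2_ge0 // lee_fin lerDl.
have := fe; rewrite -(lte_pmul2l (z := (M ^+ 2 + 1)%:E)) ?lte_fin //.
by rewrite -EFinM mulrC divfK // lt0r_neq0.
Qed.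

Lemma L2_closureM_algebra f w : cl f -> W w -> cl (fun y => f y * w y).
Proof.
move=> [mf fl] Ww; have mw := algebra_meas WA Ww.
have [M wM] := algebra_bounded WA Ww; split; first exact: cmeasM.
move=> e e0; have M1 : 0 < e / (M ^+ 2 + 1) by rewrite divr_gt0 // ltr_pwDr ?sqr_ge0.
have [v Wv fv] := fl _ M1; exists (fun y => v y * w y); first exact: algebraM.
have := N2M_lt (cmeasB mf (algebra_meas WA Wv)) mw wM fv.
by congr (N2 _ < _)%E; apply/funext => y; rewrite mulrBl.
Qed.

(** The factor [g] is approximated first, at a cost governed by the bound of
    [f]. *)
Lemma L2_closureM f g : V f -> cl g -> cl (fun y => f y * g y).
Proof.
move=> [fl [M fM]] [mg gl]; have mf := fl.1.
apply: L2_closure_limit; first exact: cmeasM.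
move=> e e0; have M1 : 0 < e / (M ^+ 2 + 1) by rewrite divr_gt0 // ltr_pwDr ?sqr_ge0.
have [w Ww gw] := gl _ M1; exists (fun y => f y * w y); first exact: L2_closureM_algebra.
have := N2M_lt (cmeasB mg (algebra_meas WA Ww)) mf fM gw.
by congr (N2 _ < _)%E; apply/funext => y; rewrite mulrBl mulrC [w y * _]mulrC.
Qed.

Lemma bounded_closureM f g : V f -> V g -> V (fun y => f y * g y).
Proof.
move=> Vf [gl [M' gM]]; split; first exact: L2_closureM.
have [_ [M fM]] := Vf; exists (M * M') => y.
by rewrite cabsM ler_pM ?cabs_ge0.
Qed.

Lemma bounded_closureD f g : V f -> V g -> V (fun y => f y + g y).
Proof.
move=> [fl [M fM]] [gl [M' gM]]; split; first exact: L2_closureD.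
by exists (M + M') => y; rewrite (le_trans (cabsD _ _)) // lerD.
Qed.

Lemma bounded_closure_cst c : V (cst c).
Proof.
have := bounded_closure_sub (algebraZ WA c (algebra1 WA)).
by congr V; apply/funext => y; rewrite mulr1.
Qed.

Lemma bounded_closureZ c f : V f -> V (fun y => c * f y).
Proof. by move=> Vf; exact: bounded_closureM (bounded_closure_cst c) Vf. Qed.

Lemma L2_closureZ c f : cl f -> cl (fun y => c * f y).
Proof. by move=> cf; exact: L2_closureM (bounded_closure_cst c) cf. Qed.

Lemma bounded_closureX f n : V f -> V (fun y => f y ^+ n).
Proof.
move=> Vf; elim: n => [|n IH]; first by under eq_fun do rewrite expr0; exact: bounded_closure_cst.
by under eq_fun do rewrite exprS; exact: bounded_closureM.
Qed.

Lemma bounded_closureB f g : V f -> V g -> V (fun y => f y - g y).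
Proof.
move=> Vf Vg; have := bounded_closureD Vf (bounded_closureZ (-1) Vg).
by congr V; apply/funext => y; rewrite mulN1r.
Qed.

Lemma bounded_closure_conj f : V f -> V (fun y => conjc (f y)).
Proof.
move=> [[mf fl] [M fM]]; split; last by exists M => y; rewrite cabs_conj.
split; first exact: cmeas_conj.
move=> e e0; have [w Ww fw] := fl _ e0; exists (fun y => conjc (w y)).
  exact: algebraC.
congr (_ < _)%E: fw; apply: eq_integral => y _.
by rewrite -rmorphB cabs_conj.
Qed.

(** By dominated convergence. *)
Lemma bounded_closure_limit (f_ : nat -> Y -> R[i]) f (M : R) :
  (forall n, V (f_ n)) -> (forall n y, cabs (f_ n y) <= M) ->
  (forall y, (fun n => f_ n y) @ \oo --> f y) -> cmeas f /\ V f.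
Proof.
move=> Vf fM cv.
have mf_ n : cmeas (f_ n) by have [[]] := Vf n.
have mf : cmeas f.
  split; [apply: (@measurable_fun_cvg _ _ _ setT (fun n y => complex.Re (f_ n y)))|
          apply: (@measurable_fun_cvg _ _ _ setT (fun n y => complex.Im (f_ n y)))].
  - by move=> n; have [] := mf_ n.
  - by move=> y _; apply: (cvg_comp _ _ (cv y)); exact: Re_continuous.
  - by move=> n; have [] := mf_ n.
  - by move=> y _; apply: (cvg_comp _ _ (cv y)); exact: Im_continuous.
have fM' y : cabs (f y) <= M.
  have cy : (fun n => cabs (f_ n y)) @ \oo --> (cabs (f y) : R).
    by apply: (cvg_comp _ _ (cv y)); exact: cabs_continuous.
  rewrite -(cvg_lim (@Rhausdorff R) cy); apply: limr_le.
    by apply/cvg_ex; eexists; exact: cy.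
  exact: nearW.
split=> //; split; last by exists M.
have M0 : 0 <= M by apply: le_trans (fM' point); exact: cabs_ge0.
apply: L2_closure_limit => // e e0.
have dom n y : cabs (f_ n y - f y) <= cabs ((cst (2 * M)%:C : Y -> R[i]) y).
  rewrite cabs_real ger0_norm ?mulr_ge0 // (le_trans (cabsD _ _)) // cabsN.
  by rewrite (_ : 2 * M = M + M) ?lerD //; ring.
have fin : (N2 (cst (2 * M)%:C) < +oo)%E by rewrite N2_cst ltry.
have [n _ /(_ n (leqnn n)) nP] :=
  N2_dominated mf_ mf (@cmeas_cst R d Y (2 * M)%:C) fin dom cv e0.
exists (f_ n); first by have [] := Vf n.
by move: nP; congr (_ < _)%E; apply: eq_integral => y _; rewrite cabsB.
Qed.

Definition real_closure (h : Y -> R) := V (fun y => (h y)%:C).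

Lemma real_closure_limit (h_ : nat -> Y -> R) h (M : R) :
  (forall n, real_closure (h_ n)) -> (forall n y, `|h_ n y| <= M) ->
  (forall y, (fun n => h_ n y) @ \oo --> h y) -> real_closure h.
Proof.
move=> Vh hM cv.
have [|y|_ //] := @bounded_closure_limit (fun n y => (h_ n y)%:C) (fun y => (h y)%:C) M Vh.
  by move=> n y; rewrite cabs_real.
by apply: (cvg_comp _ _ (cv y)); exact: real_complex_continuous.
Qed.

Lemma real_closure_cst c : real_closure (cst c). Proof. exact: (bounded_closure_cst c%:C). Qed.

Lemma real_closureD h k : real_closure h -> real_closure k -> real_closure (fun y => h y + k y).
Proof.
by move=> Vh Vk; have := bounded_closureD Vh Vk; congr V; apply/funext => y; rewrite rmorphD.
Qed.

Lemma real_closureB h k : real_closure h -> real_closure k -> real_closure (fun y => h y - k y).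
Proof.
by move=> Vh Vk; have := bounded_closureB Vh Vk; congr V; apply/funext => y; rewrite rmorphB.
Qed.

Lemma real_closureM h k : real_closure h -> real_closure k -> real_closure (fun y => h y * k y).
Proof.
by move=> Vh Vk; have := bounded_closureM Vh Vk; congr V; apply/funext => y; rewrite rmorphM.
Qed.

Lemma real_closureX h n : real_closure h -> real_closure (fun y => h y ^+ n).
Proof.
by move=> Vh; have := bounded_closureX n Vh; congr V; apply/funext => y; rewrite rmorphXn.
Qed.

Lemma real_closure_ReIm f : V f -> real_closure (fun y => complex.Re (f y)) /\ real_closure (fun y => complex.Im (f y)).
Proof.
move=> Vf; have Vc := bounded_closure_conj Vf; split.
  have := bounded_closureZ (1 / 2) (bounded_closureD Vf Vc); congr V; apply/funext => y.
  by rewrite addcJ; field.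
have := bounded_closureZ (1 / (2 * 'i%C)) (bounded_closureB Vf Vc); congr V; apply/funext => y.
have i0 : ('i%C : R[i]) != 0 by rewrite eq_complex /= oner_eq0 andbF.
by rewrite subcJ; field.
Qed.

(** This is the sigma-algebra generated by [W], completed by the measurable
    sets that are null modifications of its members; indicators describe it
    without forming a completion. *)
Definition closure_sets : set (set Y) := fun B => measurable B /\ real_closure \1_B.
Local Notation K := closure_sets.

Lemma closure_setsP B : measurable B -> cl (fun y => (\1_B y : R)%:C) -> K B.
Proof.
move=> mB clB; split=> //; split=> //; exists 1 => y.
by rewrite cabs_real indicE ger0_norm //; case: (_ \in _).
Qed.

Lemma closure_sets_sigma : sigma_algebra setT K.
Proof.
have K0 : K set0.
  split; first exact: measurable0.
  have := real_closure_cst 0; congr real_closure; apply/funext => y.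
  by rewrite indicE in_set0.
have KC A : K A -> K (setT `\` A).
  move=> [mA VA]; split; first exact: measurableD.
  have := real_closureB (real_closure_cst 1) VA; congr real_closure; apply/funext => y.
  by rewrite setTD !indicE in_setC /=; case: (_ \in _); rewrite ?subrr ?subr0.
have KU A B : K A -> K B -> K (A `|` B).
  move=> [mA vA] [mB vB]; split; first exact: measurableU.
  have := real_closureB (real_closureD vA vB) (real_closureM vA vB); congr real_closure; apply/funext => y.
  by rewrite !indicE in_setU; case: (y \in A); case: (y \in B) => /=; lra.
split=> // A KA.
have KUn n : K (\big[setU/set0]_(i < n) A i).
  by elim/big_ind: _ => // *; exact: KU.
split; first by apply: bigcupT_measurable => k; have [] := KA k.
apply: (@real_closure_limit (fun n => \1_(\big[setU/set0]_(i < n) A i)) _ 1).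
- by move=> n; have [] := KUn n.
- by move=> n y; rewrite indicE ger0_norm //; case: (_ \in _).
move=> y; apply: cvg_near_cst.
have [[k _ Aky]|Ay] := pselect ((\bigcup_k A k) y).
  exists k.+1 => // n /= kn; rewrite !indicE !mem_set //; first by exists k.
  by rewrite -bigcup_mkord; exists k.
apply: nearW => n; rewrite !indicE !memNset //.
by rewrite -bigcup_mkord => -[k _ Aky]; apply: Ay; exists k.
Qed.

(** After $h-a$ is scaled into $g$ with values in $[-1,1]$, the indicator of
    $g>0$ is the pointwise limit of polynomials in $g$: a threshold that
    decides the sign, times a factor that vanishes where $g=0$ and tends to 1
    elsewhere. *)
Lemma closure_sets_gt (h : Y -> R) a : real_closure h -> K [set y | a < h y].
Proof.
move=> Vh; have [[mh _] [M hM]] := Vh.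
have M0 : 0 <= M by apply: le_trans (hM point); exact: cabs_ge0.
pose c := M + `|a| + 1; have c0 : 0 < c by rewrite ltr_pwDr // addr_ge0.
pose g y := (h y - a) / c.
have Vg : real_closure g by exact: real_closureM (real_closureB Vh (real_closure_cst a)) (real_closure_cst c^-1).
have g1 y : -1 <= g y <= 1.
  have := hM y; rewrite cabs_real => hy.
  rewrite -ler_norml /g normrM normfV (gtr0_norm c0) ler_pdivrMr // mul1r /c.
  rewrite (le_trans (ler_normB _ _)) //; lra.
pose t y := (1 - g y) / 2.
have Vt : real_closure t by exact: real_closureM (real_closureB (real_closure_cst 1) Vg) (real_closure_cst 2^-1).
have t01 y : 0 <= t y <= 1.
  by have /andP[? ?] := g1 y; rewrite /t; apply/andP; split; lra.
have s01 y : 0 <= 1 - g y ^+ 2 <= 1.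
  have /andP[? ?] := g1 y; apply/andP; split; last by rewrite gerBl sqr_ge0.
  by rewrite subr_ge0 -real_normK ?num_real // exprn_ile1 // ler_norml g1.
(* Here t < 1/2, t = 1/2 or t > 1/2 according as g > 0, g = 0 or g < 0. *)
pose p n y := (1 - t y ^+ n) ^+ (2 ^ n) * (1 - (1 - g y ^+ 2) ^+ n).
have Vp n : real_closure (p n).
  apply: real_closureM; first by apply: real_closureX; exact: real_closureB (real_closure_cst 1) (real_closureX n Vt).
  exact: real_closureB (real_closure_cst 1) (real_closureX n (real_closureB (real_closure_cst 1) (real_closureX 2 Vg))).
have p1 n y : `|p n y| <= 1.
  have /andP[t0 t1] := t01 y; have /andP[s0 s1] := s01 y.
  have tn0 : 0 <= t y ^+ n by rewrite exprn_ge0.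
  have tn1 : t y ^+ n <= 1 by rewrite exprn_ile1.
  have sn0 : 0 <= (1 - g y ^+ 2) ^+ n by rewrite exprn_ge0.
  have sn1 : (1 - g y ^+ 2) ^+ n <= 1 by rewrite exprn_ile1.
  rewrite /p ger0_norm ?mulr_ge0 ?exprn_ge0 ?subr_ge0 //.
  rewrite mulr_ile1 ?exprn_ge0 ?subr_ge0 ?exprn_ile1 ?subr_ge0 //; lra.
split.
  have /cmeas_real mhr := mh.
  by rewrite -[X in measurable X]setTI -preimage_itvoy; apply: mhr => //; exact: measurable_itv.
apply: (real_closure_limit Vp p1) => y.
have /andP[t0 t1] := t01 y; have /andP[s0 s1] := s01 y.
have ga : (a < h y) = (0 < g y) by rewrite /g pmulr_lgt0 ?invr_gt0 // subr_gt0.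
have sq : g y != 0 -> (fun n => 1 - (1 - g y ^+ 2) ^+ n) @ \oo --> (1 : R).
  move=> g0; rewrite -[X in _ --> X]subr0.
  apply: (@cvgB _ R^o); first exact: cvg_cst.
  apply: cvg_expr0; rewrite s0 /= gtrBl lt_neqAle sqr_ge0 andbT.
  by rewrite eq_sym expf_eq0.
have [g0|g0|g0] := ltgtP (g y) 0.
- rewrite indicE memNset /=; last by rewrite ga; apply/negP; rewrite -leNgt ltW.
  rewrite -[X in _ --> X](mul0r 1).
  apply: (@cvgM R); last by apply: sq; rewrite lt_eqF.
  by apply: threshold_gt; rewrite t1 andbT /t; lra.
- rewrite indicE mem_set /=; last by rewrite ga.
  rewrite -[X in _ --> X](mul1r 1).
  apply: (@cvgM R); last by apply: sq; rewrite gt_eqF.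
  by apply: threshold_lt; rewrite t0 /t; lra.
- rewrite indicE memNset /=; last by rewrite ga g0 ltxx.
  rewrite /p g0; apply: cvg_near_cst; apply: nearW => n.
  by rewrite expr0n /= subr0 expr1n subrr mulr0.
Qed.

Lemma closure_sets_preimage f U : V f -> open U -> K (f @^-1` U).
Proof.
move=> /real_closure_ReIm [Vr Vi]; apply: sub_sigma_algebraP => [|a|a].
- exact: closure_sets_sigma.
- exact: closure_sets_gt.
- exact: closure_sets_gt.
Qed.

Lemma closure_sets_measurable B : K B -> measurable B. Proof. by case. Qed.

(** The sum counts the multiples of $1/n$ below $h$. *)
Lemma unit_staircase (h : R) n : (0 < n)%N -> 0 <= h <= 1 ->
  `|n%:R^-1 * \sum_(j < n) (j%:R < n%:R * h)%R%:R - h| <= n%:R^-1.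
Proof.
move=> n0 /andP[h0 h1]; have nR : 0 < n%:R :> R by rewrite ltr0n.
pose x := n%:R * h.
have xn : x <= n%:R by rewrite /x ler_piMr // ltW.
have x0 : 0 <= x by rewrite mulr_ge0 // ltW.
have stair m : (m <= n)%N ->
    (\sum_(j < m) (j%:R < x)%R%:R : R) <= x + 1 /\
    Num.min x m%:R <= (\sum_(j < m) (j%:R < x)%R%:R : R) /\
    (\sum_(j < m) (j%:R < x)%R%:R : R) <= m%:R.
  elim: m => [|m IH] mn; first by rewrite big_ord0 ge_min lexx orbT; split=> //; lra.
  have [IH1 [IH2 IH3]] := IH (ltnW mn); rewrite big_ord_recr /= -(natr1 m).
  case: (ltrP m%:R x) => mx /=.
    by move: IH2; rewrite !(minEle x); do 2 case: ifPn => //; rewrite -?ltNge; lra.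
  rewrite addr0; split=> //; split; last by lra.
  by apply: le_trans IH2; rewrite le_min !ge_min lexx /= mx.
have [s1 [s2 _]] := stair n (leqnn n); rewrite min_l // in s2.
rewrite -[X in _ - X](mulKf (lt0r_neq0 nR)) -mulrBr normrM gtr0_norm ?invr_gt0 //.
rewrite -[leRHS]mulr1 ler_pM2l ?invr_gt0 // ler_norml -/x; apply/andP; split; lra.
Qed.

Lemma real_closure_sum (I : Type) (r : seq I) (h : I -> Y -> R) :
  (forall i, real_closure (h i)) -> real_closure (fun y => \sum_(i <- r) h i y).
Proof.
move=> Vh; elim: r => [|i r IH].
  have := real_closure_cst 0; congr real_closure; apply/funext => y.
  by rewrite big_nil.
have := real_closureD (Vh i) IH; congr real_closure; apply/funext => y.
by rewrite big_cons.
Qed.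

Lemma closure_unit (h : Y -> R) : (forall y, 0 <= h y <= 1) ->
  (forall a, K [set y | a < h y]) -> real_closure h.
Proof.
move=> h01 Kh.
pose s n y := n.+1%:R^-1 * \sum_(j < n.+1) (\1_[set y | j%:R / n.+1%:R < h y] y : R).
have Vs n : real_closure (s n).
  apply: (real_closureM (real_closure_cst _)); apply: real_closure_sum => j.
  by have [] := Kh (j%:R / n.+1%:R).
have sh n y : `|s n y - h y| <= n.+1%:R^-1.
  apply: le_trans (unit_staircase (ltn0Sn n) (h01 y)).
  rewrite le_eqVlt; apply/orP; left; apply/eqP; congr `|_ * _ - _|.
  apply: eq_bigr => j _; rewrite indicE.
  have -> : (j%:R < n.+1%:R * h y) = (j%:R / n.+1%:R < h y).
    by rewrite ltr_pdivrMr ?ltr0n // mulrC.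
  congr (nat_of_bool _)%:R; apply/idP/idP => [/set_mem //|lt].
  exact/mem_set.
apply: (real_closure_limit (M := 2) Vs) => [n y|y].
  rewrite -[s n y](subrK (h y)) (le_trans (ler_normD _ _)) //.
  have /andP[h0 h1] := h01 y; rewrite (ger0_norm h0) (_ : 2 = 1 + 1) //.
  by rewrite lerD // (le_trans (sh n y)) // invf_le1 ?ltr0n // ler1n.
apply/(@cvgrPdist_le _ R^o) => e e0.
have := @near_infty_natSinv_lt R (PosNum e0); apply: filterS => n /= ne.
by rewrite distrC (le_trans (sh n y)) // ltW.
Qed.

Lemma closure_bounded (h : Y -> R) (M : R) : (forall y, `|h y| <= M) ->
  (forall a, K [set y | a < h y]) -> real_closure h.
Proof.
move=> hM Kh; have M0 : 0 <= M by apply: le_trans (hM point).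
have c0 : 0 < 2 * M + 1 by rewrite ltr_pwDr // mulr_ge0.
pose g y := (h y + M) / (2 * M + 1).
have Vg : real_closure g.
  apply: closure_unit => [y|a].
    have := hM y; rewrite ler_norml => /andP[? ?].
    rewrite /g; apply/andP; split; first by apply: divr_ge0; [lra|exact: ltW].
    by rewrite ler_pdivrMr //; lra.
  have := Kh (a * (2 * M + 1) - M); congr K; apply/seteqP; split=> y /=;
  by rewrite /g ltr_pdivlMr // ltrBlDr.
have := real_closureB (real_closureM (real_closure_cst (2 * M + 1)) Vg) (real_closure_cst M); congr real_closure; apply/funext => y.
by rewrite /g /=; field; exact: lt0r_neq0.
Qed.

Lemma closure_setT : K setT.
Proof.
have [K0 KC _] := closure_sets_sigma.
by have := KC _ K0; rewrite setD0.
Qed.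

Lemma closure_set0 : K set0.
Proof. by have [] := closure_sets_sigma. Qed.

Definition clamp (M x : R) : R := Num.max (- M) (Num.min M x).

Lemma clamp_dist M x : 0 <= M -> `|clamp M x - x| <= `|x|.
Proof.
move=> M0; rewrite /clamp; case: (leP x M) => xM.
  rewrite /Num.min; case: (leP (- M) x) => Mx; first by rewrite subrr normr0.
  by rewrite ger0_norm ?ler0_norm; lra.
have -> : Num.max (- M) M = M by apply/max_idPr; lra.
by rewrite ler0_norm ?ger0_norm; lra.
Qed.

Lemma closure_clamp (h : Y -> R) (n : nat) :
  (forall a, K [set y | a < h y]) -> real_closure (fun y => clamp n%:R (h y)).
Proof.
move=> Kh; apply: (@closure_bounded _ n%:R) => [y|a].
  rewrite /clamp ler_norml le_max lexx /= ge_max ge_min lexx andbT.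
  by rewrite (le_trans _ (ler0n R n)) // oppr_le0.
have [an|na] := ltP a (- n%:R).
  rewrite (_ : [set y | _] = setT); first exact: closure_setT.
  by apply/seteqP; split=> // y _ /=; rewrite /clamp lt_max an.
have [na'|an] := leP n%:R a.
  rewrite (_ : [set y | _] = set0); first exact: closure_set0.
  apply/seteqP; split=> // y /=; rewrite /clamp lt_max lt_min.
  by rewrite (ltNge a n%:R) na' /= orbF ltNge na.
have := Kh a; congr K; apply/seteqP; split=> y /=;
by rewrite /clamp lt_max lt_min an /= [a < - _]ltNge na.
Qed.

(** The real and imaginary parts truncated at level $n$ are uniform limits of
    staircases over the sets of [K], hence belong to the closure, and they
    converge to $f$ in the square norm. *)
Lemma L2_closure_sets f : L2 mu K f -> cl f.
Proof.
move=> [Kf f2].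
have mf : cmeas f by apply/cmeasP => U /Kf /closure_sets_measurable.
have Kr a : K [set y | a < complex.Re (f y)].
  apply: (Kf [set z | a < complex.Re z]).
  apply: (@open_comp _ _ (fun z : R[i] => complex.Re z : R) [set x | a < x]); last exact: open_gt.
  by move=> z _; exact: Re_continuous.
have Ki a : K [set y | a < complex.Im (f y)].
  apply: (Kf [set z | a < complex.Im z]).
  apply: (@open_comp _ _ (fun z : R[i] => complex.Im z : R) [set x | a < x]); last exact: open_gt.
  by move=> z _; exact: Im_continuous.
pose f_ (n : nat) y := (clamp n%:R (complex.Re (f y)))%:C
  + 'i%C * (clamp n%:R (complex.Im (f y)))%:C.
have clf n : V (f_ n).
  by apply: bounded_closureD; [exact: closure_clamp|apply: bounded_closureZ; exact: closure_clamp].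
have fE y : f y = (complex.Re (f y))%:C + 'i%C * (complex.Im (f y))%:C by exact: complexE.
have clamped (x : R) (n : nat) : `|x| <= n%:R -> clamp n%:R x = x.
  by rewrite ler_norml => /andP[? ?]; rewrite /clamp min_r // max_r.
apply: L2_closure_limit => // e e0.
have dist n y : cabs (f_ n y - f y) <= cabs (f y).
  rewrite -ler_sqr ?nnegrE ?cabs_ge0 // !cabsE.
  have f_E : f_ n y = Complex (clamp n%:R (complex.Re (f y)))
      (clamp n%:R (complex.Im (f y))) by rewrite [RHS]complexE.
  rewrite f_E; case: (f y) => p q /=.
  by apply: lerD; rewrite -[leLHS]real_normK ?num_real // -[leRHS]real_normK ?num_real //;
    rewrite lerXn2r ?nnegrE // clamp_dist.
have cv y : (fun n => f_ n y) @ \oo --> f y.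
  apply: cvg_near_cst; exists (Num.truncn (cabs (f y))).+1 => // n /= yn.
  have cn : cabs (f y) <= n%:R.
    by rewrite (le_trans (ltW (truncnS_gt _))) // ler_nat.
  rewrite /f_ !clamped -?fE //; first exact: le_trans (Im_cabs _) cn.
  exact: le_trans (Re_cabs _) cn.
have mf_ n : cmeas (f_ n) by have [[]] := clf n.
have [n _ /(_ n (leqnn n)) nP] := N2_dominated mf_ mf mf f2 dist cv e0.
exists (f_ n); first by have [] := clf n.
by move: nP; congr (_ < _)%E; apply: eq_integral => y _; rewrite cabsB.
Qed.

End closure_of_algebra.

(** * Complex integrals *)

Section complex_integral.
Context {R : realType} {d : measure_display} {Y : measurableType d}.
Variable mu : probability Y R.
Implicit Types f g : Y -> R[i].

Local Notation N2 := (L2norm2 mu).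
Local Notation cint := (cintegral mu).

Definition cintegrable f : Prop :=
  mu.-integrable setT (EFin \o (fun y => complex.Re (f y))) /\
  mu.-integrable setT (EFin \o (fun y => complex.Im (f y))).

Lemma cintegrable_dom f (G : Y -> R) : cmeas f ->
  mu.-integrable setT (EFin \o G) -> (forall y, cabs (f y) <= G y) ->
  cintegrable f.
Proof.
move=> [mr mi] iG fG; split; apply: le_integrable iG => //.
- exact/measurable_EFinP.
- move=> y _; rewrite /= lee_fin; apply: (le_trans (Re_cabs _)).
  exact: le_trans (fG y) (ler_norm _).
- exact/measurable_EFinP.
- move=> y _; rewrite /= lee_fin; apply: (le_trans (Im_cabs _)).
  exact: le_trans (fG y) (ler_norm _).
Qed.

Lemma sqr_integrable f : cmeas f -> (N2 f < +oo)%E ->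
  mu.-integrable setT (EFin \o (fun y => cabs (f y) ^+ 2)).
Proof.
move=> mf f2; apply/integrableP; split; first exact: cmeas_sqrE.
rewrite (eq_integral (fun y => (cabs (f y) ^+ 2)%:E)) // => y _.
by rewrite gee0_abs //= lee_fin exprn_ge0 ?cabs_ge0.
Qed.

Lemma cst_integrable (c : R) : mu.-integrable setT (EFin \o cst c).
Proof. exact: finite_measure_integrable_cst. Qed.

Lemma L2_integrable f : cmeas f -> (N2 f < +oo)%E -> cintegrable f.
Proof.
move=> mf f2.
apply: (@cintegrable_dom _ (fun y => 1 + cabs (f y) ^+ 2)) => // [|y]; last first.
  have := sqr_ge0 (cabs (f y) - 2^-1); nra.
have := integrableD measurableT (cst_integrable 1) (sqr_integrable mf f2).
by congr (mu.-integrable _ _).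
Qed.

Lemma L2_mul_integrable f g : cmeas f -> cmeas g ->
  (N2 f < +oo)%E -> (N2 g < +oo)%E -> cintegrable (fun y => f y * g y).
Proof.
move=> mf mg f2 g2.
apply: (@cintegrable_dom _ (fun y => cabs (f y) ^+ 2 + cabs (g y) ^+ 2)).
- exact: cmeasM.
- have := integrableD measurableT (sqr_integrable mf f2) (sqr_integrable mg g2).
  by congr (mu.-integrable _ _).
- move=> y; rewrite cabsM.
  have := sqr_ge0 (cabs (f y) - cabs (g y)); have := cabs_ge0 (f y); have := cabs_ge0 (g y).
  nra.
Qed.

Lemma bounded_L2 f (M : R) : cmeas f -> (forall y, cabs (f y) <= M) -> (N2 f < +oo)%E.
Proof. by move=> mf fM; apply: le_lt_trans (N2_bounded mu mf fM) _; exact: ltry. Qed.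

Lemma cintegralD f g : cintegrable f -> cintegrable g ->
  cint (fun y => f y + g y) = cint f + cint g.
Proof.
move=> [fr fi] [gr gi]; rewrite /cintegral.
under eq_Rintegral do rewrite raddfD.
rewrite RintegralD //; under [X in Complex _ X]eq_Rintegral do rewrite raddfD.
by rewrite RintegralD.
Qed.

Lemma integrableZ_real (k : R) (h : Y -> R) : mu.-integrable setT (EFin \o h) ->
  mu.-integrable setT (EFin \o (fun y => k * h y)).
Proof.
move=> ih; have := integrableZl measurableT k ih; by congr (mu.-integrable _ _).
Qed.

Lemma cintegralZ c f : cintegrable f -> cint (fun y => c * f y) = c * cint f.
Proof.
move=> [fr fi]; rewrite /cintegral; case: c => a b.
apply/eqP; rewrite eq_complex /=; apply/andP; split; apply/eqP.
  rewrite -!RintegralZl // -RintegralB //; [|exact: integrableZ_real|exact: integrableZ_real].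
  by apply: eq_Rintegral => y _; rewrite Re_mulc.
rewrite -!RintegralZl // -RintegralD //; [|exact: integrableZ_real|exact: integrableZ_real].
by apply: eq_Rintegral => y _; rewrite Im_mulc.
Qed.

Lemma cintegralB f g : cintegrable f -> cintegrable g ->
  cint (fun y => f y - g y) = cint f - cint g.
Proof.
move=> [fr fi] [gr gi]; rewrite /cintegral.
under eq_Rintegral do rewrite raddfB.
rewrite RintegralB //; under [X in Complex _ X]eq_Rintegral do rewrite raddfB.
by rewrite RintegralB.
Qed.

Lemma cintegrableZ c f : cintegrable f -> cintegrable (fun y => c * f y).
Proof.
move=> [fr fi].
split.
  have := integrableB measurableT (integrableZ_real (complex.Re c) fr) (integrableZ_real (complex.Im c) fi).
  by congr (mu.-integrable _ _); apply/funext => y; rewrite /= Re_mulc.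
have := integrableD measurableT (integrableZ_real (complex.Re c) fi) (integrableZ_real (complex.Im c) fr).
by congr (mu.-integrable _ _); apply/funext => y; rewrite /= Im_mulc.
Qed.

Lemma cintegrableD f g : cintegrable f -> cintegrable g -> cintegrable (fun y => f y + g y).
Proof.
move=> [fr fi] [gr gi]; split.
  have := integrableD measurableT fr gr.
  by congr (mu.-integrable _ _); apply/funext => y; rewrite /= raddfD.
have := integrableD measurableT fi gi.
by congr (mu.-integrable _ _); apply/funext => y; rewrite /= raddfD.
Qed.

Lemma cintegral_sum (I : Type) (r : seq I) (f : I -> Y -> R[i]) :
  (forall i, cintegrable (f i)) ->
  cintegrable (fun y => \sum_(i <- r) f i y) /\
  cint (fun y => \sum_(i <- r) f i y) = \sum_(i <- r) cint (f i).
Proof.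
move=> fi; elim: r => [|i r [IH1 IH2]].
  under [X in cintegrable X]eq_fun do rewrite big_nil.
  split; first by split; exact: cst_integrable.
  rewrite big_nil /cintegral.
  by apply/eqP; rewrite eq_complex /=; apply/andP; split; apply/eqP;
    under eq_Rintegral do rewrite big_nil; rewrite Rintegral_cst // mul0r.
have E : (fun y => \sum_(i <- i :: r) f i y) = (fun y => f i y + \sum_(i <- r) f i y).
  by apply/funext => y; rewrite big_cons.
rewrite E; split; first exact: cintegrableD.
by rewrite cintegralD // IH2 big_cons.
Qed.

(** A form of the Cauchy-Schwarz inequality; the free parameter $t$ replaces
    the optimal ratio of the two norms. *)
Lemma cabs_cintegral_le p q (t a b : R) : 0 < t -> cmeas p -> cmeas q ->
  (N2 p <= a%:E)%E -> (N2 q <= b%:E)%E ->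
  cabs (cint (fun y => p y * conjc (q y))) <= t * a + t^-1 * b.
Proof.
move=> t0 mp mq pa qb.
have p2 : (N2 p < +oo)%E := le_lt_trans pa (ltry _).
have q2 : (N2 q < +oo)%E := le_lt_trans qb (ltry _).
have mqc := cmeas_conj mq.
have qc2 : (N2 (fun y => conjc (q y)) < +oo)%E.
  by apply: le_lt_trans q2; apply: N2_le => // y; rewrite cabs_conj.
have [ir ii] := L2_mul_integrable mp mqc p2 qc2.
have ip := sqr_integrable mp p2; have iq := sqr_integrable mq q2.
pose G y := t / 2 * cabs (p y) ^+ 2 + t^-1 / 2 * cabs (q y) ^+ 2.
have iG : mu.-integrable setT (EFin \o G).
  have := integrableD measurableT (integrableZ_real (t / 2) ip) (integrableZ_real (t^-1 / 2) iq).
  by congr (mu.-integrable _ _).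
have pG y : cabs (p y * conjc (q y)) <= G y.
  rewrite cabsM cabs_conj /G.
  have -> : t / 2 * cabs (p y) ^+ 2 + t^-1 / 2 * cabs (q y) ^+ 2 =
      (2 * t)^-1 * ((t * cabs (p y)) ^+ 2 + cabs (q y) ^+ 2).
    by field; exact: lt0r_neq0.
  rewrite ler_pdivlMl ?mulr_gt0 //.
  have := sqr_ge0 (t * cabs (p y) - cabs (q y)); nra.
have Gle : \int[mu]_y G y <= t / 2 * a + t^-1 / 2 * b.
  have sq_le h (c : R) : (N2 h <= c%:E)%E -> (N2 h < +oo)%E ->
      \int[mu]_y (cabs (h y) ^+ 2) <= c.
    move=> hc h2; rewrite -lee_fin; apply: le_trans hc.
    rewrite /Rintegral fineK // ge0_fin_numE //; exact: (N2_ge0 mu h).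
  rewrite RintegralD //; [|exact: integrableZ_real|exact: integrableZ_real].
  rewrite !RintegralZl //; apply: lerD; apply: ler_wpM2l;
    rewrite ?divr_ge0 ?invr_ge0 ?(ltW t0) //; exact: sq_le.
have part (k : R[i] -> R) : (forall z, `|k z| <= cabs z) ->
    mu.-integrable setT (EFin \o (fun y => k (p y * conjc (q y)))) ->
    `|\int[mu]_y k (p y * conjc (q y))| <= t / 2 * a + t^-1 / 2 * b.
  move=> kz ik; apply: le_trans Gle; apply: (le_trans (le_normr_Rintegral measurableT ik)).
  apply: le_Rintegral => //.
    have := integrable_norm ik; by congr (mu.-integrable _ _).
  by move=> y _; exact: le_trans (kz _) (pG y).
rewrite (le_trans (cabs_le_ReIm _)) //= (_ : t * a + t^-1 * b =
  (t / 2 * a + t^-1 / 2 * b) + (t / 2 * a + t^-1 / 2 * b)); last by field; exact: lt0r_neq0.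
by apply: lerD; apply: part => //; [exact: Re_cabs|exact: Im_cabs].
Qed.

Section invariance.
Variable T : Y -> Y.
Hypothesis mT : measurable_fun setT T.
Hypothesis pT : forall B, measurable B -> mu (T @^-1` B) = mu B.

Lemma cmeas_comp f : cmeas f -> cmeas (f \o T).
Proof.
by move=> [fr fi]; split; [exact: (measurableT_comp fr mT)|exact: (measurableT_comp fi mT)].
Qed.

Lemma ae_comp (P : Y -> Prop) : {ae mu, forall y, P y} -> {ae mu, forall y, P (T y)}.
Proof.
move=> [A [mA A0 PA]]; exists (T @^-1` A); split.
- by rewrite -[X in measurable X]setTI; exact: mT.
- by rewrite pT.
- by move=> y /= nP; apply: PA.
Qed.

Lemma N2_comp f : cmeas f -> N2 (f \o T) = N2 f.
Proof.
move=> mf; rewrite /L2norm2.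
rewrite -[RHS](@eq_measure_integral _ _ _ _ _ (pushforward mu T)); last first.
  by move=> A mA _; exact: (pT mA).
rewrite ge0_integral_pushforward ?preimage_setT //.
- exact: cmeas_sqrE.
- by move=> y _; rewrite lee_fin exprn_ge0 ?cabs_ge0.
Qed.

Lemma cintegral_comp f : cmeas f -> cintegrable (f \o T) -> cint (f \o T) = cint f.
Proof.
move=> mf [ir ii].
have inv (h : Y -> R) : measurable_fun setT h ->
    mu.-integrable setT (EFin \o (h \o T)) ->
    \int[mu]_y (h \o T) y = \int[mu]_y h y.
  move=> mh ih; congr fine.
  rewrite -[RHS](@eq_measure_integral _ _ _ _ _ (pushforward mu T)); last first.
    by move=> A mA _; exact: (pT mA).
  rewrite integral_pushforward ?preimage_setT //.
  exact/measurable_EFinP.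
have [mr mi] := mf.
by apply/eqP; rewrite eq_complex /=; apply/andP; split; apply/eqP; apply: inv.
Qed.

End invariance.

Lemma N2_ae f g : cmeas f -> cmeas g -> {ae mu, forall y, f y = g y} -> N2 f = N2 g.
Proof.
move=> mf mg fg; apply: ge0_ae_eq_integral => //.
- exact: cmeas_sqrE.
- exact: cmeas_sqrE.
- by move=> y _; rewrite lee_fin exprn_ge0 ?cabs_ge0.
- by move=> y _; rewrite lee_fin exprn_ge0 ?cabs_ge0.
- by apply: filterS fg => y -> _.
Qed.

Lemma cintegral_ae f g : cmeas f -> cmeas g -> {ae mu, forall y, f y = g y} ->
  cint f = cint g.
Proof.
move=> [fr fi] [gr gi] fg.
by apply/eqP; rewrite eq_complex /=; apply/andP; split; apply/eqP; congr fine;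
  apply: ae_eq_integral => //; try exact/measurable_EFinP; apply: filterS fg => y -> _.
Qed.

End complex_integral.

(** * Eigenfunctions and the Kronecker factor *)

Section eigenfunctions.
Context {R : realType} {d : measure_display} {Y : measurableType d}.
Variables (mu : probability Y R) (T : Y -> Y).
Implicit Types f g : Y -> R[i].

Local Notation N2 := (L2norm2 mu).
Local Notation eigen := (eigenfunction mu T measurable).

Hypothesis mT : measurable_fun setT T.
Hypothesis pT : forall B, measurable B -> mu (T @^-1` B) = mu B.

Lemma L2_cmeas f : L2 mu measurable f <-> cmeas f /\ (N2 f < +oo)%E.
Proof. by split=> -[mf f2]; split=> //; [apply/cmeasP|move/cmeasP: mf]. Qed.

(** Invariance of the measure gives $\|g\|=\|g\circ T\|=|\lambda|\,\|g\|$. *)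
Lemma eigenvalue_unimodular lam g : eigen lam g -> cabs lam = 1 \/ N2 g = 0%E.
Proof.
move=> [/L2_cmeas [mg g2] gT]; have g0 := N2_ge0 mu g.
have gE : N2 g = ((cabs lam ^+ 2)%:E * N2 g)%E.
  rewrite -N2Z // -[LHS](N2_comp mT pT mg); apply: N2_ae => //.
  - exact: cmeas_comp.
  - exact: cmeasZ.
have gf : N2 g \is a fin_num by rewrite ge0_fin_numE.
rewrite -(fineK gf) in gE g0 *; move: gE; rewrite -EFinM => -[gE].
have [->|gn0] := eqVneq (fine (N2 g)) 0; first by right.
left; have : (cabs lam ^+ 2 - 1) * fine (N2 g) = 0 by rewrite mulrBl mul1r -gE subrr.
move/eqP; rewrite mulf_eq0 (negPf gn0) orbF subr_eq0 => /eqP lam2.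
by move/eqP: lam2; rewrite pexpr_eq1 ?cabs_ge0 // => /eqP.
Qed.

Definition bounded_eigenfunction g : Prop :=
  [/\ cmeas g, exists M, forall y, cabs (g y) <= M &
      exists lam, {ae mu, forall y, g (T y) = lam * g y}].

Lemma bounded_eigen g : bounded_eigenfunction g ->
  exists lam, eigen lam g.
Proof.
move=> [mg [M gM] [lam gT]]; exists lam; split=> //.
by apply/L2_cmeas; split=> //; exact: bounded_L2 gM.
Qed.

(** Only bounded eigenfunctions span, so that the span is an algebra. *)
Inductive eigenspan : set (Y -> R[i]) :=
| eigenspan0 : eigenspan (cst 0)
| eigenspanD c g w : bounded_eigenfunction g -> eigenspan w ->
    eigenspan (fun y => c * g y + w y).

Lemma eigenspan_add f g : eigenspan f -> eigenspan g ->
  eigenspan (fun y => f y + g y).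
Proof.
move=> sf sg; elim: sf => [|c h w bh sw IH].
  by rewrite (_ : (fun y => _) = g) //; apply/funext => y; rewrite add0r.
have := eigenspanD c bh IH; congr eigenspan.
by apply/funext => y; rewrite addrA.
Qed.

Lemma eigenspan_scale c f : eigenspan f -> eigenspan (fun y => c * f y).
Proof.
elim=> [|e h w bh sw IH].
  by rewrite (_ : (fun y => _) = cst 0); [exact: eigenspan0|apply/funext => y; rewrite mulr0].
have := eigenspanD (c * e) bh IH; congr eigenspan.
by apply/funext => y; rewrite mulrDr mulrA.
Qed.

Lemma eigenspan_sub g : bounded_eigenfunction g -> eigenspan g.
Proof.
move=> bg; have := eigenspanD 1 bg eigenspan0; congr eigenspan.
by apply/funext => y; rewrite mul1r addr0.
Qed.

Lemma bounded_eigen_mul f g : bounded_eigenfunction f -> bounded_eigenfunction g ->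
  bounded_eigenfunction (fun y => f y * g y).
Proof.
move=> [mf [M fM] [l fT]] [mg [M' gM] [l' gT]]; split; first exact: cmeasM.
  by exists (M * M') => y; rewrite cabsM ler_pM ?cabs_ge0.
exists (l * l'); apply: filterS2 fT gT => y -> ->; by rewrite mulrACA.
Qed.

Lemma bounded_eigen_conj f : bounded_eigenfunction f ->
  bounded_eigenfunction (fun y => conjc (f y)).
Proof.
move=> [mf [M fM] [l fT]]; split; first exact: cmeas_conj.
  by exists M => y; rewrite cabs_conj.
by exists (conjc l); apply: filterS fT => y ->; rewrite rmorphM.
Qed.

Lemma eigenspan_mul f g : eigenspan f -> eigenspan g ->
  eigenspan (fun y => f y * g y).
Proof.
move=> sf sg; elim: sf => [|c h w bh sw IH].
  by rewrite (_ : (fun y => _) = cst 0); [exact: eigenspan0|apply/funext => y; rewrite mul0r].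
have hg : eigenspan (fun y => h y * g y).
  elim: sg => [|e k v bk sv IHv].
    by rewrite (_ : (fun y => _) = cst 0); [exact: eigenspan0|apply/funext => y; rewrite mulr0].
  have := eigenspanD e (bounded_eigen_mul bh bk) IHv; congr eigenspan.
  by apply/funext => y; rewrite mulrDr mulrCA.
have := eigenspan_add (eigenspan_scale c hg) IH; congr eigenspan.
by apply/funext => y; rewrite mulrDl mulrA.
Qed.

Lemma eigenspan_algebra : function_algebra eigenspan.
Proof.
split.
- apply: eigenspan_sub; split; first exact: cmeas_cst.
    by exists 1 => y; rewrite cabs1.
  by exists 1; apply: aeW => y; rewrite mul1r.
- exact: eigenspan_add.
- exact: eigenspan_mul.
- exact: eigenspan_scale.
- move=> f; elim=> [|c g w bg sw IH].
    by rewrite (_ : (fun y => _) = cst 0); [exact: eigenspan0|apply/funext => y; rewrite conjc0].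
  have := eigenspanD (conjc c) (bounded_eigen_conj bg) IH; congr eigenspan.
  by apply/funext => y; rewrite rmorphD rmorphM.
- move=> f; elim=> [|c g w [mg _ _] sw IH]; first exact: cmeas_cst.
  by apply: cmeasD => //; exact: cmeasZ.
- move=> f; elim=> [|c g w [_ [M gM] _] sw [M' IH]].
    by exists 0 => y; rewrite cabs0.
  exists (cabs c * M + M') => y; rewrite (le_trans (cabsD _ _)) // lerD //.
  by rewrite cabsM ler_wpM2l ?cabs_ge0.
Qed.

Lemma eigenspan_sum w : eigenspan w ->
  exists (n : nat) (c : 'I_n -> R[i]) (g : 'I_n -> Y -> R[i]),
    (forall i, bounded_eigenfunction (g i)) /\
    w = fun y => \sum_(i < n) c i * g i y.
Proof.
elim=> [|c g w' bg sw [n [cs [gs [bgs ->]]]]].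
  exists 0%N, (fun=> 0), (fun=> cst 0); split; first by case.
  by apply/funext => y; rewrite big_ord0.
exists n.+1, (fun i => oapp cs c (unlift ord0 i)), (fun i => oapp gs g (unlift ord0 i)).
split=> [i|]; first by case: unliftP => [j|] _ /=.
apply/funext => y; rewrite big_ord_recl unlift_none /=; congr (_ + _).
by apply: eq_bigr => i _; rewrite liftK.
Qed.

Local Notation cl := (L2_closure mu eigenspan).
Definition kronecker : set (set Y) := closure_sets mu eigenspan.
Local Notation K := kronecker.

(** Truncating an eigenfunction at a level of its modulus, which is
    invariant, leaves an eigenfunction. *)
Lemma eigen_closure lam g : eigen lam g -> cl g.
Proof.
move=> eg; have [/L2_cmeas [mg g2] gT] := eg.
have [l1|g0] := eigenvalue_unimodular eg; last first.
  split=> // e e0; exists (cst 0); first exact: eigenspan0.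
  rewrite (_ : (fun y => _) = g); first by rewrite g0 lte_fin.
  by apply/funext => y; rewrite subr0.
pose S (n : nat) := [set y | cabs (g y) ^+ 2 <= n%:R ^+ 2].
pose g_ n y := g y * (\1_(S n) y : R)%:C.
have mS n : measurable (S n).
  rewrite /S -[X in measurable X]setTI -preimage_itvNyc.
  by apply: (cmeas_sqr mg) => //; exact: measurable_itv.
have mg_ n : cmeas (g_ n) by apply: cmeasM => //; exact: cmeas_indic.
have in_S n y : S n y -> g_ n y = g y.
  by move=> Sy; rewrite /g_ indicE mem_set // mulr1.
have out_S n y : ~ S n y -> g_ n y = 0.
  by move=> Sy; rewrite /g_ indicE memNset // mulr0.
have beg n : bounded_eigenfunction (g_ n).
  split=> //.
    exists n%:R => y; have [Sy|Sy] := pselect (S n y).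
      by rewrite in_S // -ler_sqr ?nnegrE ?cabs_ge0.
    by rewrite out_S // cabs0.
  exists lam; apply: filterS gT => y gTy.
  have SS : S n (T y) <-> S n y by rewrite /S /= gTy cabsM l1 mul1r.
  have [Sy|Sy] := pselect (S n y).
    by rewrite !in_S //; exact/SS.
  by rewrite !out_S ?mulr0 // => /SS.
have dom n y : cabs (g_ n y - g y) <= cabs (g y).
  have [Sy|Sy] := pselect (S n y); first by rewrite in_S // subrr cabs0 cabs_ge0.
  by rewrite out_S // sub0r cabsN.
have cv y : (fun n => g_ n y) @ \oo --> g y.
  apply: cvg_near_cst; exists (Num.truncn (cabs (g y))).+1 => // n /= yn.
  apply: in_S; rewrite /S /= lerXn2r ?nnegrE ?cabs_ge0 //.
  by rewrite (le_trans (ltW (truncnS_gt _))) // ler_nat.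
apply: (L2_closure_limit eigenspan_algebra) => // e e0.
have [n _ /(_ n (leqnn n)) nP] := N2_dominated mg_ mg mg g2 dom cv e0.
exists (g_ n); first by apply: (L2_closure_sub mu eigenspan_algebra); exact: eigenspan_sub.
by move: nP; congr (_ < _)%E; apply: eq_integral => y _; rewrite cabsB.
Qed.

Lemma kronecker_discrete : discrete_spectrum mu T K.
Proof.
move=> f Kf e e0.
have [mf fl] := L2_closure_sets eigenspan_algebra Kf.
have [w sw fw] := fl e e0; have [n [c [g [bg wE]]]] := eigenspan_sum sw.
have /choice [lam lamP] i := bounded_eigen (bg i).
exists n, c, lam, g; split; last by rewrite wE in fw.
move=> i; have [[_ g2] gT] := lamP i; split=> //; split=> // U oU.
apply: (closure_sets_preimage eigenspan_algebra) => //.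
by apply: (bounded_closure_sub mu eigenspan_algebra); exact: eigenspan_sub.
Qed.

Lemma L2_closure_sum n (c : 'I_n -> R[i]) (g : 'I_n -> Y -> R[i]) :
  (forall i, cl (g i)) -> cl (fun y => \sum_(i < n) c i * g i y).
Proof.
move=> cg; pose P (r : seq 'I_n) := cl (fun y => \sum_(i <- r) c i * g i y).
suff : P (index_enum 'I_n) by [].
elim: (index_enum _) => [|i r IH]; rewrite /P.
  rewrite (_ : (fun y => _) = cst 0); last by apply/funext => y; rewrite big_nil.
  by apply: (L2_closure_sub mu eigenspan_algebra); exact: eigenspan0.
rewrite (_ : (fun y => _) = (fun y => c i * g i y + \sum_(i <- r) c i * g i y)).
  apply: (L2_closureD eigenspan_algebra) => //; exact: (L2_closureZ eigenspan_algebra).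
by apply/funext => y; rewrite big_cons.
Qed.

Lemma indic_L2 (A : set (set Y)) B : sigma_algebra setT A -> A `<=` measurable ->
  A B -> L2 mu A (fun y => (\1_B y : R)%:C).
Proof.
move=> sA Am AB; split; last first.
  apply: (@bounded_L2 _ _ _ _ _ 1); first exact/cmeas_indic/Am.
  by move=> y; rewrite cabs_real indicE ger0_norm //; case: (_ \in _).
have [A0 AC AU] := sA; have AT : A setT by have := AC _ A0; rewrite setD0.
move=> U _; have ACB : A (~` B) by rewrite -setTD; exact: AC.
have val1 y : B y -> (\1_B y : R)%:C = 1 by move=> By; rewrite indicE mem_set.
have val0 y : ~ B y -> (\1_B y : R)%:C = 0 by move=> By; rewrite indicE memNset.
have [U1|U1] := pselect (U 1); have [U0|U0] := pselect (U 0).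
- rewrite (_ : _ @^-1` _ = setT) //; apply/seteqP; split=> // y _ /=.
  by have [By|By] := pselect (B y); rewrite ?(val1 _ By) ?(val0 _ By).
- rewrite (_ : _ @^-1` _ = B) //; apply/seteqP; split=> y /=.
    by have [//|By] := pselect (B y); rewrite val0.
  by move=> By; rewrite val1.
- rewrite (_ : _ @^-1` _ = ~` B) //; apply/seteqP; split=> y /=.
    by have [By|//] := pselect (B y); rewrite val1.
  by move=> By; rewrite val0.
- rewrite (_ : _ @^-1` _ = set0) //; apply/seteqP; split=> y //=.
  by have [By|By] := pselect (B y); rewrite ?(val1 _ By) ?(val0 _ By).
Qed.

(** The indicator of a set of such a factor is a limit of combinations of
    eigenfunctions, and these lie in the closure. *)
Lemma kronecker_max A : is_factor T A -> discrete_spectrum mu T A -> A `<=` K.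
Proof.
move=> [sA Am _] dA B AB; have mB := Am _ AB.
apply: (closure_setsP mB); apply: (L2_closure_limit eigenspan_algebra).
  exact: cmeas_indic.
move=> e e0; have [n [c [lam [g [eg gB]]]]] := dA _ (indic_L2 sA Am AB) e e0.
exists (fun y => \sum_(i < n) c i * g i y) => //; apply: L2_closure_sum => i.
apply: (@eigen_closure (lam i)); have [[Ag g2] gT] := eg i.
by split=> //; split=> // U oU; exact/Am/Ag.
Qed.

Section inverse.
Variable T' : Y -> Y.
Hypothesis mT' : measurable_fun setT T'.
Hypotheses (TK : cancel T T') (T'K : cancel T' T).

Lemma inverse_preserving B : measurable B -> mu (T' @^-1` B) = mu B.
Proof.
move=> mB; rewrite -pT; last by rewrite -[X in measurable X]setTI; exact: mT'.
by congr (mu _); apply/seteqP; split=> y /=; rewrite TK.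
Qed.

(** Composition with $S$ preserves the square norm and the span. *)
Lemma kronecker_preimage (S : Y -> Y) B : measurable_fun setT S ->
  (forall B, measurable B -> mu (S @^-1` B) = mu B) ->
  (forall g, bounded_eigenfunction g -> bounded_eigenfunction (g \o S)) ->
  K B -> K (S @^-1` B).
Proof.
move=> mS pS bS [mB [[mB' lB] _]].
have mSB : measurable (S @^-1` B) by rewrite -[X in measurable X]setTI; exact: mS.
apply: (closure_setsP mSB); split; first exact: cmeas_indic.
have sS w : eigenspan w -> eigenspan (w \o S).
  elim=> [|c g v bg sv IH]; first exact: eigenspan0.
  exact: eigenspanD (bS _ bg) IH.
move=> e e0; have [w sw wB] := lB e e0; exists (w \o S); first exact: sS.
move: wB; rewrite -(N2_comp mS pS); last first.
  by apply: cmeasB => //; exact: (algebra_meas eigenspan_algebra).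
by congr (_ < _)%E; apply: eq_integral => y _ /=; rewrite !indicE.
Qed.

Lemma kronecker_factor_exists : is_kronecker_factor mu T K.
Proof.
have bT g : bounded_eigenfunction g -> bounded_eigenfunction (g \o T).
  move=> [mg [M gM] [lam gT]]; split; first exact: cmeas_comp.
    by exists M => y; exact: gM.
  exists lam; exact: (ae_comp mT pT gT).
have bT' g : bounded_eigenfunction g -> bounded_eigenfunction (g \o T').
  move=> [mg [M gM] [lam gT]]; split; first exact: cmeas_comp.
    by exists M => y; exact: gM.
  exists lam; have := ae_comp mT' inverse_preserving gT.
  by apply: filterS => y; rewrite /= T'K TK.
split; [|exact: kronecker_discrete|].
  split; first exact: (closure_sets_sigma mu eigenspan_algebra).
    by move=> B [].
  apply/seteqP; split=> [_ [B KB <-]|B KB].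
    exact: kronecker_preimage.
  exists (T' @^-1` B); last by apply/seteqP; split=> y /=; rewrite TK.
  by apply: kronecker_preimage => //; exact: inverse_preserving.
move=> A fA dA B AB; exists B; first exact: kronecker_max fA dA _ AB.
by rewrite setDv setU0 measure0.
Qed.

End inverse.

Section orthogonality.
Variable p : Y -> R[i].
Hypothesis mp : cmeas p.
Hypothesis p2 : (N2 p < +oo)%E.
Hypothesis small : forall (a : R[i]) (e : R), cabs a = 1 -> 0 < e ->
  exists2 H, (0 < H)%N &
    (N2 (fun y => \sum_(h < H) a ^+ h * p (iter h T y))%R <= (e * H%:R ^+ 2)%:E)%E.

Lemma iter_measurable h : measurable_fun setT (iter h T).
Proof. by elim: h => [|h IH]; [exact: measurable_id|exact: (measurableT_comp mT IH)]. Qed.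

Lemma iter_preserving h B : measurable B -> mu (iter h T @^-1` B) = mu B.
Proof.
elim: h B => [|h IH] B mB //.
have mTB : measurable (T @^-1` B) by rewrite -[X in measurable X]setTI; exact: mT.
exact: etrans (IH _ mTB) (pT mB).
Qed.

Lemma eigen_iter lam g h : {ae mu, forall y, g (T y) = lam * g y} ->
  {ae mu, forall y, g (iter h T y) = lam ^+ h * g y}.
Proof.
move=> gT; elim: h => [|h IH]; first by apply: aeW => y; rewrite expr0 mul1r.
have := ae_comp (iter_measurable h) (@iter_preserving h) gT.
by apply: filterS2 IH => y IHy /= ->; rewrite IHy exprS mulrA.
Qed.

Lemma cmeas_iter h f : cmeas f -> cmeas (f \o iter h T).
Proof. by move=> mf; apply: cmeas_comp => //; exact: iter_measurable. Qed.

Local Notation cint := (cintegral mu).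

(** The pairing of $p$ with $g$ equals the pairing of $\bar\lambda^h\,p\circ
    T^h$ with $g$ for all $h$, hence that of their average over $h<H$, which
    is small in norm. *)
Lemma orthogonal_eigen lam g : eigen lam g -> cint (fun y => p y * conjc (g y)) = 0.
Proof.
move=> eg; have [/L2_cmeas [mg g2] gT] := eg.
have g2f : N2 g \is a fin_num by rewrite ge0_fin_numE // N2_ge0.
have p2f : N2 p \is a fin_num by rewrite ge0_fin_numE // N2_ge0.
set b := fine (N2 g); have b0 : 0 <= b by rewrite fine_ge0 // N2_ge0.
have gb : (N2 g <= b%:E)%E by rewrite /b fineK.
apply: cabs_eq0; apply/eqP; rewrite eq_le cabs_ge0 andbT.
apply/ler_addgt0Pl => e e0; rewrite addr0.
have [l1|g0] := eigenvalue_unimodular eg; last first.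
  have q0 : (N2 g <= 0%:E)%E by rewrite g0.
  have pb : (N2 p <= (fine (N2 p))%:E)%E by rewrite fineK.
  pose c := fine (N2 p); have c0 : 0 <= c by rewrite fine_ge0 // N2_ge0.
  have t0 : 0 < e / (c + 1) by rewrite divr_gt0 // ltr_pwDr.
  apply: (le_trans (cabs_cintegral_le t0 mp mg pb q0)); rewrite mulr0 addr0 -/c.
  rewrite mulrAC ler_pdivrMr ?ltr_pwDr //.
  by apply: ler_wpM2l; [exact: ltW|rewrite lerDl].
(* Both halves of the bound t * N2 q + b / t are then at most e / 2. *)
pose t := 2 * (b + 1) / e.
have t0 : 0 < t by rewrite divr_gt0 // mulr_gt0 // ltr_pwDr.
have e'0 : 0 < e / (2 * t) by rewrite divr_gt0 // mulr_gt0.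
have lc1 : cabs (conjc lam) = 1 by rewrite cabs_conj.
have [H H0 HP] := small lc1 e'0.
pose q y := \sum_(h < H) H%:R^-1 * (conjc lam ^+ h * p (iter h T y)).
have mph (h : nat) : cmeas (fun y => conjc lam ^+ h * p (iter h T y)).
  by apply: cmeasZ; exact: (cmeas_iter h mp).
have mq : cmeas q by apply: cmeas_sum => h _; apply: cmeasZ.
have HR : 0 < H%:R :> R by rewrite ltr0n.
have qe : (N2 q <= (e / (2 * t))%:E)%E.
  rewrite (_ : q = fun y => H%:R^-1 * \sum_(h < H) (conjc lam ^+ h * p (iter h T y))); last first.
    by apply/funext => y; rewrite mulr_sumr.
  rewrite N2Z; last by apply: cmeas_sum => h _.
  rewrite cabsV cabs_nat.
  apply: (@le_trans _ _ ((H%:R^-1 ^+ 2)%:E * (e / (2 * t) * H%:R ^+ 2)%:E)%E).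
    by apply: lee_wpmul2l => //; rewrite lee_fin exprn_ge0 // invr_ge0.
  rewrite -EFinM lee_fin le_eqVlt; apply/orP; left; apply/eqP.
  by field; rewrite !lt0r_neq0.
have -> : cint (fun y => p y * conjc (g y)) = cint (fun y => q y * conjc (g y)).
  have gc2 : (N2 (fun y => conjc (g y)) < +oo)%E.
    by apply: le_lt_trans g2; apply: N2_le => // [|y]; [exact: cmeas_conj|rewrite cabs_conj].
  have ph2 (h : nat) : (N2 (p \o iter h T) < +oo)%E.
    by rewrite (N2_comp (iter_measurable h) (@iter_preserving h)).
  have mgc := cmeas_conj mg.
  have int_h (h : nat) : cintegrable mu (fun y => p (iter h T y) * conjc (g y)).
    exact: (L2_mul_integrable (cmeas_iter h mp) mgc (ph2 h) gc2).
  rewrite (_ : (fun y => q y * _) = fun y => \sum_(h < H)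
      (H%:R^-1 * conjc lam ^+ h) * (p (iter h T y) * conjc (g y))); last first.
    by apply/funext => y; rewrite mulr_suml; apply: eq_bigr => h _; rewrite !mulrA.
  have [_ ->] := @cintegral_sum _ _ _ mu _ (index_enum 'I_H) (fun h y => (H%:R^-1 * conjc lam ^+ h) *
    (p (iter h T y) * conjc (g y))) (fun h => cintegrableZ _ (int_h h)).
  have step (h : nat) : conjc lam ^+ h * cint (fun y => p (iter h T y) * conjc (g y)) =
      cint (fun y => p y * conjc (g y)).
    rewrite -cintegralZ //.
    rewrite -[RHS](cintegral_comp (iter_measurable h) (@iter_preserving h)); last 2 first.
    - exact: cmeasM.
    - have := L2_mul_integrable (cmeas_iter h mp) (cmeas_iter h mgc) (ph2 h).
      by rewrite (N2_comp (iter_measurable h) (@iter_preserving h)) //; apply.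
    apply: cintegral_ae.
    - by apply: cmeasZ; apply: cmeasM => //; exact: (cmeas_iter h mp).
    - exact: (cmeas_iter h (cmeasM mp mgc)).
    - apply: filterS (eigen_iter h gT) => y /= ->.
      by rewrite rmorphM rmorphXn /= mulrCA.
  rewrite (eq_bigr (fun=> H%:R^-1 * cint (fun y => p y * conjc (g y)))); last first.
    by move=> h _; rewrite cintegralZ // -mulrA step.
  rewrite sumr_const card_ord -mulrnAl -[_ *+ H]mulr_natl mulfV ?mul1r //.
  by rewrite pnatr_eq0 -lt0n.
apply: (le_trans (cabs_cintegral_le t0 mq mg qe gb)).
have -> : t * (e / (2 * t)) = e / 2 by field; exact: lt0r_neq0.
have : t^-1 * b <= e / 2.
  rewrite /t invf_div mulrAC ler_pdivrMr ?mulr_gt0 ?ltr_pwDr //.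
  by have := mulr_ge0 (ltW e0) b0; nra.
lra.
Qed.

Lemma orthogonal_discrete (A : set (set Y)) g : A `<=` measurable ->
  discrete_spectrum mu T A -> L2 mu A g ->
  cintegral mu (fun y => p y * conjc (g y)) = 0.
Proof.
move=> Am dA Lg; have [Ag g2] := Lg.
have mg : cmeas g by apply/cmeasP => U oU; apply/Am/Ag.
have p2f : L2norm2 mu p \is a fin_num by rewrite ge0_fin_numE // N2_ge0.
pose c := fine (L2norm2 mu p); have c0 : 0 <= c by rewrite fine_ge0 // N2_ge0.
have pc : (L2norm2 mu p <= c%:E)%E by rewrite fineK.
apply: cabs_eq0; apply/eqP; rewrite eq_le cabs_ge0 andbT.
apply/ler_addgt0Pl => e e0; rewrite addr0.
have t0 : 0 < e / (2 * (c + 1)) by rewrite divr_gt0 // mulr_gt0 // ltr_pwDr.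
set t := e / _ in t0.
have te0 : 0 < t * (e / 2) by rewrite mulr_gt0 // divr_gt0.
have [n [cs [lam [gs [eg gs2]]]]] := dA _ Lg _ te0.
have eg' i : eigenfunction mu T measurable (lam i) (gs i).
  by have [[Agi gi2] giT] := eg i; split=> //; split=> // U oU; apply/Am/Agi.
have mgs i : cmeas (gs i).
  by apply/cmeasP; have [[]] := eg' i.
have gs2i i : (L2norm2 mu (gs i) < +oo)%E by have [[]] := eg' i.
pose s y := \sum_(i < n) cs i * gs i y.
have ms : cmeas s by apply: cmeas_sum => i _; exact: cmeasZ.
have int_i i : cintegrable mu (fun y => p y * conjc (gs i y)).
  apply: L2_mul_integrable => //; first exact: cmeas_conj.
  by apply: le_lt_trans (gs2i i); apply: N2_le => // [|y]; [exact: cmeas_conj|rewrite cabs_conj].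
have sE : (fun y => p y * conjc (s y)) =
    (fun y => \sum_(i < n) conjc (cs i) * (p y * conjc (gs i y))).
  apply/funext => y; rewrite /s rmorph_sum mulr_sumr; apply: eq_bigr => i _.
  by rewrite rmorphM /= mulrCA.
have [ints s0] := @cintegral_sum _ _ _ mu _ (index_enum 'I_n) (fun i y => conjc (cs i) *
  (p y * conjc (gs i y))) (fun i => cintegrableZ _ (int_i i)).
rewrite -sE in ints s0.
have {}s0 : cintegral mu (fun y => p y * conjc (s y)) = 0.
  rewrite s0 big1 // => i _; rewrite cintegralZ //.
  by rewrite (orthogonal_eigen (eg' i)) mulr0.
have mgs' : cmeas (fun y => g y - s y) by exact: cmeasB.
have gsl : (L2norm2 mu (fun y => g y - s y)%R < +oo)%E by apply: lt_trans gs2 (ltry _).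
have -> : cintegral mu (fun y => p y * conjc (g y)) =
    cintegral mu (fun y => p y * conjc (g y - s y)).
  have -> : (fun y => p y * conjc (g y)) =
      (fun y => p y * conjc (g y - s y) + p y * conjc (s y)).
    by apply/funext => y; rewrite -mulrDr -rmorphD subrK.
  rewrite cintegralD ?s0 ?addr0 //.
  apply: L2_mul_integrable => //; first exact: cmeas_conj.
  by apply: le_lt_trans gsl; apply: N2_le => // [|y]; [exact: cmeas_conj|rewrite cabs_conj].
apply: (le_trans (cabs_cintegral_le t0 mp mgs' pc (ltW gs2))).
rewrite mulKf ?lt0r_neq0 // [leRHS]splitr lerD2r /t.
by rewrite mulrAC ler_pdivrMr ?mulr_gt0 ?ltr_pwDr //; have := mulr_ge0 (ltW e0) c0; lra.
Qed.

End orthogonality.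

End eigenfunctions.

(** * Borel measures and limits of empirical measures *)

Section borel_sets.
Context {R : realType} {X : ptopologicalType}.

Lemma open_borel (U : set X) : open U -> measurable (U : set (borel X)).
Proof. by move=> oU; exact: sub_sigma_algebra. Qed.

Lemma continuous_cmeas (f : X -> R[i]) : continuous f -> @cmeas R _ (borel X) f.
Proof.
by move=> cf; apply/cmeasP => U oU; apply: open_borel; apply: open_comp.
Qed.

Lemma continuous_borel (T : X -> X) : continuous T ->
  measurable_fun [set: borel X] (T : borel X -> borel X).
Proof.
move=> cT; apply: (@measurability _ _ (borel X) (borel X) setT T (@open X)) => //.
move=> _ [U oU <-]; rewrite setTI; apply: open_borel; exact: open_comp.
Qed.

Lemma continuous_iter (T : X -> X) n : continuous T -> continuous (iter n T).
Proof.
move=> cT; elim: n => [|n IH] x; first exact: cvg_id.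
by apply: (@continuous_comp _ _ _ (iter n T) T); [exact: IH|exact: cT].
Qed.

(** This consequence of metrisability makes Borel measures determined by the
    integrals of continuous functions; it is stated on its own because it
    also has to be applied to the orbit closure, whose topology is not
    presented by a metric. *)
Definition opens_are_cozero : Prop := forall U : set X, open U ->
  exists phi : X -> R, [/\ continuous phi, forall x, 0 <= phi x <= 1 &
    forall x, U x <-> 0 < phi x].

Variable nu : probability (borel X) R.

Definition cozero_approx (phi : X -> R) n x := 1 - (1 - phi x) ^+ n.

Lemma cozero_approx01 phi n x : 0 <= phi x <= 1 -> 0 <= cozero_approx phi n x <= 1.
Proof.
move=> /andP[p0 p1]; have q0 : 0 <= 1 - phi x by rewrite subr_ge0.
rewrite /cozero_approx subr_ge0 gerBl exprn_ge0 // andbT exprn_ile1 //.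
by rewrite gerBl.
Qed.

Lemma cozero_approx_cvg phi x : 0 <= phi x <= 1 ->
  (fun n => cozero_approx phi n x) @ \oo --> ((0 < phi x)%R%:R : R).
Proof.
move=> /andP[p0 p1]; have [x0|] := ltP 0 (phi x); last first.
  move=> x0; have px : phi x = 0 by apply/eqP; rewrite eq_le x0.
  apply: cvg_near_cst; apply: nearW => n.
  by rewrite /cozero_approx px subr0 expr1n subrr.
rewrite -[X in _ --> X]subr0.
apply: (@cvgB _ R^o); first exact: cvg_cst.
by apply: cvg_expr0; rewrite subr_ge0 p1 /= gtrBl.
Qed.

Lemma cozero_approx_continuous phi n : continuous phi ->
  continuous (fun x => (cozero_approx phi n x)%:C : R[i]).
Proof.
move=> cp; rewrite (_ : (fun x => _) = (fun x => 1 - (1 - (phi x)%:C) ^+ n)); last first.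
  by apply/funext => x; rewrite /cozero_approx rmorphB rmorphXn rmorphB rmorph1.
have cpC : continuous (fun x => (phi x)%:C : R[i]).
  move=> x; apply: (@continuous_comp _ _ _ phi (fun y : R => y%:C : R[i])); first exact: cp.
  exact: real_complex_continuous.
have c1 : continuous (fun _ : X => 1 : R[i]) by exact: cst_continuous.
exact: (continuous_addr c1 (continuous_oppr
  (@continuous_expr _ _ _ n (continuous_addr c1 (continuous_oppr cpC))))).
Qed.

Lemma bounded_integrable (h : X -> R) (M : R) : continuous (fun x => (h x)%:C : R[i]) ->
  (forall x, `|h x| <= M) -> nu.-integrable setT (EFin \o h).
Proof.
move=> ch hM; have mh := continuous_cmeas ch.
have [] // := @cintegrable_dom _ _ _ nu _ (cst M) mh (cst_integrable nu M).
by move=> x; rewrite cabs_real.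
Qed.

(** The functions $1-(1-\phi)^n$ converge to the indicator of $\phi>0$. *)
Lemma cozero_measure (U : set X) (phi : X -> R) : continuous phi ->
  (forall x, 0 <= phi x <= 1) -> (forall x, U x <-> 0 < phi x) ->
  (fun n => (\int[nu]_x (cozero_approx phi n x))%:E) @ \oo --> nu U.
Proof.
move=> cphi p01 Up.
have oU : open U.
  rewrite (_ : U = phi @^-1` [set y | 0 < y]).
    by apply: open_comp => [x _|]; [exact: cphi|exact: open_gt].
  by apply/seteqP; split=> x /Up.
have ap01 n x := cozero_approx01 n (p01 x).
have apn n x : `|cozero_approx phi n x| <= 1.
  by have /andP[? ?] := ap01 n x; rewrite ger0_norm.
have mE n : measurable_fun [set: borel X] (fun x => (cozero_approx phi n x)%:E).
  by apply/measurable_EFinP/cmeas_real/continuous_cmeas; exact: cozero_approx_continuous.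
have mU : measurable_fun [set: borel X] (fun x => (\1_U x : R)%:E).
  by apply/measurable_EFinP; apply: measurable_indic; exact: open_borel.
have cvx x : (fun n => (cozero_approx phi n x)%:E) @ \oo --> (\1_U x : R)%:E.
  apply: cvg_EFin; first exact: nearW.
  rewrite indicE (_ : (x \in U) = (0 < phi x)); first exact: cozero_approx_cvg.
  by apply/idP/idP => [/set_mem/Up|/Up/mem_set].
have dom : {ae nu, forall x (n : nat), setT x ->
    (`|(cozero_approx phi n x)%:E| <= (EFin \o cst 1%R) x)%E}.
  by apply: aeW => x n _; rewrite /= lee_fin.
have [_ _] := @dominated_convergence _ _ _ nu setT measurableT
  (fun n (x : borel X) => (cozero_approx phi n x)%:E) (fun x => (\1_U x : R)%:E)
  (EFin \o cst 1) mE mU (aeW nu (fun x _ => cvx x)) (cst_integrable nu 1) dom.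
rewrite integral_indic ?setIT //; last exact: open_borel.
rewrite (_ : (fun n => _) = (fun n => (\int[nu]_x (cozero_approx phi n x))%:E)) //.
apply/funext => n; rewrite /Rintegral fineK //.
apply: integrable_fin_num => //.
by apply: bounded_integrable (apn n); exact: cozero_approx_continuous.
Qed.

(** The open sets form a pi-system that generates the Borel sets. *)
Lemma measure_preserving_of_integrals (T : X -> X) : opens_are_cozero -> continuous T ->
  (forall (phi : X -> R), continuous (fun x => (phi x)%:C : R[i]) ->
    (forall x, 0 <= phi x <= 1) ->
    cintegral nu (fun x => (phi (T x))%:C) = cintegral nu (fun x => (phi x)%:C)) ->
  measure_preserving nu (T : borel X -> borel X).
Proof.
move=> pX cT inv; split; first exact: continuous_borel.
have mT := continuous_borel cT.
have openE (U : set X) : open U -> nu (T @^-1` U) = nu U.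
  move=> oU; have [phi [cphi p01 Up]] := pX U oU.
  have cphiT : continuous (phi \o T).
    by move=> x; apply: (@continuous_comp _ _ _ T phi); [exact: cT|exact: cphi].
  have lim := cozero_measure cphi p01 Up.
  have limT := cozero_measure cphiT (fun x => p01 (T x)) (fun x => Up (T x)).
  apply: (@cvg_unique _ (@ereal_hausdorff R) _ _ _ _ limT).
  apply: cvg_trans lim; apply: near_eq_cvg; apply: nearW => n.
  congr (_%:E).
  have := inv (cozero_approx phi n) (@cozero_approx_continuous phi n cphi)
    (fun x => cozero_approx01 n (p01 x)).
  by move=> /(congr1 (fun z => complex.Re z)) /= ?; symmetry.
move=> B mB.
pose TM : {mfun borel X >-> borel X} := mfun_Sub (mem_set mT).
apply: (@measure_unique _ R (borel X) (@open X) (fun=> setT) _ _ _ _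
  (distribution nu TM) nu _ _ B mB) => //.
- by move=> U V; exact: openI.
- by move=> _; exact: openT.
- by rewrite bigcup_const.
- by move=> _; apply: le_lt_trans (ltry 1); exact: (@probability_le1 _ _ _ (distribution nu TM)).
Qed.

(** The empirical means of $f$ and of $f\circ T$ along an orbit differ by two
    boundary terms. *)
Lemma quasi_generic_invariant (T : X -> X) x (N : nat -> nat) : opens_are_cozero ->
  continuous T -> increasing N -> quasi_generic T x N nu ->
  measure_preserving nu (T : borel X -> borel X).
Proof.
move=> pX cT incN gx; apply: measure_preserving_of_integrals => // phi cphi p01.
have cphiT : continuous (fun y => (phi (T y))%:C : R[i]).
  by move=> y; apply: (@continuous_comp _ _ _ T (fun y => (phi y)%:C : R[i]));
     [exact: cT|exact: cphi].
apply/esym/(cvgn_unique (gx _ cphi)).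
apply: (cvgn_close (gx _ cphiT)) => e e0.
have := near_div_increasing 2 incN e0; apply: filterS => l; apply: le_lt_trans.
have b n : (0 < n)%N -> cabs ((phi (iter n T x))%:C : R[i]) <= 1.
  by move=> _; have /andP[? ?] := p01 (iter n T x); rewrite cabs_real ger0_norm.
have := cmean_shift (N l) 1 b; rewrite !mulr1.
by rewrite /cmean; under [X in cabs (_ * X - _) <= _]eq_bigr do rewrite addn1.
Qed.

End borel_sets.

(** * Distances and the shift on the orbit closure *)

Section distances.
Context {R : realType} {X : ptopologicalType}.
Variable D : X -> X -> R.
Hypothesis D0 : forall x y, 0 <= D x y.
Hypothesis Dxx : forall x, D x x = 0.
Hypothesis Dsym : forall x y, D x y = D y x.
Hypothesis Dtri : forall y x z, D x z <= D x y + D y z.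
Hypothesis Dnbhs : forall x (A : set X),
  nbhs x A <-> exists2 e, 0 < e & forall y, D x y < e -> A y.

(** The function is the distance to the complement, truncated at 1. The
    metric is a variable, for the sake of the orbit closure. *)
Lemma opens_are_cozero_distance : @opens_are_cozero R X.
Proof.
move=> U oU.
have [UT|/existsNP [w0 Uw0]] := pselect (forall x, U x).
  exists (cst 1); split=> [|x|x]; first exact: cst_continuous.
    by rewrite ler01 lexx.
  by split.
pose S x := [set Num.min 1 (D x w) | w in ~` U].
have Slb x : has_inf (S x).
  split; first by exists (Num.min 1 (D x w0)), w0.
  by exists 0 => _ [w _ <-]; rewrite le_min ler01 D0.
have S0 x : 0 <= inf (S x).
  apply: lb_le_inf; first by case: (Slb x).
  by move=> _ [w _ <-]; rewrite le_min ler01 D0.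
have Sw x w : ~ U w -> inf (S x) <= Num.min 1 (D x w).
  by move=> Uw; apply: ge_inf; [case: (Slb x)|exists w].
have lip x y : inf (S x) - D x y <= inf (S y).
  apply: lb_le_inf; first by case: (Slb y).
  move=> _ [w Uw <-]; rewrite lerBlDr (le_trans (Sw x w Uw)) //.
  have := Dtri y x w; have := D0 x y; rewrite ge_min.
  rewrite /Num.min; case: ltP => ? ?; [|by move=> ?; apply/orP; right; lra].
  by move=> _; apply/orP; left; lra.
exists (fun x => inf (S x)); split.
- move=> x; apply/(@cvgrPdist_lt _ R^o) => e e0; apply/Dnbhs; exists e => // y xy.
  rewrite ltr_norml; have := lip x y; have := lip y x; rewrite (Dsym y x) => ? ?.
  by apply/andP; split; lra.
- move=> x; rewrite S0 /= (le_trans (Sw x w0 Uw0)) // ge_min lexx //.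
- move=> x; split=> [Ux|].
    have /Dnbhs [e e0 eU] : nbhs x U by exact: open_nbhs_nbhs.
    apply: (@lt_le_trans _ _ (Num.min 1 e)); first by rewrite lt_min ltr01.
    apply: lb_le_inf; first by case: (Slb x).
    move=> _ [w Uw <-]; rewrite le_min ge_min lexx /= ge_min.
    by rewrite (_ : e <= D x w) ?orbT // leNgt; apply/negP => /eU.
  by apply: contraPP => Ux; apply/negP; rewrite -leNgt (le_trans (Sw x x Ux)) // ge_min Dxx lexx orbT.
Qed.

End distances.

Lemma opens_are_cozero_metric (R : realType) (X : pmetricType R) : @opens_are_cozero R X.
Proof.
apply: (@opens_are_cozero_distance R X (@mdist R X)).
- exact: mdist_ge0.
- exact: mdistxx.
- exact: metric_sym.
- by move=> y x z; exact: metric_triangle.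
- move=> x A; split=> [/nbhs_ballP [e e0 eA]|[e e0 eA]].
    by exists e => // y xy; apply: eA; rewrite ballEmdist.
  apply/nbhs_ballP; exists e => // y; rewrite ballEmdist; exact: eA.
Qed.

Section shift_space.
Variables (R : realType) (u : nat -> R[i]) (u0 : R[i]).
Local Notation X := (Xu u u0).
Implicit Types z w : X.

Definition coordinate (j : int) z : R[i] := (\val z) j.

Lemma coordinate_continuous j : continuous (coordinate j).
Proof.
move=> z; apply: (@continuous_comp _ _ _ (fun z : X => \val z : biseq R) (fun s : biseq R => s j)).
  exact: initial_continuous.
exact: (@proj_continuous int (fun=> R[i]) j).
Qed.

(** Distances at coordinate $j$ are damped by $|j|+1$, so that only finitely
    many coordinates matter at each scale. *)
Definition coord_dist (j : int) z w : R :=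
  Num.min 1 (cabs (coordinate j z - coordinate j w)) / (`|j|%N.+1)%:R.

Definition shift_dist z w : R := sup (range (fun j => coord_dist j z w)).

Lemma coord_dist_ge0 j z w : 0 <= coord_dist j z w.
Proof. by rewrite divr_ge0 // le_min ler01 cabs_ge0. Qed.

Lemma coord_dist_le1 j z w : coord_dist j z w <= 1 / (`|j|%N.+1)%:R.
Proof. by rewrite ler_pM2r ?invr_gt0 // ge_min lexx. Qed.

Lemma shift_dist_sup z w : has_sup (range (fun j => coord_dist j z w)).
Proof.
split; first by exists (coord_dist 0 z w), 0.
exists 1 => _ [j _ <-]; rewrite (le_trans (coord_dist_le1 _ _ _)) //.
by rewrite ler_pdivrMr ?mul1r // ler1n.
Qed.

Lemma coord_dist_le j z w : coord_dist j z w <= shift_dist z w.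
Proof. by apply: ub_le_sup; [case: (shift_dist_sup z w)|exists j]. Qed.

Lemma shift_dist_le z w (e : R) : (forall j, coord_dist j z w <= e) -> shift_dist z w <= e.
Proof.
by move=> le; apply: ge_sup; [case: (shift_dist_sup z w)|move=> _ [j _ <-]].
Qed.

Lemma shift_dist_nbhs z (A : set X) :
  nbhs z A <-> exists2 e, 0 < e & forall w, shift_dist z w < e -> A w.
Proof.
split; last first.
  move=> [e e0 eA]; pose J := (Num.truncn (2 / e)).+1.
  have JR : 0 < J%:R :> R by rewrite ltr0n.
  have Je : 1 / J%:R <= e / 2.
    rewrite ler_pdivrMr // mulrC -ler_pdivrMr ?divr_gt0 // mul1r invf_div.
    exact: ltW (truncnS_gt _).
  have e2 : 0 < e / 2 by rewrite divr_gt0.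
  have near_j (j : int) : \forall w \near z, cabs (coordinate j z - coordinate j w) < e / 2.
    have /continuous_cabsP := @coordinate_continuous j => /(_ z _ e2).
    by apply: filterS => w; rewrite cabsB.
  have near_J : \forall w \near z, forall i : 'I_J,
      cabs (coordinate i%:Z z - coordinate i%:Z w) < e / 2 /\
      cabs (coordinate (- i%:Z) z - coordinate (- i%:Z) w) < e / 2.
    apply: (@filter_forall X _ (fun (i : 'I_J) (w : X) => cabs (coordinate i%:Z z - coordinate i%:Z w) < e / 2 /\ cabs (coordinate (- i%:Z) z - coordinate (- i%:Z) w) < e / 2) (nbhs z) (nbhs_filter z)) => i.
    exact: (filterI (near_j _) (near_j _)).
  apply: filterS near_J => w wJ; apply: eA.
  apply: (@le_lt_trans _ _ (e / 2)); last by rewrite ltr_pdivrMr // ltr_pMr // ltr1n.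
  apply: shift_dist_le => j; case: (ltnP `|j|%N J) => jJ; last first.
    rewrite (le_trans (coord_dist_le1 _ _ _)) // (le_trans _ Je) // !div1r.
    by rewrite lef_pV2 ?posrE ?ltr0n // ler_nat (leq_trans jJ).
  have : cabs (coordinate j z - coordinate j w) <= e / 2.
    have [wp wn] := wJ (Ordinal jJ).
    by case: j jJ wp wn => n jn /= wp wn; apply: ltW.
  move=> h; rewrite /coord_dist ler_pdivrMr ?ltr0n //.
  rewrite ge_min; apply/orP; right; apply: (le_trans h); apply: ler_peMr.
    exact: ltW.
  by rewrite ler1n.
move=> nA; pose F : set_system X := [set B | exists2 e, 0 < e & forall w, shift_dist z w < e -> B w].
have FF : Filter F.
  split.
  - by exists 1.
  - move=> P Q [e e0 eP] [f f0 fQ]; exists (Num.min e f); first by rewrite lt_min e0.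
    by move=> w; rewrite lt_min => /andP[we wf]; split; [exact: eP|exact: fQ].
  - by move=> P Q PQ [e e0 eP]; exists e => // w /eP /PQ.
have Fj (j : int) : coordinate j @ F --> coordinate j z.
  apply/cvg_cabsP => e e0.
  pose c := Num.min 1 e / (`|j|%N.+1)%:R.
  have c0 : 0 < c by rewrite divr_gt0 ?ltr0n // lt_min ltr01.
  exists c => // w zw; have := le_lt_trans (coord_dist_le j z w) zw.
  rewrite /coord_dist /c ltr_pM2r ?invr_gt0 ?ltr0n // cabsB lt_min !gt_min ltxx /=.
  by move=> /andP[x1 /orP[e1|//]]; exact: lt_trans x1 e1.
have Fv : (fun w : X => \val w : {ptws int -> R[i]}) @ F -->
    (\val z : {ptws int -> R[i]}).
  apply/cvg_sup => j U [_ [[W oW <-] Wz WU]]; apply: (filterS WU).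
  exact: (Fj j W (open_nbhs_nbhs (conj oW Wz))).
move: nA => [_ [[V oV <-] Vz VA]]; suff : F A by [].
apply: (filterS VA).
exact: (Fv V (open_nbhs_nbhs (conj oV Vz))).
Qed.

Lemma coord_dist_sym j z w : coord_dist j z w = coord_dist j w z.
Proof. by rewrite /coord_dist cabsB. Qed.

Lemma coord_dist_tri j y z w : coord_dist j z w <= coord_dist j z y + coord_dist j y w.
Proof.
rewrite /coord_dist -mulrDl ler_pM2r ?invr_gt0 ?ltr0n //.
have := cabsD (coordinate j z - coordinate j y) (coordinate j y - coordinate j w).
rewrite addrA subrK => tri.
have a0 := cabs_ge0 (coordinate j z - coordinate j y); have b0 := cabs_ge0 (coordinate j y - coordinate j w).
rewrite /Num.min.
by case: ltP => ?; case: ltP => ?; case: ltP => ?; lra.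
Qed.

Lemma opens_are_cozero_shift : @opens_are_cozero R X.
Proof.
apply: (@opens_are_cozero_distance R X shift_dist).
- by move=> z w; apply: le_trans (coord_dist_le 0 z w); exact: coord_dist_ge0.
- move=> z; apply/eqP; rewrite eq_le; apply/andP; split.
    by apply: shift_dist_le => j; rewrite /coord_dist subrr cabs0 min_r // mul0r.
  by apply: le_trans (coord_dist_le 0 z z); exact: coord_dist_ge0.
- by move=> z w; congr sup; apply/seteqP; split=> _ [j _ <-]; exists j; rewrite // coord_dist_sym.
- move=> y z w; apply: shift_dist_le => j; apply: (le_trans (coord_dist_tri j y z w)).
  by apply: lerD; exact: coord_dist_le.
- exact: shift_dist_nbhs.
Qed.

Lemma unshift_subproof (z : X) : shift_by (-1) (\val z) \in orbit_closure u u0.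
Proof.
apply/mem_set => B nB.
have [y [[k ->] By]] := set_mem (valP z) _ (@shift_by_continuous R (-1) _ _ nB).
exists (shift_by (-1) (shift_by k (extend u u0))); split => //.
by exists (-1 + k); apply/funext => j; rewrite /shift_by addrA.
Qed.

Definition unshift (z : X) : X := SigSub (unshift_subproof z).

Lemma shiftK : cancel (@Defs.shift R u u0) unshift.
Proof. by move=> z; apply/val_inj/funext => j; rewrite /= /shift_by subrK. Qed.

Lemma unshiftK : cancel unshift (@Defs.shift R u u0).
Proof. by move=> z; apply/val_inj/funext => j; rewrite /= /shift_by addrK. Qed.

Lemma continuous_into_Xu (f : X -> X) k :
  (forall z, \val (f z) = shift_by k (\val z)) -> continuous f.
Proof.
move=> fE z A [_ [[V oV <-] Vz VA]].
have FF : Filter (f @ z) by apply: fmap_filter; exact: nbhs_filter.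
apply: (filterS VA).
have cs : continuous (fun w : X => shift_by k (\val w) : biseq R).
  move=> w; apply: (@continuous_comp _ _ _ (fun z : X => \val z : biseq R) (@shift_by R k)).
    exact: initial_continuous.
  exact: shift_by_continuous.
have nV : nbhs z ((fun w : X => shift_by k (\val w)) @^-1` V).
  by apply: (cs z V); rewrite -fE; exact: (open_nbhs_nbhs (conj oV Vz)).
rewrite (_ : (fun w : X => _) = (fun w => \val (f w))) in nV; last first.
  by apply/funext => w; rewrite fE.
exact: nV.
Qed.

Lemma shift_continuous : continuous (@Defs.shift R u u0).
Proof. exact: (@continuous_into_Xu _ 1). Qed.

Lemma unshift_continuous : continuous unshift.
Proof. exact: (@continuous_into_Xu _ (-1)). Qed.

Lemma iter_shift n z j : coordinate j (iter n (@Defs.shift R u u0) z) = coordinate (j + n%:Z) z.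
Proof.
elim: n z => [|n IH] z; first by rewrite addr0.
by rewrite iterSr IH /coordinate /= /shift_by -addrA [in RHS]intS [in RHS](addrC 1).
Qed.

Lemma coord_uXu n h : (0 < n)%N -> coordinate h%:Z (iter n (@Defs.shift R u u0) (uXu u u0)) = u (n + h)%N.
Proof.
move=> n0; rewrite iter_shift /coordinate /= /extend -PoszD.
by rewrite ifF ?absz_nat ?[(h + n)%N]addnC //; apply/eqP; lia.
Qed.

End shift_space.

(** * Density of continuous functions *)

Section density_of_continuous_functions.
Context {R : realType} {X : ptopologicalType}.
Hypothesis cX : compact [set: X].
Hypothesis pX : @opens_are_cozero R X.
Variable nu : probability (borel X) R.

Lemma continuous_bounded (f : X -> R[i]) : continuous f ->
  exists M, forall x, cabs (f x) <= M.
Proof.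
move=> cf; have cc : compact ((fun x => cabs (f x) : R) @` setT).
  apply: continuous_compact => //; apply: continuous_subspaceT => x.
  apply: (@continuous_comp _ _ _ f (fun z : R[i] => cabs z : R)); first exact: cf.
  exact: cabs_continuous.
have [M [_ Mb]] := compact_bounded cc.
exists (M + 1) => x; apply: le_trans (ler_norm _) _.
by apply: (Mb (M + 1)); [rewrite ltrDl|exists x].
Qed.

Lemma continuous_algebra :
  @function_algebra R _ (borel X) [set f : borel X -> R[i] | continuous (f : X -> R[i])].
Proof.
split.
- exact: (@cst_continuous X R[i] 1).
- move=> f g cf cg; exact: (@continuous_addr _ X f g cf cg).
- move=> f g cf cg; exact: (@continuous_mulr _ X f g cf cg).
- move=> c f cf.
  exact: (@continuous_mulr _ X (cst c) f (@cst_continuous X R[i] c) cf).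
- move=> f cf; exact: (@continuous_conjc _ X f cf).
- move=> f cf; exact: (@continuous_cmeas R X f cf).
- move=> f cf; exact: (continuous_bounded cf).
Qed.

(** Open sets are of the form $\phi>0$, so the sets whose indicators are
    limits of continuous functions form a sigma-algebra that contains all
    Borel sets. *)
Lemma continuous_dense (f : borel X -> R[i]) (e : R) : cmeas f ->
  (L2norm2 nu f < +oo)%E -> 0 < e ->
  exists2 g : X -> R[i], continuous g &
    (L2norm2 nu (fun x => f x - g x)%R < e%:E)%E.
Proof.
move=> mf f2 e0.
pose K := closure_sets nu [set f : borel X -> R[i] | continuous (f : X -> R[i])].
have oK U : open U -> K U.
  move=> oU; have [phi [cphi p01 Up]] := pX oU.
  have -> : U = [set x | 0 < phi x] by apply/seteqP; split=> x /Up.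
  apply: (closure_sets_gt continuous_algebra); apply: (bounded_closure_sub nu continuous_algebra).
  move=> x; apply: (@continuous_comp _ _ _ phi (fun y : R => y%:C : R[i])).
    exact: cphi.
  exact: real_complex_continuous.
have mK (B : set (borel X)) : measurable B -> K B.
  by apply: smallest_sub => //; exact: (closure_sets_sigma nu continuous_algebra).
have /(_ e e0) [g cg fg] : forall e : R, 0 < e ->
    exists2 g : borel X -> R[i], continuous (g : X -> R[i]) &
    (L2norm2 nu (fun x => f x - g x)%R < e%:E)%E.
  have [|_ //] := @L2_closure_sets _ _ _ nu _ continuous_algebra f.
  by split=> // U oU; apply: mK; move/cmeasP: mf; apply.
by exists g.
Qed.

End density_of_continuous_functions.

(** * Quantile functions into the Cantor space *)

(** Prefixes are listed latest bit first, so that extending one is a [cons]. *)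
Fixpoint prefix_of (c : cantor_space) k : seq bool :=
  if k is k'.+1 then c k' :: prefix_of c k' else [::].

Lemma size_prefix_of c k : size (prefix_of c k) = k.
Proof. by elim: k => //= k ->. Qed.

Lemma prefix_le c c' j k : (j <= k)%N -> prefix_of c k = prefix_of c' k ->
  prefix_of c j = prefix_of c' j.
Proof.
move=> /subnK <-; elim: (k - j)%N => // m IH; rewrite addSn /= => -[_].
exact: IH.
Qed.

Definition cylinder (c : cantor_space) k := [set c' | prefix_of c' k = prefix_of c k].

Lemma cylinder_nbhs c k : nbhs c (cylinder c k).
Proof.
have near_j j : nbhs c [set c' : cantor_space | c' j = c j].
  have := @proj_continuous nat (fun=> bool) j c [set b | b = c j].
  by apply; apply: open_nbhs_nbhs; split => //; exact: discrete_open.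
elim: k => [|k IH]; first by apply: filterS filterT.
apply: filterS (filterI (near_j k) IH) => c' [e1 e2].
  by rewrite /cylinder /mkset /= [X in X :: _]e1 [X in _ :: X]e2.
Qed.

Lemma nbhs_cylinder c (A : set cantor_space) : nbhs c A ->
  exists k, cylinder c k `<=` A.
Proof.
pose F : set_system cantor_space := [set B | exists k, cylinder c k `<=` B].
have FF : Filter F.
  split; first by exists 0%N.
  - move=> P Q [k kP] [l lQ]; exists (maxn k l) => c' cc'; split.
      by apply: kP; exact: prefix_le (leq_maxl k l) cc'.
    by apply: lQ; exact: prefix_le (leq_maxr k l) cc'.
  - by move=> P Q PQ [k kP]; exists k => c' /kP /PQ.
suff : F --> c by apply.
apply/cvg_sup => j U [_ [[W oW <-] Wz WU]]; apply: (filterS WU).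
by exists j.+1 => c' /= [-> _].
Qed.

Section cylinder_functions.
Variable R : realType.

Lemma cantor_uniform (F : cantor_space -> R[i]) (e : R) : continuous F -> 0 < e ->
  exists k, forall c c', prefix_of c k = prefix_of c' k -> cabs (F c - F c') < e.
Proof.
move=> /continuous_cabsP cF e0; apply: contrapT => /forallNP bad.
have {}bad k : exists c : cantor_space, exists c', prefix_of c k = prefix_of c' k /\
    e <= cabs (F c - F c').
  have /existsNP [c /existsNP [c' /not_implyP [cc /negP]]] := bad k.
  by rewrite -leNgt => ec; exists c, c'.
have [a /choice [b abP]] := choice bad.
have aF : (a @ \oo) setT by exists 0%N.
have [c [_ ccl]] := @cantor_space_compact (a @ \oo) _ aF.
have e2 : 0 < e / 2 by rewrite divr_gt0.
have [k kc] := nbhs_cylinder (cF c _ e2).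
have aT : (a @ \oo) [set z | exists2 n, (k <= n)%N & z = a n].
  by exists k => // n kn; exists n.
have [z [[n kn ->] ank]] := ccl _ _ aT (cylinder_nbhs c k).
have [abn eab] := abP n.
have bnk : cylinder c k (b n) by rewrite /cylinder /= -(prefix_le kn abn).
have := ltrD (kc _ ank) (kc _ bnk); rewrite -splitr ltNge => /negP; apply.
apply: (le_trans eab); rewrite [cabs (F (b n) - _)]cabsB (le_trans _ (cabsD _ _)) //.
by rewrite addrA subrK.
Qed.

End cylinder_functions.

Section quantile.
Variables (R : realType) (w : seq bool -> R).
Hypothesis w0 : forall s, 0 <= w s.
Hypothesis w1 : w [::] = 1.
Hypothesis wD : forall s, w s = w (false :: s) + w (true :: s).

(** The weights cut $[0,1)$ into consecutive intervals, one of length $w(s)$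
    for each prefix $s$ of a given length. The extensions of $s$ by [false]
    and by [true] divide the interval of $s$ in this order. *)
Fixpoint left_end (s : seq bool) : R :=
  if s is b :: s' then left_end s' + (if b then w (false :: s') else 0) else 0.

Fixpoint quantile_prefix (t : R) k : seq bool :=
  if k is k'.+1 then
    let s := quantile_prefix t k' in (left_end s + w (false :: s) <= t) :: s
  else [::].

Definition quantile (t : R) : cantor_space := fun k =>
  head false (quantile_prefix t k.+1).

Lemma prefix_quantile t k : prefix_of (quantile t) k = quantile_prefix t k.
Proof. by elim: k => //= k ->. Qed.

Lemma left_end_ge0 s : 0 <= left_end s.
Proof. by elim: s => //= b s IH; rewrite addr_ge0 //; case: b. Qed.

Lemma right_end_le1 s : left_end s + w s <= 1.
Proof.
elim: s => [|b s IH] /=; first by rewrite add0r w1.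
have := wD s; have := w0 (true :: s); have := w0 (false :: s); case: b; lra.
Qed.

Lemma quantile_interval t s : 0 <= t < 1 ->
  prefix_of (quantile t) (size s) = s <-> left_end s <= t < left_end s + w s.
Proof.
move=> /andP[t0 t1]; rewrite prefix_quantile.
elim: s => [|b s IH] /=; first by rewrite w1 add0r t0 t1.
have ws := wD s; have wf := w0 (false :: s); have wt := w0 (true :: s).
split=> [[bE sE]|/andP[lt tr]].
  move: bE; rewrite sE; have /andP[lt tr] := IH.1 sE.
  case: b => bE; first by rewrite bE /=; lra.
  move/negbT: bE; rewrite -ltNge => bE; apply/andP; split; lra.
have sE : quantile_prefix t (size s) = s.
  apply/IH; move: lt tr; case: b => lt tr; apply/andP; split; lra.
rewrite sE; congr (_ :: _); move: lt tr; case: b => lt tr; first by lra.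
by apply/negbTE; rewrite -ltNge; lra.
Qed.

Lemma quantile_cylinder_measurable k s :
  measurable [set t : R | prefix_of (quantile t) k = s].
Proof.
rewrite (_ : [set t | _] = [set t | quantile_prefix t k = s]); last first.
  by apply/seteqP; split=> t /=; rewrite prefix_quantile.
elim: k s => [|k IH] [|b s] /=.
- by rewrite (_ : [set t | _] = setT) //; apply/seteqP; split.
- by rewrite (_ : [set t | _] = set0) //; apply/seteqP; split.
- by rewrite (_ : [set t | _] = set0) //; apply/seteqP; split.
rewrite (_ : [set t | _] = [set t | quantile_prefix t k = s] `&`
    [set t | (left_end s + w (false :: s) <= t) = b]).
  apply: measurableI => //; case: b.
    rewrite (_ : [set t | _] = `[left_end s + w (false :: s), +oo[%classic) //.
    by apply/seteqP; split=> t /=; rewrite in_itv /= andbT.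
  rewrite (_ : [set t | _] = `]-oo, left_end s + w (false :: s)[%classic) //.
  apply/seteqP; split=> t /=; rewrite in_itv /= ltNge; first by move=> ->.
  by move/negbTE.
apply/seteqP; split=> t /= [e1 e2]; last by rewrite e1 e2.
by rewrite e2 in e1; split.
Qed.

Definition unit_measure := mrestr (@lebesgue_measure R)
  (measurable_itv `[(0 : R), 1[ : measurable `[(0 : R), 1[%classic).

HB.instance Definition _ := Measure.on unit_measure.

Lemma unit_measure_setT : unit_measure setT = 1%E.
Proof. by rewrite /unit_measure /mrestr setTI lebesgue_measure_itv /= lte01 sube0. Qed.

HB.instance Definition _ := Measure_isProbability.Build _ _ R unit_measure unit_measure_setT.

Lemma quantile_measure s :
  unit_measure [set t | prefix_of (quantile t) (size s) = s] = (w s)%:E.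
Proof.
rewrite /unit_measure /mrestr.
have l0 := left_end_ge0 s; have r1 := right_end_le1 s; have ws := w0 s.
rewrite (_ : _ `&` _ = `[left_end s, left_end s + w s[%classic).
  rewrite lebesgue_measure_itv /= lte_fin; case: ltP => [_|ws0].
    by rewrite -EFinD addrAC subrr add0r.
  by congr EFin; lra.
apply/seteqP; split=> t /=; rewrite !in_itv /=.
  by move=> [ts t01]; exact/quantile_interval.
move=> ts; have t01 : 0 <= t < 1 by move: ts => /andP[? ?]; apply/andP; split; lra.
by split=> //; exact/quantile_interval.
Qed.

End quantile.

(** * Existence of quasi-generic measures *)

(** Sequential compactness of $[0,1]^S$ for countable $S$. *)
Lemma convergent_subsequence (R : realType) (S : countType) (W : nat -> S -> R) :
  (forall l s, 0 <= W l s <= 1) ->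
  exists phi : nat -> nat, increasing phi /\
    exists w : S -> R, forall s, (fun l => W (phi l) s) @ \oo --> w s.
Proof.
move=> W01.
pose K := [set f : prod_topology (fun _ : S => R) | forall s, `[0, 1]%classic (f s)].
have cK : compact K.
  by apply: (@tychonoff S (fun=> R) (fun=> `[0, 1]%classic)) => s; exact: segment_compact.
have WK : ((W : nat -> prod_topology (fun _ : S => R)) @ \oo) K.
  by exists 0%N => // l _ s; rewrite /= in_itv /= W01.
have [w [_ wcl]] := cK ((W : nat -> prod_topology (fun _ : S => R)) @ \oo) _ WK.
have near1 (s : S) (e : R) : 0 < e ->
    nbhs w [set f : prod_topology (fun _ : S => R) | `|f s - w s| < e].
  move=> e0; have := @proj_continuous S (fun=> R) s w [set x | `|x - w s| < e].
  apply; apply/nbhs_ballP; exists e => // x; rewrite -ball_normE /= distrC //.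
have nearj (j : nat) : nbhs w [set f : prod_topology (fun _ : S => R) |
    forall s, (pickle s < j)%N -> `|f s - w s| < j.+1%:R^-1].
  have : \forall f \near w, forall i : 'I_j, forall s, unpickle i = Some s ->
      `|(f : prod_topology (fun _ : S => R)) s - w s| < j.+1%:R^-1.
    apply: (@filter_forall _ _ (fun (i : 'I_j) (f : prod_topology (fun _ : S => R)) =>
      forall s, unpickle i = Some s -> `|f s - w s| < j.+1%:R^-1) (nbhs w) (nbhs_filter w)) => i.
    case E : (unpickle i) => [s|]; last by apply: filterS filterT.
    have := near1 s j.+1%:R^-1; rewrite invr_gt0 ltr0n => /(_ isT).
    by apply: filterS => f fs s' [<-].
  apply: filterS => f fj s sj.
  by apply: (fj (Ordinal sj)); rewrite /= pickleK.
have step m j : exists l, (m < l)%N /\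
    forall s, (pickle s < j)%N -> `|W l s - w s| < j.+1%:R^-1.
  have tail : ((W : nat -> prod_topology (fun _ : S => R)) @ \oo)
      [set f | exists2 l, (m < l)%N & f = W l].
    by exists m.+1 => // l /= ml; exists l.
  by have [_ [[l ml ->] Wl]] := wcl _ _ tail (nearj j); exists l.
have /choice [nx nxP] : forall mj : nat * nat, exists l, (mj.1 < l)%N /\
    forall s, (pickle s < mj.2)%N -> `|W l s - w s| < mj.2.+1%:R^-1.
  by move=> [m j]; exact: step.
pose fix phi j := if j is i.+1 then nx (phi i, j) else nx (0, 0)%N.
exists phi; split.
  move=> m n /subnK <-; elim: (n - m.+1)%N => [|k IH].
    by have [] := nxP (phi m, m.+1).
  by rewrite addSn (ltn_trans IH) //; have [] := nxP (phi (k + m.+1)%N, (k + m.+1).+1).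
exists w => s; apply/(@cvgrPdist_lt _ R^o) => e e0.
have [n _ nP] := @near_infty_natSinv_lt R (PosNum e0).
exists (maxn n (pickle s).+1) => // l /=; rewrite geq_max => /andP[nl sl].
rewrite distrC; apply: lt_trans (nP l nl).
case: l nl sl => // l nl sl.
by have [_ /(_ s sl)] := nxP (phi l, l.+1).
Qed.

Lemma sum_prefix (R : realType) (g : seq bool -> R[i]) (p : seq bool) k : size p = k ->
  g p = \sum_(s : k.-tuple bool) ((p == s :> seq bool)%:R : R)%:C * g s.
Proof.
move=> /eqP pk; rewrite (bigD1 (Tuple pk)) //= eqxx mul1r big1 ?addr0 // => s sp.
rewrite (_ : (p == s :> seq bool) = false) ?mul0r //.
by apply/negbTE; apply: contra sp => /eqP e; apply/eqP/val_inj; rewrite /= -e.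
Qed.

Section empirical_limit.
Variables (R : realType) (c : nat -> cantor_space).

Definition empirical (N : nat) (s : seq bool) : R :=
  mean N (fun n => (prefix_of (c n) (size s) == s)%:R).

Lemma empirical01 N s : 0 <= empirical N s <= 1.
Proof.
apply/andP; split; first by apply: mean_ge0 => n _; rewrite ler0n.
apply: le_trans (mean_cst_le N ler01); apply: ler_mean => n _.
by case: eqP => _; rewrite ?ler01 ?lexx.
Qed.

Lemma empirical_cons N s :
  empirical N s = empirical N (false :: s) + empirical N (true :: s).
Proof.
rewrite /empirical -meanD; apply: eq_mean => n _ /=.
by rewrite !eqseq_cons; case: (c n _); case: (_ == s); rewrite /= ?addr0 ?add0r.
Qed.

Lemma empirical_nil N : (0 < N)%N -> empirical N [::] = 1.
Proof.
move=> N0; rewrite /empirical /mean /= sumr_const_nat subSS subn0.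
by rewrite -[1 *+ N]mulr_natl mulr1 mulVf // pnatr_eq0 -lt0n.
Qed.

Lemma cmean_prefix N k (g : seq bool -> R[i]) :
  cmean N (fun n => g (prefix_of (c n) k)) =
  \sum_(s : k.-tuple bool) (empirical N s)%:C * g s.
Proof.
under eq_cmean => n _ do rewrite (sum_prefix g (size_prefix_of (c n) k)).
rewrite cmean_sum; apply: eq_bigr => s _.
under eq_cmean => n _ do rewrite mulrC.
rewrite cmeanZ mulrC; congr (_ * _); rewrite cmean_real; congr (_%:C).
by apply: eq_mean => n _; rewrite size_tuple.
Qed.

Variables (M : nat -> nat) (w : seq bool -> R).
Hypothesis incM : increasing M.
Hypothesis Mw : forall s, (fun l => empirical (M l) s) @ \oo --> w s.

Lemma weight_ge0 s : 0 <= w s.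
Proof.
rewrite -(cvg_lim (@Rhausdorff R) (@Mw s)); apply: limr_ge.
  by apply/cvg_ex; eexists; exact: Mw.
by apply: nearW => l; have /andP[] := empirical01 (M l) s.
Qed.

Lemma weight_nil : w [::] = 1.
Proof.
apply: (@cvg_unique _ (@Rhausdorff R) _ _ _ _ (@Mw [::])).
apply: cvg_near_cst; exists 1%N => // l l0.
by apply: empirical_nil; rewrite (leq_trans l0) // increasing_leq.
Qed.

Lemma weight_cons s : w s = w (false :: s) + w (true :: s).
Proof.
apply: (@cvg_unique _ (@Rhausdorff R) _ _ _ _ (@Mw s)).
rewrite (_ : (fun l => _) = (fun l => empirical (M l) (false :: s) + empirical (M l) (true :: s))).
  exact: (@cvgD R R^o _ _ _ _ _ _ _ (@Mw (false :: s)) (@Mw (true :: s))).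
by apply/funext => l; rewrite -empirical_cons.
Qed.

Local Notation P := (@unit_measure R).
Local Notation theta := (quantile w).

Lemma cintegral_prefix k (g : seq bool -> R[i]) :
  @cmeas R _ (measurableTypeR R) (fun t => g (prefix_of (theta t) k)) /\
  cintegral P (fun t => g (prefix_of (theta t) k)) =
  \sum_(s : k.-tuple bool) (w s)%:C * g s.
Proof.
pose A (s : seq bool) := [set t : R | prefix_of (theta t) k = s].
have mA s : measurable (A s) by exact: quantile_cylinder_measurable.
have E : (fun t => g (prefix_of (theta t) k)) =
    (fun t => \sum_(s : k.-tuple bool) g s * (\1_(A s) t : R)%:C).
  apply/funext => t; rewrite (sum_prefix g (size_prefix_of (theta t) k)).
  apply: eq_bigr => s _; rewrite mulrC indicE; congr (_ * (_%:R)%:C).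
  by congr nat_of_bool; apply/eqP/idP => [e|/set_mem //]; exact/mem_set.
have mi s : @cmeas R _ (measurableTypeR R) (fun t => (\1_(A s) t : R)%:C).
  exact: (@cmeas_indic R _ (measurableTypeR R) _ (mA s)).
have iA s : cintegrable P (fun t => (\1_(A s) t : R)%:C).
  apply: L2_integrable => //; apply: (@bounded_L2 _ _ _ _ _ 1) => // t.
  by rewrite cabs_real indicE ger0_norm //; case: (_ \in _).
rewrite E; split; first by apply: cmeas_sum => s _; exact: cmeasZ.
have [_ ->] := @cintegral_sum _ _ _ P _ (index_enum (k.-tuple bool : finType))
  (fun s t => g s * (\1_(A s) t : R)%:C) (fun s => cintegrableZ (g s) (iA s)).
apply: eq_bigr => s _; rewrite cintegralZ // mulrC; congr (_ * _).
have := quantile_measure weight_ge0 weight_nil weight_cons s; rewrite size_tuple => PA.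
apply/eqP; rewrite eq_complex /=; apply/andP; split; apply/eqP.
  rewrite /Rintegral /= (_ : (\int[P]_x (\1_(A s) x)%:E)%E = P (A s)).
    by rewrite PA.
  by rewrite (@integral_indic _ _ _ P setT measurableT (A s) (mA s)) setIT.
by rewrite Rintegral_cst // mul0r.
Qed.

(** Up to a small error $F$ depends on finitely many bits, and for such
    functions the empirical mean is a finite combination of frequencies of
    prefixes. *)
Lemma empirical_integral (F : cantor_space -> R[i]) : continuous F ->
  @cmeas R _ (measurableTypeR R) (F \o theta) ->
  (exists B, forall z, cabs (F z) <= B) ->
  (fun l => cmean (M l) (fun n => F (c n))) @ \oo --> cintegral P (F \o theta).
Proof.
move=> cF mF [B FB]; apply/cvg_cabsP => e e0.
have e4 : 0 < e / 6 by rewrite divr_gt0.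
have [k kP] := cantor_uniform cF e4.
have /choice [rep repP] : forall s : seq bool, exists z : cantor_space,
    forall z', prefix_of z' k = s -> prefix_of z k = s.
  move=> s; have [[z zs]|nz] := pselect (exists z : cantor_space, prefix_of z k = s).
    by exists z.
  by exists (fun=> false) => z' z's; case: nz; exists z'.
pose g s := F (rep s).
have Fg z : cabs (F z - g (prefix_of z k)) < e / 6.
  by apply: kP; rewrite (repP (prefix_of z k) z).
have [mg intg] := cintegral_prefix k g.
have lim : (fun l => \sum_(s : k.-tuple bool) (empirical (M l) s)%:C * g s) @ \oo -->
    \sum_(s : k.-tuple bool) (w s)%:C * g s.
  apply: cvg_sumr => s _.
  have wC : (fun l => (empirical (M l) s)%:C : R[i]) @ \oo --> (w s)%:C.
    by apply: (cvg_comp _ _ (@Mw s)); exact: real_complex_continuous.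
  exact: (cvgM wC (cvg_cst (g s))).
rewrite -intg in lim; move/cvg_cabsP: lim => /(_ _ e4); apply: filterS => l.
rewrite -cmean_prefix => close.
have d1 : cabs (cmean (M l) (fun n => F (c n)) - cmean (M l) (fun n => g (prefix_of (c n) k))) <= e / 6.
  rewrite -cmeanB (le_trans (cabs_cmean _ _)) //.
  apply: le_trans (mean_cst_le (M l) (ltW e4)); apply: ler_mean => n _.
  exact: ltW (Fg _).
have iF : cintegrable P (F \o theta).
  apply: L2_integrable => //; apply: (@bounded_L2 _ _ _ _ _ B) => // t.
  exact: FB.
have ig : cintegrable P (fun t => g (prefix_of (theta t) k)).
  apply: L2_integrable => //; apply: (@bounded_L2 _ _ _ _ _ B) => // t.
  exact: FB.
have d2 : cabs (cintegral P (F \o theta) - cintegral P (fun t => g (prefix_of (theta t) k))) <= e / 3.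
  rewrite -cintegralB // (le_trans (cabs_le_ReIm _)) //=.
  have part (r : R[i] -> R) : (forall z, `|r z| <= cabs z) ->
      P.-integrable setT (EFin \o (fun t => r ((F \o theta) t - g (prefix_of (theta t) k)))) ->
      `|\int[P]_t r ((F \o theta) t - g (prefix_of (theta t) k))| <= e / 6.
    move=> rz ir; apply: (le_trans (le_normr_Rintegral measurableT ir)).
    apply: (@le_trans _ _ (\int[P]_t (e / 6))).
      apply: le_Rintegral => //.
      - by have := integrable_norm ir; congr (P.-integrable _ _).
      - exact: (@cst_integrable _ _ _ P (e / 6)).
      - by move=> t _; apply: (le_trans (rz _)); exact: ltW (Fg _).
    rewrite (Rintegral_cst P measurableT (e / 6)).
    have -> : fine (P setT) = 1 by rewrite (_ : P setT = 1%E) //; exact: probability_setT.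
    by rewrite mulr1.
  have iB := cintegrableD iF (cintegrableZ (-1) ig).
  rewrite (_ : (fun y => _ + -1 * _) = (fun t => (F \o theta) t - g (prefix_of (theta t) k))) in iB; last first.
    by apply/funext => t; rewrite mulN1r.
  have [i1 i2] := iB.
  rewrite (_ : e / 3 = e / 6 + e / 6); last by field.
  by apply: lerD; apply: part => //; [exact: Re_cabs|exact: Im_cabs].
set a := cmean _ _ in d1 *; set b := cmean _ _ in d1 close.
set i1 := cintegral _ _ in d2 *; set i2 := cintegral _ _ in d2 close.
have -> : a - i1 = (a - b) + (b - i2) + (i2 - i1) by ring.
rewrite (le_lt_trans (cabsD _ _)) // (le_lt_trans (lerD (cabsD _ _) (lexx _))) //.
rewrite [cabs (i2 - i1)]cabsB; lra.
Qed.

End empirical_limit.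

(** An orbit in a compact metric space has quasi-generic measures: the orbit
    is lifted to the Cantor space, where the frequencies of all prefixes
    converge along a subsequence, and the limit frequencies are realised by a
    quantile function on $[0,1)$. *)
Lemma quasi_generic_exists (R : realType) (X : pmetricType R) (T : X -> X) (x : X)
    (M : nat -> nat) : compact [set: X] -> increasing M ->
  exists2 phi : nat -> nat, increasing phi &
    exists nu : probability (borel X) R, quasi_generic T x (M \o phi) nu.
Proof.
move=> cX incM.
have [p cp] := @cantor_surj R X cX (@metric_hausdorff R X).
have /choice [c cE] : forall n, exists z, p z = iter n T x.
  move=> n; have [z _ zE] := @surj _ _ setT setT p (iter n T x) I.
  by exists z.
have [phi [incphi [w wP]]] := convergent_subsequence (fun l s => empirical01 R c (M l) s).
have incMphi : increasing (M \o phi) by move=> m n /incphi/incM.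
pose theta := quantile w.
have mtheta : measurable_fun [set: measurableTypeR R] (p \o theta : R -> borel X).
  apply: (@measurability _ _ (measurableTypeR R) (borel X) setT _ (@open X)) => //.
  move=> _ [U oU <-]; rewrite setTI.
  have oV : open (p @^-1` U) by apply: open_comp => // z _; exact: cp.
  pose A (s : seq bool) := [set t : R | prefix_of (theta t) (size s) = s /\
    forall z, prefix_of z (size s) = s -> (p @^-1` U) z].
  have [en enP] : exists en : nat -> seq bool, forall s, exists n, en n = s.
    by exists (fun n => odflt [::] (unpickle n)) => s; exists (pickle s); rewrite pickleK.
  rewrite (_ : _ @^-1` U = \bigcup_n (A (en n))).
    apply: (@bigcupT_measurable _ (measurableTypeR R)) => n.
    move: (en n) => s.
    have [H|H] := pselect (forall z, prefix_of z (size s) = s -> (p @^-1` U) z).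
      rewrite (_ : A s = [set t : R | prefix_of (theta t) (size s) = s]).
        exact: quantile_cylinder_measurable.
      by apply/seteqP; split=> t // [].
    by rewrite (_ : A s = set0) //; apply/seteqP; split=> t // [].
  apply/seteqP; split=> [t Ut|t [n _]].
    have [k kU] := nbhs_cylinder (open_nbhs_nbhs (conj oV (Ut : (p @^-1` U) (theta t)))).
    have [n nE] := enP (prefix_of (theta t) k); exists n => //; rewrite nE /A /= size_prefix_of.
    by split=> // z zk; exact: kU.
  by move: (en n) => s [ts]; apply.
pose pm : {mfun measurableTypeR R >-> borel X} := mfun_Sub (mem_set mtheta).
exists phi => //; exists (distribution (@unit_measure R) pm) => f cf.
have cF : continuous (f \o p).
  by move=> z; apply: (@continuous_comp _ _ _ p f); [exact: cp|exact: cf].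
have mF : @cmeas R _ (measurableTypeR R) ((f \o p) \o theta).
  have [mr mi] := continuous_cmeas cf; split.
    exact: (measurableT_comp mr mtheta).
  exact: (measurableT_comp mi mtheta).
have [B fB] := @continuous_bounded R X cX f cf.
have FB : forall z, cabs ((f \o p) z) <= B by move=> z; exact: fB.
have := empirical_integral incMphi wP cF mF (ex_intro _ B FB).
rewrite (_ : (fun l => cmean _ _) = (fun l => ((M \o phi) l)%:R^-1 *
    \sum_(1 <= n < ((M \o phi) l).+1) f (iter n T x))); last first.
  by apply/funext => l; congr (_ * _); apply: eq_bigr => n _; rewrite /= cE.
suff -> : cintegral (@unit_measure R) ((f \o p) \o theta) = cintegral (distribution (@unit_measure R) pm) f by [].
have [mr mi] := continuous_cmeas cf.
have iF : cintegrable (@unit_measure R) ((f \o p) \o theta).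
  apply: L2_integrable => //; apply: (@bounded_L2 _ _ _ _ _ B) => // t.
  exact: FB.
have [ir ii] := iF.
have inv (h : borel X -> R) : measurable_fun setT h ->
    (@unit_measure R).-integrable setT (EFin \o (h \o (p \o theta))) ->
    \int[@unit_measure R]_t h (p (theta t)) = \int[distribution (@unit_measure R) pm]_y h y.
  move=> mh ih; congr fine.
  by rewrite (@integral_distribution _ _ _ _ _ _ pm (EFin \o h)) //; exact/measurable_EFinP.
by apply/eqP; rewrite eq_complex /=; apply/andP; split; apply/eqP; apply: inv.
Qed.

(** * Consequences of small exponential sums *)

Section generic_means.
Context {R : realType} {X : ptopologicalType}.
Variables (T : X -> X) (x : X) (N : nat -> nat) (nu : probability (borel X) R).
Hypothesis gx : quasi_generic T x N nu.

Lemma generic_L2norm2 (r : X -> R[i]) : continuous r ->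
  (fun l => mean (N l) (fun n => cabs (r (iter n T x)) ^+ 2)) @ \oo
    --> fine (L2norm2 nu (r : borel X -> R[i])).
Proof.
move=> cr.
have cr2 : continuous (fun y => (cabs (r y) ^+ 2)%:C : R[i]).
  rewrite (_ : (fun y => _) = fun y => r y * conjc (r y)); last first.
    by apply/funext => y; rewrite cabs2.
  exact: (@continuous_mulr _ X r (fun y => conjc (r y)) cr (continuous_conjc cr)).
have lim := cvgn_Re (gx cr2); rewrite (_ : (fun l => _) = (fun l => complex.Re
    (cmean (N l) (fun n => (cabs (r (iter n T x)) ^+ 2)%:C)))); first exact: lim.
by apply/funext => l; rewrite cmean_real.
Qed.

(** By $2|r|\le t+|r|^2/t$, a form of the Cauchy-Schwarz inequality. *)
Lemma generic_small_mean (r : X -> R[i]) (t : R) : continuous r -> 0 < t ->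
  (L2norm2 nu (r : borel X -> R[i]) < (t ^+ 2)%:E)%E ->
  \forall l \near \oo, mean (N l) (fun n => cabs (r (iter n T x))) <= t.
Proof.
move=> cr t0 rt.
have r0 := N2_ge0 nu (r : borel X -> R[i]).
have rfin : L2norm2 nu (r : borel X -> R[i]) \is a fin_num.
  by rewrite ge0_fin_numE // (lt_trans rt) // ltry.
have rt' : fine (L2norm2 nu (r : borel X -> R[i])) < t ^+ 2 by rewrite -lte_fin fineK.
have := @cvgr_lt R nat \oo eventually_filter _ _ (generic_L2norm2 cr) _ rt'.
apply: filterS => l lt.
apply: (@le_trans _ _ (mean (N l) (fun n => t / 2 + (2 * t)^-1 * cabs (r (iter n T x)) ^+ 2))).
  apply: ler_mean => n _; set c := cabs _.
  rewrite -(ler_pM2l (mulr_gt0 (ltr0n R 2) t0)) mulrDr mulVKf ?mulf_neq0 ?lt0r_neq0 //.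
  by have := sqr_ge0 (t - c); nra.
rewrite meanD [leRHS]splitr lerD //.
  exact: (mean_cst_le (N l) (ltW (divr_gt0 t0 (ltr0n R 2)))).
rewrite meanZ.
rewrite -(ler_pM2l (mulr_gt0 (ltr0n R 2) t0)) mulVKf ?mulf_neq0 ?lt0r_neq0 //.
by apply: (le_trans (ltW lt)); rewrite le_eqVlt; apply/orP; left; apply/eqP; field.
Qed.

End generic_means.

Section orthogonality_along_generic_points.
Context {R : realType} {X : pmetricType R}.
Variables (T : X -> X) (x : X) (N : nat -> nat) (nu : probability (borel X) R).
Variable u : nat -> R[i].
Hypothesis cX : compact [set: X].
Hypothesis cT : continuous T.
Hypothesis incN : increasing N.
Hypothesis gx : quasi_generic T x N nu.
Hypothesis mT : measurable_fun setT (T : borel X -> borel X).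
Hypothesis pT : forall B : set (borel X), measurable B -> nu (T @^-1` B) = nu B.
Hypothesis u1 : forall n, (0 < n)%N -> cabs (u n) <= 1.
Hypothesis short : small_exponential_sums u.

Let corr (phi : X -> R[i]) l := cmean (N l) (fun n => phi (iter n T x) * u n).

(** Approximability in the square norm by continuous functions that are
    almost orthogonal to [u] along the orbit; unlike the orthogonality of $w$
    itself, it makes sense for functions defined up to null sets. *)
Definition asymptotically_orthogonal (w : borel X -> R[i]) : Prop :=
  cmeas w /\ forall e : R, 0 < e -> exists2 phi : X -> R[i], continuous phi &
    (L2norm2 nu (fun y => w y - phi y)%R < e%:E)%E /\
    \forall l \near \oo, cabs (corr phi l) < e.

Lemma asymptotically_orthogonal0 : asymptotically_orthogonal (cst 0).
Proof.
split; first exact: cmeas_cst.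
move=> e e0; exists (cst 0); first exact: cst_continuous.
split.
  apply: (N2_lt e0); rewrite (_ : (fun y => _) = cst 0) ?N2_cst ?cabs0 ?expr0n //.
  by apply/funext => y; rewrite subrr.
apply: nearW => l; rewrite (_ : corr _ l = 0) ?cabs0 //.
by rewrite /corr /cst (cmeanZ (N l) 0 u) mul0r.
Qed.

Lemma asymptotically_orthogonalD v w : asymptotically_orthogonal v ->
  asymptotically_orthogonal w -> asymptotically_orthogonal (fun y => v y + w y).
Proof.
move=> [mv vP] [mw wP]; split; first exact: cmeasD.
move=> e e0; have e4 : 0 < e / 4 by rewrite divr_gt0.
have [phi cphi [vphi phiu]] := vP _ e4; have [psi cpsi [wpsi psiu]] := wP _ e4.
exists (fun y => phi y + psi y); first exact: (@continuous_addr _ X phi psi cphi cpsi).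
have mphi := continuous_cmeas cphi; have mpsi := continuous_cmeas cpsi.
split.
  have := N2D_lt (cmeasB mv mphi) (cmeasB mw mpsi) vphi wpsi.
  rewrite (_ : 2 * _ = e); last by field.
  by rewrite (_ : (fun y => _) = (fun y => v y + w y - (phi y + psi y))) //;
     apply/funext => y; rewrite opprD addrACA.
apply: filterS2 phiu psiu => l pl sl.
rewrite (_ : corr _ l = corr phi l + corr psi l); last first.
  by rewrite /corr -cmeanD; apply: eq_cmean => n _; rewrite mulrDl.
by rewrite (le_lt_trans (cabsD _ _)) //; lra.
Qed.

Lemma asymptotically_orthogonalZ c w : asymptotically_orthogonal w ->
  asymptotically_orthogonal (fun y => c * w y).
Proof.
move=> [mw wP]; split; first exact: cmeasZ.
move=> e e0; pose d := e / (cabs c ^+ 2 + cabs c + 1).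
have k0 := cabs_ge0 c; have k2 := sqr_ge0 (cabs c).
have D0 : 0 < cabs c ^+ 2 + cabs c + 1 by lra.
have d0 : 0 < d by rewrite divr_gt0.
have dE : e = cabs c ^+ 2 * d + cabs c * d + d.
  by rewrite /d; field; exact: lt0r_neq0.
have [phi cphi [wphi phiu]] := wP _ d0.
have mphi := continuous_cmeas cphi.
exists (fun y => c * phi y).
  exact: (@continuous_mulr _ X (cst c) phi (@cst_continuous X R[i] c) cphi).
split.
  rewrite (_ : (fun y => _) = (fun y => c * (w y - phi y))); last first.
    by apply/funext => y; rewrite mulrBr.
  rewrite N2Z; last exact: cmeasB.
  apply: (@le_lt_trans _ _ ((cabs c ^+ 2)%:E * d%:E)%E).
    by apply: lee_wpmul2l; [rewrite lee_fin|exact: ltW].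
  by rewrite -EFinM lte_fin dE; have := mulr_ge0 k0 (ltW d0); lra.
apply: filterS phiu => l pl.
rewrite (_ : corr _ l = c * corr phi l); last first.
  by rewrite /corr -cmeanZ; apply: eq_cmean => n _; rewrite mulrA.
rewrite cabsM; apply: (le_lt_trans (ler_wpM2l k0 (ltW pl))).
by rewrite dE; have := mulr_ge0 k2 (ltW d0); lra.
Qed.

Lemma asymptotically_orthogonal_sum n (c : 'I_n -> R[i]) (g : 'I_n -> borel X -> R[i]) :
  (forall i, asymptotically_orthogonal (g i)) ->
  asymptotically_orthogonal (fun y => \sum_(i < n) c i * g i y).
Proof.
move=> gP; pose P (r : seq 'I_n) := asymptotically_orthogonal (fun y => \sum_(i <- r) c i * g i y).
suff : P (index_enum 'I_n) by [].
elim: (index_enum _) => [|i r IH]; rewrite /P.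
  rewrite (_ : (fun y => _) = cst 0); first exact: asymptotically_orthogonal0.
  by apply/funext => y; rewrite big_nil.
have := asymptotically_orthogonalD (asymptotically_orthogonalZ (c i) (gP i)) IH.
by congr asymptotically_orthogonal; apply/funext => y; rewrite big_cons.
Qed.

Lemma corr_split (phi : X -> R[i]) (lam : R[i]) H l :
  H%:R * corr phi l =
  \sum_(h < H) (corr phi l - cmean (N l) (fun n => phi (iter (n + h) T x) * u (n + h)%N)) +
  \sum_(h < H) cmean (N l) (fun n => (phi (iter (n + h) T x) - lam ^+ h * phi (iter n T x)) * u (n + h)%N) +
  cmean (N l) (fun n => phi (iter n T x) * \sum_(h < H) lam ^+ h * u (n + h)%N).
Proof.
under [X in cmean _ X]eq_fun do rewrite mulr_sumr.
rewrite cmean_sum -!big_split /= mulr_natl -[in LHS](card_ord H) -sumr_const.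
apply: eq_bigr => h _; rewrite -addrA -cmeanD.
rewrite [X in _ + X](_ : _ = cmean (N l) (fun n => phi (iter (n + h) T x) * u (n + h)%N)) ?subrK //.
by apply: eq_cmean => n _; ring.
Qed.

(** For a continuous $\phi$ close to the eigenfunction, $\phi(T^{n+h}x)$ is
    close to $\lambda^h\phi(T^nx)$ for most $n$, with an error independent of
    $h$; averaging over $h<H$ leaves the short exponential sums of [u] at
    $\lambda$. *)
Lemma asymptotically_orthogonal_eigen lam g : eigenfunction nu T measurable lam g ->
  asymptotically_orthogonal g.
Proof.
move=> eg; have [/L2_cmeas [mg g2] gT] := eg.
split=> // e e0.
have [l1|g0] := eigenvalue_unimodular mT pT eg; last first.
  exists (cst 0); first exact: cst_continuous.
  split.
    rewrite (_ : (fun y => _) = g); first by rewrite g0 lte_fin.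
    by apply/funext => y; rewrite subr0.
  apply: nearW => l; rewrite (_ : corr _ l = 0) ?cabs0 //.
  by rewrite /corr /cst (cmeanZ (N l) 0 u) mul0r.
pose t := e / 4; have t0 : 0 < t by rewrite divr_gt0.
(* With N2 (g - phi) < d the square norm of psi h is below 4d. *)
pose d := Num.min e (t ^+ 2 / 4).
have d0 : 0 < d by rewrite lt_min e0 divr_gt0 ?exprn_gt0.
have [phi cphi gphi] := continuous_dense cX (@opens_are_cozero_metric R X) mg g2 d0.
have mphi := continuous_cmeas cphi.
have de : d <= e by rewrite ge_min lexx.
have dt : d <= t ^+ 2 / 4 by rewrite ge_min lexx orbT.
exists phi => //; split; first by apply: lt_le_trans gphi _; rewrite lee_fin.
pose psi h y := phi (iter h T y) - lam ^+ h * phi y.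
have ciT h : continuous (fun y => phi (iter h T y)).
  by move=> y; apply: (@continuous_comp _ _ _ (iter h T) phi); [exact: continuous_iter|exact: cphi].
have cpsi h : continuous (psi h).
  have cl := @continuous_mulr _ X (cst (lam ^+ h)) phi (@cst_continuous X R[i] _) cphi.
  exact: (@continuous_addr _ X _ _ (ciT h) (@continuous_oppr _ X _ cl)).
have psi2 h : (L2norm2 nu (psi h : borel X -> R[i]) < (t ^+ 2)%:E)%E.
  have mD : cmeas (fun y : borel X => g y - phi y) by exact: cmeasB.
  have mDT : @cmeas R _ (borel X) (fun y => g (iter h T y) - phi (iter h T y)).
    exact: (cmeas_comp (iter_measurable mT h) mD).
  (* The eigenfunction cancels almost everywhere. *)
  rewrite (@N2_ae _ _ (borel X) nu (psi h)
    (fun y => lam ^+ h * (g y - phi y) - (g (iter h T y) - phi (iter h T y)))).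
  - apply: (@lt_le_trans _ _ (2 * (d + d))%:E).
      apply: N2B_lt => //; first exact: cmeasZ.
        by rewrite N2Z // cabsX l1 expr1n expr1n mul1e.
      rewrite (N2_comp (iter_measurable mT h) (iter_preserving mT pT h) mD).
      exact: gphi.
    by rewrite lee_fin; lra.
  - exact: continuous_cmeas.
  - by apply: cmeasB => //; exact: cmeasZ.
  have := eigen_iter mT pT h gT; apply: filterS => y gy.
  by rewrite /psi gy; ring.
have [B phiB] := continuous_bounded cX cphi.
have B0 : 0 <= B by apply: le_trans (phiB x); exact: cabs_ge0.
have d'0 : 0 < t / (B + 1) by rewrite divr_gt0 // ltr_pwDr.
have [H0 H0P] := short l1 d'0; have [N0 N0P] := H0P _ (leqnSn H0).
pose H := H0.+1.
have small_psi : \forall l \near \oo, forall h : 'I_H,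
    mean (N l) (fun n => cabs (psi h (iter n T x))) <= t.
  apply: (@filter_forall _ _ (fun (h : 'I_H) l =>
    mean (N l) (fun n => cabs (psi h (iter n T x))) <= t) \oo eventually_filter) => h.
  exact: (generic_small_mean gx (@cpsi h) t0 (psi2 h)).
have boundary := near_div_increasing (2 * H%:R * B) incN t0.
have late : \forall l \near \oo, (N0 <= N l)%N.
  by exists N0 => // l /= Nl; exact: leq_trans Nl (increasing_leq incN l).
apply: filterS3 small_psi boundary late => l lpsi lbd lN.
have H_gt0 : 0 < H%:R :> R by rewrite ltr0n.
suff : H%:R * cabs (corr phi l) <= H%:R * (3 * t).
  by rewrite ler_pM2l // => /le_lt_trans; apply; rewrite /t; lra.
have -> : H%:R * cabs (corr phi l) = cabs (H%:R * corr phi l) by rewrite cabsM cabs_nat.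
rewrite (corr_split phi lam).
have sumt (F : 'I_H -> R[i]) : (forall h, cabs (F h) <= t) -> cabs (\sum_(h < H) F h) <= H%:R * t.
  move=> Ft; apply: (le_trans (cabs_sum _ _ _)); apply: (@le_trans _ _ (\sum_(h < H) t)).
    exact: ler_sum.
  by rewrite sumr_const card_ord mulr_natl.
have -> : H%:R * (3 * t) = H%:R * t + H%:R * t + H%:R * t by ring.
apply: (le_trans (cabsD _ _)); apply: lerD; [apply: (le_trans (cabsD _ _)); apply: lerD|].
- apply: sumt => h; rewrite cabsB; set w := fun n => phi (iter n T x) * u n.
  have wB n : (0 < n)%N -> cabs (w n) <= B.
    move=> n0; rewrite /w cabsM -[leRHS]mulr1 ler_pM ?cabs_ge0 //; exact: u1.
  apply: (le_trans (cmean_shift (N l) h wB)); apply: ltW; apply: le_lt_trans lbd.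
  rewrite ler_wpM2r ?invr_ge0 // ler_wpM2r // ler_wpM2l // ler_nat; exact: ltnW.
- apply: sumt => h; apply: (le_trans (cabs_cmean _ _)); apply: le_trans (lpsi h).
  apply: ler_mean => n n0; rewrite cabsM -[leRHS]mulr1 ler_pM ?cabs_ge0 //.
    by rewrite /psi addnC iterD lexx.
  by apply: u1; rewrite addn_gt0 n0.
apply: (le_trans (cabs_cmean _ _)).
apply: (@le_trans _ _ (mean (N l) (fun n => B * cabs (\sum_(h < H) lam ^+ h * u (n + h)%N)))).
  by apply: ler_mean => n _; rewrite cabsM ler_wpM2r ?cabs_ge0.
rewrite meanZ.
have := N0P _ lN; rewrite -/H => S.
have : mean (N l) (fun n => cabs (\sum_(h < H) lam ^+ h * u (n + h)%N)) <= t / (B + 1) * H%:R.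
  have [N0'|N1] := posnP (N l).
    by rewrite /mean N0' invr0 mul0r mulr_ge0 // ltW.
  by rewrite /mean mulrC ler_pdivrMr ?ltr0n.
move=> /(ler_wpM2l B0) /le_trans; apply.
rewrite mulrA mulrC ler_wpM2l // mulrA ler_pdivrMr ?ltr_pwDr //.
by have := ltW t0; lra.
Qed.

Lemma discrete_spectrum_corr (f : X -> R[i]) : discrete_spectrum nu T measurable ->
  continuous f -> forall e : R, 0 < e -> \forall l \near \oo, cabs (corr f l) < e.
Proof.
move=> dT cf e e0; have mf := continuous_cmeas cf.
have [M fM] := continuous_bounded cX cf.
have Lf : L2 nu measurable (f : borel X -> R[i]).
  by apply/L2_cmeas; split=> //; exact: (@bounded_L2 _ _ _ _ _ M).
pose t := e / 2; have t0 : 0 < t by rewrite divr_gt0.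
have d0 : 0 < t ^+ 2 / 4 by rewrite divr_gt0 ?exprn_gt0.
have [n [c [lam [g [eg fg]]]]] := dT _ Lf _ d0.
have [mw wP] := asymptotically_orthogonal_sum c (fun i => asymptotically_orthogonal_eigen (eg i)).
have m0 : 0 < Num.min t (t ^+ 2 / 4) by rewrite lt_min t0.
have [phi cphi [wphi phiu]] := wP _ m0.
have mphi := continuous_cmeas cphi.
have cr : continuous (fun y => f y - phi y).
  exact: (@continuous_addr _ X _ _ cf (@continuous_oppr _ X _ cphi)).
have r2 : (L2norm2 nu (fun y : borel X => f y - phi y)%R < (t ^+ 2)%:E)%E.
  have wphi' := lt_le_trans wphi (_ : _ <= (t ^+ 2 / 4)%:E)%E.
  have {wphi'}wphi' := wphi' ltac:(by rewrite lee_fin ge_min lexx orbT).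
  have := N2D_lt (cmeasB mf mw) (cmeasB mw mphi) fg wphi'.
  rewrite (_ : 2 * _ = t ^+ 2); last by field.
  by rewrite (_ : (fun y => _) = (fun y => f y - phi y)) //;
     apply/funext => y; rewrite addrA subrK.
have rsmall := generic_small_mean gx cr t0 r2.
apply: filterS2 rsmall phiu => l rl pl.
rewrite (_ : corr f l = cmean (N l) (fun n => (f (iter n T x) - phi (iter n T x)) * u n) + corr phi l); last first.
  by rewrite /corr -cmeanD; apply: eq_cmean => k _; rewrite -mulrDl subrK.
rewrite (le_lt_trans (cabsD _ _)) // [e]splitr ler_ltD //; last first.
  by apply: lt_le_trans pl _; rewrite ge_min lexx.
apply: (le_trans (cabs_cmean _ _)); apply: le_trans rl.
by apply: ler_mean => k k0; rewrite cabsM -[leRHS]mulr1 ler_pM ?cabs_ge0 //; exact: u1.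
Qed.

End orthogonality_along_generic_points.

Section sequences_with_small_exponential_sums.
Variables (R : realType) (u : nat -> R[i]) (u0 : R[i]).
Hypothesis u1 : forall n, (0 < n)%N -> cabs (u n) <= 1.
Hypothesis u01 : cabs u0 <= 1.
Hypothesis short : small_exponential_sums u.

(** Times along which the means stay away from 0 would have a subsequence
    that generates a visible measure. *)
Lemma small_sums_orthogonal_C_DISP : orthogonal_C_DISP u.
Proof.
move=> X T [[cX [cT _]] dT] f cf x; apply/cvg_cabsP => e e0.
apply: contrapT => bad.
have {}bad m : exists M, (m <= M)%N /\ e <= cabs (cmean M (fun n => f (iter n T x) * u n)).
  apply: contrapT => nm; apply: bad; exists m => // M /= mM.
  by rewrite subr0 ltNge; apply/negP => eM; apply: nm; exists M.
have [nx nxP] := choice bad.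
pose fix M l := if l is l'.+1 then nx (M l').+1 else nx 0%N.
have incM : increasing M.
  move=> m n /subnK <-; elim: (n - m.+1)%N => [|k IH]; first by have [] := nxP (M m).+1.
  by rewrite addSn (ltn_trans IH) //; have [] := nxP (M (k + m.+1)%N).+1.
have badM l : e <= cabs (cmean (M l) (fun n => f (iter n T x) * u n)).
  by case: l => [|l] /=; [have [] := nxP 0%N|have [] := nxP (M l).+1].
have [phi incphi [nu gx]] := quasi_generic_exists T x cX incM.
have incMphi : increasing (M \o phi) by move=> m n /incphi/incM.
have [mT pT] := quasi_generic_invariant (@opens_are_cozero_metric R X) cT incMphi gx.
have [_ dnu] : DISP nu T.
  by apply: dT; split=> //; exists x, (M \o phi).
have [l0 _ small] := discrete_spectrum_corr cX cT incMphi gx mT pT u1 short dnu cf e0.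
have := small l0 (leqnn l0); rewrite /= ltNge => /negP; apply; exact: badM.
Qed.

Local Notation X := (Xu u u0).
Local Notation S := (@Defs.shift R u u0).

Lemma coord_le1 j (z : X) : cabs (coordinate j z) <= 1.
Proof.
rewrite leNgt; apply/negP => z1.
pose e := cabs (coordinate j z) - 1; have e0 : 0 < e by rewrite subr_gt0.
have nb : nbhs (\val z : biseq R) [set w | cabs (coordinate j z - w j) < e].
  apply: (@proj_continuous int (fun=> R[i]) j (\val z) [set v | cabs (coordinate j z - v) < e]).
  by apply/nbhs_cabs; exists e.
have [w [[k ->] wj]] := set_mem (valP z) _ nb.
have w1 : cabs (extend u u0 (j + k)) <= 1.
  by rewrite /extend; case: eqP => // jk; apply: u1; rewrite absz_gt0; apply/eqP.
have := lt_le_trans wj (lexx e); rewrite ltNge => /negP; apply.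
by apply: le_trans (ler_cabsB _ _); rewrite /e lerD2l lerN2.
Qed.

Lemma pi0_cmeas : @cmeas R _ (borel X) (@pi0 R u u0).
Proof. exact: (continuous_cmeas (@coordinate_continuous R u u0 0)). Qed.

(** Genericity turns the norm of $\sum_{h<H}a^h\pi_0\circ S^h$ into a limit
    of means of squared short exponential sums. *)
Lemma small_sums_Veech : Veech_DISP u u0.
Proof.
move=> kappa [N [incN gN]].
have cS : continuous S := @shift_continuous R u u0.
have [mS pS] := quasi_generic_invariant (@opens_are_cozero_shift R u u0) cS incN gN.
have mS' := continuous_borel (@unshift_continuous R u u0).
have fK := kronecker_factor_exists mS pS mS' (@shiftK R u u0) (@unshiftK R u u0).
exists (kronecker kappa S); split => // g Lg.
have p2 : (L2norm2 kappa (@pi0 R u u0 : borel X -> R[i]) < +oo)%E.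
  apply: (@bounded_L2 _ _ _ _ _ 1); first exact: pi0_cmeas.
  by move=> z; exact: (coord_le1 0).
have [[_ Km _] dK _] := fK.
apply: (orthogonal_discrete mS pS pi0_cmeas p2 _ Km dK Lg).
move=> a e a1 e0; have [H0 H0P] := short a1 e0; have [N0 N0P] := H0P _ (leqnSn H0).
exists H0.+1 => //; set H := H0.+1 in N0P *.
pose phi (z : X) := \sum_(h < H) a ^+ h * coordinate h%:Z z.
have phiE : (fun z : borel X => \sum_(h < H) a ^+ h * @pi0 R u u0 (iter h S z)) = phi.
  apply/funext => z; apply: eq_bigr => h _; congr (_ * _).
  by rewrite -[LHS]/(coordinate 0 (iter h S z)) iter_shift add0r.
rewrite phiE.
have cphi : continuous phi.
  apply: (@continuous_sumr _ X _ (index_enum 'I_H) predT (fun h z => a ^+ h * coordinate h%:Z z)) => h _.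
  exact: (@continuous_mulr _ X (cst (a ^+ h)) (coordinate h%:Z) (@cst_continuous X R[i] _) (@coordinate_continuous R u u0 _)).
have phiH z : cabs (phi z) <= H%:R.
  apply: (le_trans (cabs_sum _ _ _)); apply: (@le_trans _ _ (\sum_(h < H) 1)).
    by apply: ler_sum => h _; rewrite cabsM cabsX a1 expr1n mul1r coord_le1.
  by rewrite sumr_const card_ord.
have phi2 : (L2norm2 kappa (phi : borel X -> R[i]) < +oo)%E.
  by apply: (@bounded_L2 _ _ _ _ _ H%:R); [exact: continuous_cmeas|].
have phif : L2norm2 kappa (phi : borel X -> R[i]) \is a fin_num.
  by rewrite ge0_fin_numE // N2_ge0.
rewrite -(fineK phif) lee_fin.
have lim := generic_L2norm2 gN cphi.
rewrite -(cvg_lim (@Rhausdorff R) lim); apply: limr_le.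
  by apply/cvg_ex; eexists; exact: lim.
exists N0.+1 => // l /= Nl; have lN := leq_trans Nl (increasing_leq incN l).
apply: (@le_trans _ _ (mean (N l) (fun n => H%:R * cabs (\sum_(h < H) a ^+ h * u (n + h)%N)))).
  apply: ler_mean => n n0; have := phiH (iter n S (uXu u u0)).
  rewrite (_ : phi _ = \sum_(h < H) a ^+ h * u (n + h)%N).
    by move=> sH; rewrite expr2 ler_wpM2r ?cabs_ge0.
  by apply: eq_bigr => h _; rewrite coord_uXu.
rewrite meanZ (_ : e * H%:R ^+ 2 = H%:R * (e * H%:R)); last by ring.
rewrite ler_wpM2l // /mean mulrC ler_pdivrMr ?ltr0n; last exact: leq_trans lN.
exact: (N0P _ (ltnW lN)).
Qed.

Lemma generic_correlations N (kappa : probability (borel X) R) h k :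
  generic_along N kappa ->
  (fun l => cov u h k (N l)) @ \oo -->
    cintegral kappa (fun z : borel X => coordinate h%:Z z * conjc (coordinate k%:Z z)).
Proof.
move=> gN.
have cp : continuous (fun z : X => coordinate h%:Z z * conjc (coordinate k%:Z z)).
  apply: (@continuous_mulr _ X (coordinate h%:Z) (fun z => conjc (coordinate k%:Z z))).
    exact: coordinate_continuous.
  exact: (continuous_conjc (@coordinate_continuous R u u0 k%:Z)).
have := gN _ cp; rewrite (_ : (fun l => (N l)%:R^-1 * _) = (fun l => cov u h k (N l))) //.
by apply/funext => l; apply: eq_cmean => n n0; rewrite !coord_uXu.
Qed.

End sequences_with_small_exponential_sums.

Theorem corollary1p16 (R : realType) (u : nat -> R[i]) (u0 : R[i])
    (hu : forall n, (0 < n)%N -> `|u n| <= 1) (hu0 : `|u0| <= 1)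
    (hrot : forall a : circle R, strong_MOMO u (rotation a)) :
  [/\ Veech_DISP u u0,
      orthogonal_C_DISP u <-> Veech_DISP u u0 &
      forall N : nat -> nat, increasing N ->
      (exists kappa : probability (borel (Xu u u0)) R, generic_along N kappa) ->
      let corr h l := abs_mean (fun n => u n * conjc (u (n + h)%N)) (N l) in
      [/\ forall h, (0 < h)%N -> cvgn (corr h),
          (fun H => H%:R^-1 * \sum_(1 <= h < H.+1) limn (corr h)) @ \oo
            --> (0 : R) &
          forall (k : nat) (v : 'I_k -> nat -> R[i]), (0 < k)%N ->
          (forall i n, (0 < n)%N -> `|v i n| <= 1) ->
          let mcorr (h : 'I_k -> nat) l :=
            abs_mean (fun n => u n * \prod_(i < k) v i (n + h i)%N) (N l) in
          (* For arbitrary [v] the inner limits over l need not exist: the first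
             part is the displayed formula whenever they do, the second is
             its unconditional form, with the limsup over l outside the sum. *)
          ((forall h : 'I_k -> nat, (forall i, (0 < h i)%N) ->
              cvgn (mcorr h)) ->
            (fun H => (H%:R ^+ k)^-1 * \sum_(h : {ffun 'I_k -> 'I_H})
               limn (mcorr (fun i => (h i).+1))) @ \oo --> (0 : R)) /\
          (fun H => limn_sup (fun l =>
             (H%:R ^+ k)^-1 * \sum_(h : {ffun 'I_k -> 'I_H})
               mcorr (fun i => (h i).+1) l)) @ \oo --> (0 : R)]].
Proof.
have cabs_le1 (z : R[i]) : `|z| <= 1 -> cabs z <= 1.
  by rewrite normr_cabs -(rmorph1 (real_complex R)) lecR.
have u1 n : (0 < n)%N -> cabs (u n) <= 1 by move=> /hu/cabs_le1.
have short := momo_small_exponential_sums hrot.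
have V := small_sums_Veech u1 (cabs_le1 _ hu0) short.
split=> //; first by split=> // _; exact: small_sums_orthogonal_C_DISP.
move=> N incN [kappa gN] corr.
have covC h k := @generic_correlations R u u0 N kappa h k gN.
split.
- by move=> h _; apply/cvg_ex; eexists; exact: (@corr_cvg R u N _ covC h).
- exact: (averaged_2chowla u1 incN covC short).
move=> k v k0 v1 mcorr.
have v1' i n : (0 < n)%N -> cabs (v i n) <= 1 by move=> /(v1 i)/cabs_le1.
split; first exact: (limit_box_cvg u1 incN covC short k0 v1').
exact: (limsup_box_cvg u1 incN covC short k0 v1').
Qed.
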